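(* In the setting of the context (with $\mathcal X$, $\mathcal Y$, $\mathcal Z=\mathcal X\times\mathcal Y$, $Q$, $\nu$, $K$, $\mathcal H_K$, $g$, $\mathcal P_K(\mathcal Z)$, $r_g^\mu$ and $f_{S_m}$ as defined there), let $(\gamma_m)_{m\in\mathbb N^+}$ be a sequence of positive real numbers such that there exists a sequence of positive real numbers $(\beta_m)_{m\in\mathbb N^+}$ with $$\lim_{m\to\infty}\gamma_m=0,\qquad \lim_{m\to\infty}\beta_m\sqrt{\gamma_m}=\infty,\qquad \lim_{m\to\infty}\frac{m\gamma_m}{\beta_m^2\log m}=+\infty .$$ Let $\mathcal P_0\subset\mathcal P_K(\mathcal Z)$ satisfy the following two conditions. (U1) There exist $C_0,M\in\mathbb R_{+}$ such that $\sup_{\mu\in\mathcal P_0}\|r_g^\mu\|_{\mathcal H_K}\le C_0$ and $\sup_{\mu\in\mathcal P_0}\int_{\mathcal Y}|g|^2\,d\mu_{\mathcal Y}\le M$. (U2) Every measure belonging to the closure of $\{\mu_{\mathcal X}:\mu\in\mathcal P_0\}\subset\mathcal P(\mathcal X)$ in the weak topology of $\mathcal P(\mathcal X)$ has support $\mathcal X$. Then for every nonnegative integer $r$ and every $\varepsilon>0$, $$\lim_{m\to\infty}\ \sup_{\mu\in\mathcal P_0}\ (\mu^m)^*\bigl\{S_m\in\mathcal Z^m:\ \|f_{S_m}-r_g^\mu\|_{C^r(\mathcal X)}\ge\varepsilon\bigr\}=0 .$$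
   Context: $\mathcal X\subset\mathbb R^d$ is a compact smooth Riemannian submanifold (with induced metric), $\mathcal Y$ is a measurable space, $\mathcal Z=\mathcal X\times\mathcal Y$, and $\mathcal P(\cdot)$ denotes the set of probability measures; the weak topology of $\mathcal P(\mathcal X)$ is the topology of weak convergence of probability measures (testing against continuous functions). $Q\subset\mathbb R^d$ is a compact rectangle with $\mathcal X\subset\operatorname{int}(Q)$, and $\nu$ is the normalized Lebesgue measure on $Q$. $K:\mathcal X\times\mathcal X\to\mathbb R$ is a smooth Mercer kernel (smooth, symmetric, positive semidefinite) and $\mathcal H_K$ is its reproducing kernel Hilbert space, which consists of smooth functions on $\mathcal X$. $\|\cdot\|_{C^r(\mathcal X)}$ is the usual $C^r$-norm on the compact manifold $\mathcal X$. $g:\mathcal Y\to\mathbb R$ is a fixed measurable function. For $\mu\in\mathcal P(\mathcal Z)$, $\mu_{\mathcal X},\mu_{\mathcal Y}$ are its marginals. It is assumed throughout that every $\mu$ considered admits a regular conditional probability $\mu_{\mathcal Y|\mathcal X}:\mathcal X\to\mathcal P(\mathcal Y)$ with respect to the projection to $\mathcal X$; the regular conditional expectation is $r_g^\mu(x)=\int_{\mathcal Y}g(y)\,d\mu_{\mathcal Y|\mathcal X}(y\mid x)$ (for $g\in L^1(\mu_{\mathcal Y})$), defined up to $\mu_{\mathcal X}$-a.e. equality. $\mathcal P_K(\mathcal Z)$ is the set of all such $\mu\in\mathcal P(\mathcal Z)$ satisfying: (i) $\operatorname{supp}(\mu_{\mathcal X})=\mathcal X$; (ii) the conditional expectation admits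 a version $r_g^\mu\in\mathcal H_K$ (this version is what $r_g^\mu$ denotes). For $a,x\in\mathbb R^d$ let $I^{(d)}(a,x)=\prod_{i=1}^d 1_{[0,\infty)}(a_i-x_i)$. For $S_m=((x_1,y_1),\dots,(x_m,y_m))\in\mathcal Z^m$, $f\in\mathcal H_K$ and $a\in Q$ set $$(A_{S_m}f)(a)=\frac1m\sum_{i=1}^m I^{(d)}(a,x_i)f(x_i),\qquad B^g_{S_m}(a)=\frac1m\sum_{i=1}^m I^{(d)}(a,x_i)g(y_i).$$ For $\gamma_m>0$, $f_{S_m}\in\mathcal H_K$ is the unique minimizer over $f\in\mathcal H_K$ of $$\|A_{S_m}f-B^g_{S_m}\|_{L^2(Q,\nu)}^2+\gamma_m\|f\|_{\mathcal H_K}^2 .$$ $(\mu^m)^*$ is the outer measure defined by the product measure $\mu^m$ on $\mathcal Z^m$. *)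

(* Defs.v *)
From HB Require Import structures.
From mathcomp Require Import all_boot all_order all_algebra.
From mathcomp Require Import all_classical all_reals all_analysis.

Set Implicit Arguments.
Unset Strict Implicit.
Unset Printing Implicit Defensive.

Import Order.TTheory GRing.Theory Num.Theory.
Import numFieldNormedType.Exports.

Local Open Scope classical_set_scope.
Local Open Scope ring_scope.

Definition iter_derive {R : realType} {V W : normedModType R} (vs : seq V)
    (f : V -> W) : V -> W :=
  foldr (fun v (h : V -> W) x => 'D_v h x) f vs.

(* C^infinity on an open set U: all iterated directional derivatives exist and
   are continuous on U. It is only used with V finite-dimensional. *)
Definition smooth_on {R : realType} {V W : normedModType R} (U : set V)
    (f : V -> W) : Prop :=
  forall (vs : seq V) (x : V), U x ->
    {for x, continuous (iter_derive vs f)} /\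
    forall v : V, derivable (iter_derive vs f) x v.

(* (U, phi) is a local parametrization of X: phi restricted to the open set U is
   a smooth immersion and a homeomorphism onto an open subset of X, where the
   type X carries the subspace topology. The values of phi outside U are
   irrelevant. *)
Record local_param {R : realType} {d n : nat} (X : set 'rV[R]_d)
    (U : set 'rV[R]_n) (phi : 'rV[R]_n -> X) : Prop := LocalParam {
  lp_open : open U ;
  lp_smooth : smooth_on U (fun u => set_val (phi u)) ;
  lp_immersion : forall (u v : 'rV[R]_n), U u -> v != 0 ->
    'D_v (fun u => set_val (phi u)) u != 0 ;
  lp_inj : {in U &, injective phi} ;
  lp_image_open : forall W : set 'rV[R]_n, open W -> W `<=` U ->
    open (phi @` W)
}.

Definition smooth_submanifold {R : realType} {d : nat} (n : nat)
    (X : set 'rV[R]_d) : Prop :=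
  forall x : X, exists (U : set 'rV[R]_n) (phi : 'rV[R]_n -> X) (u : 'rV[R]_n),
    [/\ local_param U phi, U u & phi u = x].

(* Data fixing one of the (equivalent) C^r-norms of a compact manifold X:
   finitely many local parametrizations phi_i : U_i -> X and compact sets
   C_i in U_i whose images cover X. *)
Record finite_atlas {R : realType} {d : nat} (n : nat) (X : set 'rV[R]_d) :=
  FiniteAtlas {
  at_size : nat ;
  at_dom : 'I_at_size -> set 'rV[R]_n ;
  at_param : 'I_at_size -> 'rV[R]_n -> X ;
  at_compact : 'I_at_size -> set 'rV[R]_n ;
  at_paramP : forall i, local_param (at_dom i) (at_param i) ;
  at_compactP : forall i, compact (at_compact i) ;
  at_compact_sub : forall i, at_compact i `<=` at_dom i ;
  at_cover : forall x : X, exists i, (at_param i @` at_compact i) x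
}.

(* max over i of the sup over C_i of the absolute values of the partial
   derivatives of order <= r of f \o phi_i; js lists the coordinates along which
   one differentiates. *)
Definition Cr_norm {R : realType} {d n : nat} {X : set 'rV[R]_d}
    (A : finite_atlas n X) (r : nat) (f : X -> R) : \bar R :=
  ereal_sup [set y | exists (i : 'I_(at_size A)) (js : seq 'I_n) (u : 'rV[R]_n),
    [/\ (size js <= r)%N, at_compact i u &
        y = `|iter_derive [seq delta_mx ord0 j | j <- js]
                          (fun w => f (at_param i w)) u|%:E]].

Definition smooth_kernel {R : realType} {d : nat} (n : nat) (X : set 'rV[R]_d)
    (K : X -> X -> R) : Prop :=
  forall (U V : set 'rV[R]_n) (phi psi : 'rV[R]_n -> X),
    local_param U phi -> local_param V psi ->
    smooth_on (U `*` V) (fun p : 'rV[R]_n * 'rV[R]_n => K (phi p.1) (psi p.2)).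

Record smooth_mercer_kernel {R : realType} {d : nat} (n : nat)
    (X : set 'rV[R]_d) (K : X -> X -> R) : Prop := SmoothMercerKernel {
  mk_smooth : smooth_kernel n K ;
  mk_sym : forall x y, K x y = K y x ;
  mk_psd : forall (k : nat) (x : 'I_k -> X) (c : 'I_k -> R),
    0 <= \sum_(i < k) \sum_(j < k) c i * c j * K (x i) (x j)
}.

(* A Hilbert space of real functions on T with reproducing kernel K (it is
   uniquely determined by K). The values of ip outside the carrier are
   irrelevant. *)
Record rkhs {R : realType} {T : Type} (K : T -> T -> R) := RKHS {
  rk_car : set (T -> R) ;
  rk_ip : (T -> R) -> (T -> R) -> R ;
  rk_zero : rk_car (fun=> 0) ;
  rk_lin : forall (a : R) (f h : T -> R), rk_car f -> rk_car h ->
    rk_car (fun x => a * f x + h x) ;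
  rk_ip_sym : forall f h, rk_car f -> rk_car h -> rk_ip f h = rk_ip h f ;
  rk_ip_lin : forall (a : R) (f h k : T -> R),
    rk_car f -> rk_car h -> rk_car k ->
    rk_ip (fun x => a * f x + h x) k = a * rk_ip f k + rk_ip h k ;
  rk_ip_ge0 : forall f, rk_car f -> 0 <= rk_ip f f ;
  rk_ip_eq0 : forall f, rk_car f -> rk_ip f f = 0 -> f = (fun=> 0) ;
  rk_complete : forall u : nat -> T -> R, (forall k, rk_car (u k)) ->
    (forall e : R, 0 < e -> exists N : nat, forall k l : nat,
       (N <= k)%N -> (N <= l)%N -> rk_ip (u k \- u l) (u k \- u l) < e) ->
    exists2 f, rk_car f &
      (fun k => rk_ip (u k \- f) (u k \- f)) @ \oo --> (0 : R) ;
  rk_kernel : forall x, rk_car (K x) ;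
  rk_reproducing : forall f x, rk_car f -> rk_ip f (K x) = f x
}.

Definition rk_norm {R : realType} {T : Type} {K : T -> T -> R} (H : rkhs K)
    (f : T -> R) : R := Num.sqrt (rk_ip H f f).

(* T with its Borel sigma-algebra. The measurable types of the library are
   pointed, hence the base point x0. *)
Definition pointed_at {T : Type} (x0 : T) : Type := T.
HB.instance Definition _ (T : choiceType) (x0 : T) :=
  Choice.on (pointed_at x0).
HB.instance Definition _ (T : choiceType) (x0 : T) :=
  isPointed.Build (pointed_at x0) x0.

Definition borel {T : topologicalType} (x0 : T) : Type :=
  @g_sigma_algebraType (pointed_at x0) (@open T).
HB.instance Definition _ (T : topologicalType) (x0 : T) :=
  Measurable.copy (borel x0) (@g_sigma_algebraType (pointed_at x0) (@open T)).

Definition marginal1 {R : realType} {d1 d2 : measure_display}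
    {T1 : measurableType d1} {T2 : measurableType d2}
    (mu : probability (T1 * T2)%type R) : probability T1 R :=
  distribution mu (mfun_Sub (mem_set measurable_fst)).

Definition marginal2 {R : realType} {d1 d2 : measure_display}
    {T1 : measurableType d1} {T2 : measurableType d2}
    (mu : probability (T1 * T2)%type R) : probability T2 R :=
  distribution mu (mfun_Sub (mem_set measurable_snd)).

(* The n-fold product measure on n-tuples; intended for sigma-finite m. *)
Fixpoint power_measure {R : realType} {dT : measure_display}
    {T : measurableType dT} (m : set T -> \bar R) (n : nat) :
    set (n.-tuple T) -> \bar R :=
  match n with
  | 0 => dirac [tuple]
  | n'.+1 => pushforward (m \x @power_measure R dT T m n')%E
                        (fun p => cons_tuple p.1 p.2)
  end.
Arguments power_measure {R dT T} m n _.

Definition lebesgue_rV (R : realType) (d : nat) :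
    set (borel (0 : 'rV[R]_d)) -> \bar R :=
  fun A => power_measure (@lebesgue_measure R) d
             [set t | A (\row_i tnth t i)].

Definition rectangle {R : realType} {d : nat} (lo hi : 'rV[R]_d) :
    set 'rV[R]_d :=
  [set a | forall i, lo ord0 i <= a ord0 i <= hi ord0 i].

Definition normalized_lebesgue {R : realType} {d : nat} (Q : set 'rV[R]_d) :
    set (borel (0 : 'rV[R]_d)) -> \bar R :=
  fun A => ((fine (lebesgue_rV Q))^-1%:E * lebesgue_rV (A `&` Q))%E.

Definition supp {R : realType} {T : topologicalType} {x0 : T}
    (P : probability (borel x0) R) : set T :=
  [set x | forall U : set T, open_nbhs x U -> (0 < P U)%E].

(* The coarsest topology on the Borel probability measures on T making
   P |-> \int f dP continuous for every continuous f; intended for compact T, on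
   which every such f is bounded. *)
Definition weak_proba (R : realType) {T : topologicalType} (x0 : T) :=
  initial_topology (fun (P : probability (borel x0) R) =>
    ((fun f => Rintegral P setT (set_val f)) :
       {ptws [set f : T -> R | continuous f] -> R})).

Definition regular_cond_proba {R : realType} {d1 d2 : measure_display}
    {T1 : measurableType d1} {T2 : measurableType d2}
    (mu : probability (T1 * T2)%type R) (k : R.-pker T1 ~> T2) : Prop :=
  forall (A : set T1) (B : set T2), measurable A -> measurable B ->
    mu (A `*` B) = (\int[marginal1 mu]_(x in A) k x B)%E.

Definition cond_exp_version {R : realType} {d1 d2 : measure_display}
    {T1 : measurableType d1} {T2 : measurableType d2} (g : T2 -> R)
    (mu : probability (T1 * T2)%type R) (f : T1 -> R) : Prop :=
  exists2 k : R.-pker T1 ~> T2, regular_cond_proba mu k &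
    {ae marginal1 mu, forall x, (\int[k x]_y (g y)%:E)%E = (f x)%:E}.

(* P_K(Z) with Z = X * Y; the integrability of g makes the regular conditional
   expectation defined. *)
Definition PK {R : realType} {d : nat} {X : set 'rV[R]_d} {x0 : X}
    {dY : measure_display} {Y : measurableType dY} (g : Y -> R)
    {K : X -> X -> R} (H : rkhs K) : set (probability (borel x0 * Y)%type R) :=
  [set mu | [/\ supp (marginal1 mu) = setT,
     (marginal2 mu).-integrable setT (EFin \o g) &
     exists2 f, rk_car H f & cond_exp_version g mu f]].

(* The version lying in H; for mu in PK it exists, and it is unique because H
   consists of continuous functions and the first marginal has full support. *)
Definition regression {R : realType} {d : nat} {X : set 'rV[R]_d} {x0 : X}
    {dY : measure_display} {Y : measurableType dY} (g : Y -> R)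
    {K : X -> X -> R} (H : rkhs K) (mu : probability (borel x0 * Y)%type R) :
    X -> R :=
  get [set f | rk_car H f /\ cond_exp_version g mu f].

Definition orthant_ind {R : realType} {d : nat} (a x : 'rV[R]_d) : R :=
  \prod_(i < d) \1_(`[0%R, +oo[%classic : set R) (a ord0 i - x ord0 i).

Definition empA {R : realType} {d : nat} {X : set 'rV[R]_d} {Y : Type} {m : nat}
    (S : m.-tuple (X * Y)) (f : X -> R) (a : 'rV[R]_d) : R :=
  m%:R^-1 * \sum_(i < m)
    orthant_ind a (set_val (tnth S i).1) * f (tnth S i).1.

Definition empB {R : realType} {d : nat} {X : set 'rV[R]_d} {Y : Type} {m : nat}
    (g : Y -> R) (S : m.-tuple (X * Y)) (a : 'rV[R]_d) : R :=
  m%:R^-1 * \sum_(i < m)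
    orthant_ind a (set_val (tnth S i).1) * g (tnth S i).2.

Definition objective {R : realType} {d : nat} {X : set 'rV[R]_d} {Y : Type}
    (Q : set 'rV[R]_d) (g : Y -> R) {K : X -> X -> R} (H : rkhs K) (gamma : R)
    {m : nat} (S : m.-tuple (X * Y)) (f : X -> R) : \bar R :=
  (\int[normalized_lebesgue Q]_(a in Q) ((empA S f a - empB g S a) ^+ 2)%:E +
   (gamma * rk_norm H f ^+ 2)%:E)%E.

(* For 0 < gamma there is exactly one minimizer. *)
Definition estimator {R : realType} {d : nat} {X : set 'rV[R]_d} {Y : Type}
    (Q : set 'rV[R]_d) (g : Y -> R) {K : X -> X -> R} (H : rkhs K) (gamma : R)
    {m : nat} (S : m.-tuple (X * Y)) : X -> R :=
  get [set f | rk_car H f /\ forall h, rk_car H h ->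
    (objective Q g H gamma S f <= objective Q g H gamma S h)%E].

(* Main.v *)
(* Write f for the regression function and h for the difference of the estimator
   and f. The residual ||A_S f - B_S||^2 is a degenerate double sum over the
   sample (the conditional expectation makes f(x) - g(y) orthogonal to functions
   of x), so its mean is O(1/m) uniformly in mu and by Markov's inequality it is
   below gamma_m with probability 1 - O(1/(m gamma_m)). On that event minimality
   bounds ||h||_H by a constant B and ||A_S h||^2 by O(gamma_m).

   Functions with ||h||_H <= B are equicontinuous, so if |h| >= eta somewhere then
   |h| >= eta/2, with a constant sign, on a ball from a fixed finite family.
   Pairing A_S h with a function on Q whose integrals over orthants are a tent
   supported in that ball bounds ||A_S h|| below by a constant times the empirical
   mass of the ball. By (U2) this mass is bounded below uniformly: otherwise an
   ultrafilter limit of the integrals against mu_X would, by the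
   Riesz representation theorem, give a measure in the weak closure that does not
   charge the ball. Hence sup |h| is small.

   Finally the bound on ||h||_H and smoothness of K bound every iterated
   directional derivative of h in charts, together with its next derivative, so
   smallness of sup |h| passes to all derivatives by interpolation. *)

Require Import Defs.
From HB Require Import structures.
From mathcomp Require Import all_boot all_order all_algebra.
From mathcomp Require Import all_classical all_reals all_analysis.
From mathcomp Require Import finmap measurable_realfun ring lra.

Set Implicit Arguments.
Unset Strict Implicit.
Unset Printing Implicit Defensive.

Import Order.TTheory GRing.Theory Num.Theory.
Import numFieldNormedType.Exports.

Local Open Scope classical_set_scope.
Local Open Scope ring_scope.

(** * Riesz representation on a compact space *)

(** Uniformity over [P0] shapes the argument: every constant of the deterministic steps is fixed
    before [mu]. Randomness is confined to one quadratic statistic and finitely many empirical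
    masses, all of which are instances of the same second moment computation; no uniform law of
    large numbers over a ball of the Hilbert space is involved.

    The estimator is not shown to be measurable in the sample. The bad event is therefore enclosed
    in a measurable one, which is all that the outer measure asks for.

    The norm bound is kept as a family of inequalities on finite combinations of values
    ([kernel_dominated]). In charts this family survives differentiation: the mixed derivative of
    the kernel dominates the derivative of the function with the same constant. Existence of
    derivatives and their local moduli of continuity all come from it.

    The limit measure is needed only through its value on an open set. Hence the Riesz theorem is
    stated with the formula for open sets, a supremum of the functional over continuous functions
    below the indicator. *)

Section depth.
Context {R : realType} {T : pseudoMetricType R}.
Implicit Types (V : set T) (x y : T).

(** A Lipschitz stand-in for the distance from [x] to the complement of [V], capped at 1. Adding the
    value 0 keeps the set nonempty for every [V] and [x]. *)
Definition depth V x : R :=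
  sup [set t | t = 0 \/ [/\ 0 < t, t <= 1 & ball x t `<=` V]].

Let depth_ub V x : has_ubound [set t : R | t = 0 \/ [/\ 0 < t, t <= 1 & ball x t `<=` V]].
Proof. by exists 1 => t [->|[]]. Qed.

Lemma depth_ge0 V x : 0 <= depth V x.
Proof. by apply: ub_le_sup => //; left. Qed.

Lemma depth_out V x : ~ V x -> depth V x = 0.
Proof.
move=> nVx; apply/eqP; rewrite eq_le depth_ge0 andbT; apply: ge_sup.
  by exists 0; left.
move=> t [->//|[t0 _ bV]]; exfalso; apply: nVx; apply: bV; exact: ballxx.
Qed.

Lemma depth_gt0 V x : open V -> V x -> 0 < depth V x.
Proof.
move=> oV Vx; have /nbhs_ballP[e /= e0 eV] := open_nbhs_nbhs (conj oV Vx).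
apply: (@lt_le_trans _ _ (Num.min e 1)); first by rewrite lt_min e0 ltr01.
apply: ub_le_sup => //; right; split; first by rewrite lt_min e0 ltr01.
  by rewrite ge_min lexx orbT.
apply: subset_trans eV; apply: le_ball; by rewrite ge_min lexx.
Qed.

Lemma depth_lipschitz V x y e : 0 < e -> ball x e y -> depth V x - e <= depth V y.
Proof.
move=> e0 xey; rewrite lerBlDr; apply: ge_sup; first by exists 0; left.
move=> t [->|[t0 t1 bV]].
  by rewrite addr_ge0 ?depth_ge0// ltW.
have [te|et] := leP t e; first by apply: (le_trans te); rewrite lerDr depth_ge0.
rewrite -lerBlDr; apply: ub_le_sup => //; right; split.
- by rewrite subr_gt0.
- by rewrite lerBlDr; apply: (le_trans t1); rewrite lerDl ltW.
- move=> z yz; apply: bV; rewrite -(subrK e t) addrC; exact: ball_triangle xey yz.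
Qed.

Lemma continuous_depth V : continuous (depth V).
Proof.
move=> x; apply/cvgrPdist_le => e e0; near=> y.
have xy : ball x e y by near: y; exact: nbhsx_ballx.
rewrite ler_norml; have := depth_lipschitz V e0 xy.
have := depth_lipschitz V e0 (ball_sym xy); lra.
Unshelve. all: by end_near. Qed.

(* Continuous functions increasing to the indicator of an open set, and equal
   to 1 eventually and locally uniformly on it. *)
Definition plateau V (N : nat) x : R := Num.min 1 (N%:R * depth V x).

Lemma continuous_plateau V N : continuous (plateau V N).
Proof.
move=> x; apply: (@continuous_min R T (cst 1) (fun x => N%:R * depth V x)); first exact: cvg_cst.
apply: continuousM; first exact: cvg_cst.
exact: continuous_depth.
Qed.

Lemma plateau_01 V N x : 0 <= plateau V N x <= 1.
Proof.
by rewrite /plateau le_min ler01/= mulr_ge0 ?depth_ge0// ge_min lexx.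
Qed.

Lemma plateau_out V N x : ~ V x -> plateau V N x = 0.
Proof. by move=> /depth_out Vx; rewrite /plateau Vx mulr0 min_r. Qed.

Lemma plateau_near V x : open V -> V x ->
  \forall x' \near x & N \near \oo, plateau V N x' = 1.
Proof.
move=> oV Vx; have d0 := depth_gt0 oV Vx.
have d2 : 0 < depth V x / 2 by rewrite divr_gt0.
exists (ball x (depth V x / 2), [set N | 2 / depth V x <= N%:R]).
  by split => /=; [exact: nbhsx_ballx|exact: nbhs_infty_ger].
move=> [x' N] /= [/(depth_lipschitz V d2) hx hN].
rewrite /plateau min_l//; rewrite ler_pdivrMr// in hN.
apply: (@le_trans _ _ (N%:R * (depth V x / 2))); first lra.
by rewrite ler_wpM2l//; lra.
Qed.

End depth.

Section continuity_lemmas.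
Context {R : realType} {T : topologicalType}.

Lemma continuous_lincomb (a : R) (f g : T -> R) : continuous f -> continuous g ->
  continuous (fun x => a * f x + g x).
Proof.
move=> cf cg x; apply: (@cvgD _ _ _ (nbhs x) _ (fun x => a * f x) g _ _ _ (cg x)).
by apply: cvgMr; exact: cf.
Qed.

Lemma continuous_sum_ord N (s : nat -> T -> R) : (forall i, continuous (s i)) ->
  continuous (fun x => \sum_(i < N) s i x).
Proof.
move=> cs; elim: N => [|N IH] x.
  under eq_fun do rewrite big_ord0; exact: cvg_cst.
under eq_fun do rewrite big_ord_recr/=; apply: cvgD; [exact: IH|exact: cs].
Qed.

End continuity_lemmas.

Section riesz.
Context {R : realType} {T : pseudoMetricType R} (x0 : T).
Hypothesis compactT : compact [set: T].
Variable L : (T -> R) -> R.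
Hypothesis L_lin : forall a (f g : T -> R), continuous f -> continuous g ->
  L (fun x => a * f x + g x) = a * L f + L g.
Hypothesis L_ge0 : forall f : T -> R, continuous f -> (forall x, 0 <= f x) -> 0 <= L f.
Hypothesis L_one : L (fun=> 1) = 1.

Let cst_cont (c : R) : continuous (fun _ : T => c).
Proof. by move=> x; exact: cvg_cst. Qed.

Let L_cst c : L (fun=> c) = c.
Proof.
have h0 : L (fun=> 0) = 0.
  have := @L_lin (-1) _ _ (@cst_cont 1) (@cst_cont 1).
  by rewrite L_one (_ : (fun x : T => _) = fun=> 0);
    [move=> ->; ring|apply/funext => x; ring].
have := @L_lin c _ _ (@cst_cont 1) (@cst_cont 0).
rewrite L_one h0 => h; transitivity (c * 1 + 0); last by ring.
by rewrite -h; congr L; apply/funext => x; ring.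
Qed.

Let L_le f g : continuous f -> continuous g -> (forall x, f x <= g x) ->
  L f <= L g.
Proof.
move=> cf cg fg; have := @L_lin (-1) f g cf cg.
have := @L_ge0 (fun x => -1 * f x + g x) (@continuous_lincomb R T (-1) f g cf cg).
have h : forall x, 0 <= -1 * f x + g x by move=> x; have := fg x; lra.
by move=> /(_ h); lra.
Qed.

Let L_sum N (s : nat -> T -> R) : (forall i, continuous (s i)) ->
  L (fun x => \sum_(i < N) s i x) = \sum_(i < N) L (s i).
Proof.
move=> cs; elim: N => [|N IH].
  rewrite big_ord0 -[RHS](L_cst 0); congr L; apply/funext => x.
  by rewrite big_ord0.
rewrite big_ord_recr/= -IH.
have := @L_lin 1 _ _ (cs N) (@continuous_sum_ord R T N s cs).
rewrite mul1r [RHS]addrC => <-; congr L; apply/funext => x.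
by rewrite big_ord_recr/= mul1r addrC.
Qed.

(** The test functions vanish outside [V], but their supports need not be contained in [V]; this
    makes the plateaus of [V] admissible. *)
Definition below (V : set T) : set (T -> R) :=
  [set f : T -> R | continuous f /\ forall x, 0 <= f x <= 1 /\ (~ V x -> f x = 0)].

Definition capacity (V : set T) : \bar R := ereal_sup [set (L f)%:E | f in below V].

Definition outer_capacity (E : set T) : \bar R :=
  ereal_inf [set capacity V | V in [set V | open V /\ E `<=` V]].

Let below0 V : below V (fun=> 0).
Proof.
by split=> [x|x]; [exact: cvg_cst|rewrite lexx ler01].
Qed.

Let below_plateau V N : below V (plateau V N).
Proof.
by split=> [|x]; [exact: continuous_plateau|split; [exact: plateau_01|exact: plateau_out]].
Qed.

Lemma capacity_ge0 V : (0 <= capacity V)%E.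
Proof.
apply: ereal_sup_ubound; exists (fun=> 0) => //=; by rewrite L_cst.
Qed.

Lemma capacity_le1 V : (capacity V <= 1)%E.
Proof.
apply: ge_ereal_sup => _ [f [cf f01] <-]; rewrite lee_fin -[leRHS](L_cst 1).
by apply: L_le => // x; have [/andP[]] := f01 x.
Qed.

Lemma le_capacity V W : V `<=` W -> (capacity V <= capacity W)%E.
Proof.
move=> VW; apply: ge_ereal_sup => _ [f [cf f01] <-]; apply: ereal_sup_ubound.
by exists f => //; split=> // x; have [-> h] := f01 x; split=> // nW; apply: h => /VW.
Qed.

Lemma capacity_setT : capacity setT = 1%E.
Proof.
apply/eqP; rewrite eq_le capacity_le1/=; apply: ereal_sup_ubound.
exists (fun=> 1); last by rewrite L_cst.
by split=> [|x]; [exact: cst_cont|rewrite ler01 lexx; split=> // /(_ Logic.I)].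
Qed.

(* Dini: by compactness finitely many plateaus dominate [f - e]. *)
Lemma capacity_bigcup (V : nat -> set T) : (forall i, open (V i)) ->
  (capacity (\bigcup_i V i) <= \sum_(i <oo) capacity (V i))%E.
Proof.
move=> oV; apply: ge_ereal_sup => _ [f [cf f01] <-].
apply/lee_addgt0Pr => e e0.
have /compact_near_coveringP/(_ nat \oo
  (fun N x => f x - e <= \sum_(i < N) plateau (V i) N x)) := compactT.
have sum0 N x : 0 <= \sum_(i < N) plateau (V i) N x.
  by apply: sumr_ge0 => i _; have /andP[] := plateau_01 (V i) N x.
case=> [x _|N _ /(_ N (leqnn N)) hN].
  (* A point of [V i] has a neighbourhood on which the plateau of index [i] is 1 for large [N], and
     [i < N] puts that plateau into the sum. Off the union [f x = 0], so [f < e] nearby. *)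
  have [[i _ Vix]|nVx] := pselect ((\bigcup_i V i) x).
    have [[A B] /= [nA nB] AB] := plateau_near (oV i) Vix.
    exists (A, B `&` [set N | (i < N)%N]) => /=.
      split=> //; apply: filterI => //; exact: nbhs_infty_gt.
    move=> [x' N] /= [Ax' [BN iN]].
    rewrite (bigD1 (Ordinal iN))//= (AB (x', N))//.
    have [/andP[_ +] _] := f01 x'.
    have : 0 <= \sum_(i0 < N | i0 != Ordinal iN) plateau (V i0) N x'.
      by apply: sumr_ge0 => k _; have /andP[] := plateau_01 (V k) N x'.
    lra.
  have fx : f x = 0 by apply: (f01 x).2.
  exists ([set x' | f x' < e], setT) => /=.
    split; last exact: filterT.
    by apply: (@cvgr_lt _ _ _ _ f (f x) (cf x)); rewrite fx.
  by move=> [x' N] /= [fe _]; have := sum0 N x'; lra.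
have : L f <= e + \sum_(i < N) L (plateau (V i) N).
  have cs i : continuous (plateau (V i) N) by exact: continuous_plateau.
  rewrite -(L_sum N cs) -{1}[e]mulr1 -{1}L_one -L_lin//.
  - apply: L_le => // [|x]; last by have := hN x I; lra.
    apply: (@continuous_lincomb R T e (fun=> 1)
        (fun x => \sum_(i < N) plateau (V i) N x)) => //.
    exact: (@continuous_sum_ord R T N (fun i => plateau (V i) N)).
  - exact: (@continuous_sum_ord R T N (fun i => plateau (V i) N)).
rewrite -lee_fin => /le_trans; apply.
rewrite EFinD addeC leeD2r// -sumEFin.
apply: (@le_trans _ _ (\sum_(i < N) capacity (V i))%E).
  apply: lee_sum => i _; apply: ereal_sup_ubound.
  by exists (plateau (V i) N).
rewrite -(big_mkord xpredT (fun i => capacity (V i))).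
by apply: nneseries_lim_ge => i _ _; exact: capacity_ge0.
Qed.

Lemma outer_capacity_open V : open V -> outer_capacity V = capacity V.
Proof.
move=> oV; apply/eqP; rewrite eq_le; apply/andP; split.
  by apply: ereal_inf_lbound; exists V => //=; split.
by apply: le_ereal_inf_tmp => _ [W [oW VW] <-]; exact: le_capacity.
Qed.

Lemma outer_capacity_ge0 E : (0 <= outer_capacity E)%E.
Proof. by apply: le_ereal_inf_tmp => _ [W _ <-]; exact: capacity_ge0. Qed.

Lemma outer_capacity0 : outer_capacity set0 = 0%E.
Proof.
rewrite outer_capacity_open; last exact: open0.
apply/eqP; rewrite eq_le capacity_ge0 andbT; apply: ge_ereal_sup => _ [f [cf f01] <-].
rewrite lee_fin -[leRHS](L_cst 0); apply: L_le => // x.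
by rewrite (f01 x).2.
Qed.

Lemma le_outer_capacity : {homo outer_capacity : A B / A `<=` B >-> (A <= B)%E}.
Proof.
move=> A B AB; apply: le_ereal_inf_tmp => _ [W [oW BW] <-].
by apply: ereal_inf_lbound; exists W => //; split=> //; exact: subset_trans BW.
Qed.

Lemma outer_capacity_fin E : outer_capacity E \is a fin_num.
Proof.
rewrite fin_real// (lt_le_trans _ (outer_capacity_ge0 E))//=.
apply: le_lt_trans (ltry 1); apply: le_trans (le_outer_capacity (@subsetT _ E)) _.
by rewrite outer_capacity_open ?capacity_setT//; exact: openT.
Qed.

Lemma outer_capacity_adherent E e : 0 < e -> exists V, [/\ open V, E `<=` V &
  (capacity V <= outer_capacity E + e%:E)%E].
Proof.
move=> e0; have := lb_ereal_inf_adherent e0 (outer_capacity_fin E).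
by move=> [_ [V [oV EV] <-] /ltW h]; exists V.
Qed.

Lemma outer_capacity_sigma_subadditive : sigma_subadditive outer_capacity.
Proof.
move=> F; apply/lee_addgt0Pr => e e0.
rewrite (le_trans _ (epsilon_trick _ _ (ltW e0)))//; last first.
  by move=> n; exact: outer_capacity_ge0.
have /choice[V hV] : forall n, exists V, [/\ open V, F n `<=` V &
    (capacity V <= outer_capacity (F n) + (e / (2 ^ n.+1)%:R)%:E)%E].
  by move=> n; apply: outer_capacity_adherent; rewrite divr_gt0.
apply: (@le_trans _ _ (capacity (\bigcup_n V n))).
  apply: ereal_inf_lbound; exists (\bigcup_n V n) => //; split.
    by apply: bigcup_open => i _; have [] := hV i.
  by apply: subset_bigcup => i _; have [] := hV i.
apply: (le_trans (capacity_bigcup _)); first by move=> i; have [] := hV i.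
apply: lee_nneseries => [i _ _|i _]; first exact: capacity_ge0.
by have [] := hV i.
Qed.

HB.instance Definition _ := isOuterMeasure.Build R T outer_capacity
  outer_capacity0 outer_capacity_ge0 le_outer_capacity
  outer_capacity_sigma_subadditive.

(** Let [f] be below the part of [W] in [V]. As [f] vanishes off [V], the part of [E] outside [V]
    lies in the open subset of [W] where [f < e]. A function [h] below that subset vanishes wherever
    [f >= e], so [h] and the truncation [fe] of [f - e] are never nonzero together and their sum is
    below [W]. Replacing [f] by [fe] costs at most [e]. *)
Lemma open_caratheodory V : open V -> outer_capacity.-caratheodory V.
Proof.
move=> oV; apply: le_caratheodory_measurable => E.
apply: le_ereal_inf_tmp => _ [W [oW EW] <-].
have hI : (outer_capacity (E `&` V) <= capacity (W `&` V))%E.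
  apply: ereal_inf_lbound; exists (W `&` V) => //; split; first exact: openI.
  exact: setSI.
apply: (le_trans (leeD2r _ hI)); rewrite -leeBrDr ?outer_capacity_fin//.
apply: ge_ereal_sup => _ [f [cf f01] <-].
rewrite leeBrDr ?outer_capacity_fin//.
apply/lee_addgt0Pr => e e0.
pose C := [set x | f x < e].
have oC : open C.
  by move/continuousP : cf => /(_ [set y | y < e]); apply; exact: open_lt.
have hD : (outer_capacity (E `&` ~` V) <= capacity (W `&` C))%E.
  apply: ereal_inf_lbound; exists (W `&` C) => //; split; first exact: openI.
  move=> x [Ex nVx]; split; first exact: EW.
  by rewrite /C/= (f01 x).2// => -[].
apply: (le_trans (leeD2l _ hD)).
rewrite -leeBrDl//; apply: ge_ereal_sup => _ [h [ch h01] <-].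
rewrite leeBrDl// -EFinD.
pose fe x := Num.max (f x - e) 0.
have cfe : continuous fe.
  move=> x; apply: (@continuous_max R T (fun x => f x - e) (cst 0)); last exact: cvg_cst.
  by apply: cvgB; [exact: cf|exact: cvg_cst].
have key : (L fe + L h)%:E%E \is a fin_num by [].
have : ((L fe + L h)%:E <= capacity W)%E.
  apply: ereal_sup_ubound; exists (fun x => 1 * fe x + h x); last by rewrite L_lin// mul1r.
  split; first exact: continuous_lincomb.
  move=> x; rewrite mul1r /fe; have [/andP[f0 f1] fV] := f01 x.
  have [/andP[h0 h1] hC] := h01 x; split.
    have [fe1|fe1] := leP e (f x).
      rewrite max_l ?subr_ge0// hC; last by rewrite /C/= => -[_]; rewrite ltNge fe1.
      by rewrite addr0 subr_ge0 fe1/=; lra.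
    by rewrite max_r ?add0r ?h0 ?h1//; lra.
  move=> nW; rewrite fV; last by case.
  by rewrite hC; [rewrite max_r ?addr0//; lra|case].
have : L f - e <= L fe.
  have := @L_lin (-e) _ _ (@cst_cont 1) cf; rewrite L_one => h1.
  have -> : L f - e = - e * 1 + L f by ring.
  rewrite -h1.
  apply: L_le => // [|x]; first exact: (@continuous_lincomb R T (- e) (fun=> 1) f).
  by rewrite /fe le_max; apply/orP; left; lra.
move=> h1 h2; rewrite addeC -leeBlDl//; apply: le_trans h2; rewrite lee_fin; lra.
Qed.

Definition riesz_measure : set (borel x0) -> \bar R := outer_capacity.

Let caratheodory_borel (A : set (borel x0)) :
  measurable A -> outer_capacity.-caratheodory A.
Proof.
move=> mA; apply: (@smallest_sub _ (sigma_algebra setT) (@open T)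
  (@caratheodory_measurable R T outer_capacity) _ _ A mA).
- split.
  + exact: caratheodory_measurable_set0.
  + by move=> B mB; rewrite setTD; exact: caratheodory_measurable_setC.
  + by move=> F mF; exact: caratheodory_measurable_bigcup.
- exact: open_caratheodory.
Qed.

Let riesz0 : riesz_measure set0 = 0%E. Proof. exact: outer_capacity0. Qed.
Let riesz_ge0 A : (0 <= riesz_measure A)%E. Proof. exact: outer_capacity_ge0. Qed.
Let riesz_semi_sigma_additive : semi_sigma_additive riesz_measure.
Proof.
move=> F mF tF mUF.
apply: (@caratheodory_measure_sigma_additive R (borel x0) outer_capacity) => //.
- by move=> i; apply: (caratheodory_borel (mF i)).
- exact: caratheodory_borel.
Qed.
HB.instance Definition _ := isMeasure.Build _ (borel x0) R riesz_measure
  riesz0 riesz_ge0 riesz_semi_sigma_additive.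
Let riesz_setT : riesz_measure setT = 1%E.
Proof.
by rewrite /riesz_measure outer_capacity_open ?capacity_setT//; exact: openT.
Qed.
HB.instance Definition _ :=
  Measure_isProbability.Build _ (borel x0) R riesz_measure riesz_setT.

Definition riesz_probability : probability (borel x0) R := riesz_measure.

Lemma riesz_probability_open V : open V -> riesz_probability V = capacity V.
Proof. exact: outer_capacity_open. Qed.

End riesz.

Section bounded_integral.
Context {R : realType} {d : measure_display} {T : measurableType d}.
Implicit Types (P : {finite_measure set T -> \bar R}) (f g : T -> R).

Lemma bounded_integrable P f B : measurable_fun setT f ->
  (forall x, `|f x| <= B) -> P.-integrable setT (EFin \o f).
Proof.
move=> mf fB; apply: measurable_bounded_integrable => //.
  exact: fin_num_fun_lty.
by exists B; split=> [|M BM x _ /=]; [exact: num_real|exact: le_trans (fB x) (ltW BM)].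
Qed.

Lemma Rintegral_probability_cst (P : probability T R) c :
  Rintegral P setT (fun=> c) = c.
Proof. by rewrite Rintegral_cst// [X in fine X](probability_setT P) mulr1. Qed.

End bounded_integral.

Section continuous_integral.
Context {R : realType} {T : topologicalType} (x0 : T).
Implicit Types (P : probability (borel x0) R) (f g : T -> R).

Lemma measurable_open (V : set T) : open V -> measurable (V : set (borel x0)).
Proof. by move=> oV; exact: sub_sigma_algebra. Qed.

Lemma continuous_borel_measurable f : continuous f ->
  measurable_fun (setT : set (borel x0)) f.
Proof.
move=> cf; apply: (measurability _ (RGenOInfty.measurableE R)).
move=> _ [_ [a ->] <-]; rewrite setTI; apply: measurable_open.
by move/continuousP : cf; apply; exact: interval_open.
Qed.

Lemma compact_continuous_bounded f : compact [set: T] -> continuous f ->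
  exists2 B, 0 <= B & forall x, `|f x| <= B.
Proof.
move=> cT cf; have := continuous_compact (continuous_subspaceT cf) cT.
move=> /compact_bounded[M [_ hM]]; exists (`|M| + 1) => [|x].
  by rewrite addr_ge0.
apply: hM; first by rewrite (le_lt_trans (ler_norm M))// ltrDl.
by exists x.
Qed.

Lemma continuous_integrable P f : compact [set: T] -> continuous f ->
  P.-integrable setT (EFin \o f).
Proof.
move=> cT cf; have [B _ fB] := compact_continuous_bounded cT cf.
exact: bounded_integrable (continuous_borel_measurable cf) fB.
Qed.

Lemma Rintegral_lincomb P (a : R) f g : compact [set: T] ->
  continuous f -> continuous g ->
  Rintegral P setT (fun x => a * f x + g x) =
  a * Rintegral P setT f + Rintegral P setT g.
Proof.
move=> cT cf cg; rewrite RintegralD//.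
- by rewrite RintegralZl//; exact: continuous_integrable.
- apply: (@continuous_integrable P (fun x => a * f x)) => // x.
  by apply: cvgMr; exact: cf.
- exact: continuous_integrable.
Qed.

Lemma ultra_cvg {S : Type} {U : topologicalType} (G : set_system S) (h : S -> U)
    (K : set U) : UltraFilter G -> compact K -> (forall s, K (h s)) ->
  exists2 l, K l & h @ G --> l.
Proof.
move=> GU cK hK; have [l [Kl cl]] := cK (h @ G) _ (@filterE _ G _ _ hK).
exists l => // V Vl; have [//|nV] := in_ultra_setVsetC (h @^-1` V) GU.
by have [y []] := cl (~` V) V nV Vl.
Qed.

End continuous_integral.

Section riesz_representation.
Context {R : realType} {T : pseudoMetricType R} (x0 : T).
Hypothesis compactT : compact [set: T].
Variable L : (T -> R) -> R.
Hypothesis L_lin : forall a (f g : T -> R), continuous f -> continuous g ->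
  L (fun x => a * f x + g x) = a * L f + L g.
Hypothesis L_ge0 : forall f : T -> R, continuous f -> (forall x, 0 <= f x) -> 0 <= L f.
Hypothesis L_one : L (fun=> 1) = 1.

Let P : probability (borel x0) R := riesz_probability x0 compactT L_lin L_ge0 L_one.

Let Rint_cst c : Rintegral P setT (fun=> c) = c.
Proof. exact: Rintegral_probability_cst. Qed.

(** A layer-cake estimate. Cut [f] into [n] horizontal slices of height [c = 1 / n]. The slice above
    level [j * c], multiplied by [n], is below the indicator of [V j], so its image under [L] before
    multiplication is at most [c] times the mass of [V j]. The sum of [c] times these indicators is
    at most [f + c]. *)
Let L_le_integral01 (f : T -> R) : continuous f -> (forall x, 0 <= f x <= 1) ->
  L f <= Rintegral P setT f.
Proof.
move=> cf f01; apply/ler_addgt0Pr => e e0.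
have [n0 n_e] : exists n : nat, n.+1%:R^-1 < e.
  have := near_infty_natSinv_lt (PosNum e0).
  by case=> N _ /(_ N (leqnn N)) /= h; exists N.
pose n := n0.+1; pose c := n%:R^-1 : R.
have c0 : 0 < c by rewrite invr_gt0.
pose m (t : R) x := Num.min (f x) t.
have cm t : continuous (m t).
  move=> x; apply: (@continuous_min R T f (cst t)); [exact: cf|exact: cvg_cst].
pose V (j : nat) := [set x | j%:R * c < f x].
have oV j : open (V j).
  by move/continuousP : cf => /(_ [set y | j%:R * c < y]); apply; exact: open_gt.
have Lstep j : L (m (j.+1%:R * c)) <= L (m (j%:R * c)) + c * fine (P (V j)).
  pose s x := n%:R * (m (j.+1%:R * c) x + -1 * m (j%:R * c) x).
  have cs0 : continuous (fun x => -1 * m (j%:R * c) x + m (j.+1%:R * c) x).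
    exact: (@continuous_lincomb R T (-1) _ _ (cm _) (cm _)).
  have cs : continuous s.
    have -> : s = fun x => n%:R * (-1 * m (j%:R * c) x + m (j.+1%:R * c) x) + 0.
      by apply/funext => x; rewrite /s; ring.
    apply: (@continuous_lincomb R T n%:R _ (fun=> 0) cs0) => x; exact: cvg_cst.
  have jc : j.+1%:R * c = j%:R * c + c by rewrite -natr1; ring.
  have nc : n%:R * c = 1 by rewrite /c mulfV// pnatr_eq0.
  have hs : L s <= fine (P (V j)).
    rewrite -lee_fin fineK ?fin_num_measure//; last exact: measurable_open.
    rewrite riesz_probability_open//; apply: ereal_sup_ubound; exists s => //.
    split=> // x; rewrite /s /m /V/= jc; split.
      apply/andP; split.
        apply: mulr_ge0 => //; have [h1|h1] := lerP (f x) (j%:R * c);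
          have [h2|h2] := lerP (f x) (j%:R * c + c); lra.
      rewrite -[leRHS]nc ler_wpM2l//; have [h1|h1] := lerP (f x) (j%:R * c);
        have [h2|h2] := lerP (f x) (j%:R * c + c); lra.
    move=> /negP; rewrite -leNgt => h1; rewrite !min_l//; first by ring.
    by apply: (le_trans h1); rewrite lerDl ltW.
  have -> : L (m (j.+1%:R * c)) = c * L s + L (m (j%:R * c)).
    rewrite -L_lin//; congr L; apply/funext => x; rewrite /s mulrA (mulrC c) nc; ring.
  by rewrite addrC lerD2l ler_wpM2l// ltW.
have LN N : L (m (N%:R * c)) <= \sum_(j < N) c * fine (P (V j)).
  elim: N => [|N IH]; last first.
    by rewrite big_ord_recr/=; apply: (le_trans (Lstep N)); rewrite lerD2r.
  rewrite big_ord0 mul0r.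
  have -> : m 0 = fun x => -1 * 1 + 1.
    apply/funext => x; rewrite /m min_r; first by ring.
    by have /andP[] := f01 x.
  rewrite (@L_lin (-1) (fun=> 1) (fun=> 1)) ?L_one; [lra|by move=> x; exact: cvg_cst..].
have mf : m (n%:R * c) = f.
  have nc : n%:R * c = 1 by rewrite /c mulfV// pnatr_eq0.
  by apply/funext => x; rewrite /m nc; apply: min_l; have /andP[] := f01 x.
have mV j : measurable (V j : set (borel x0)) by exact: measurable_open.
have IV N : \sum_(j < N) c * fine (P (V j)) =
    Rintegral P setT (fun x => \sum_(j < N) c * \1_(V j) x) /\
    P.-integrable setT (EFin \o (fun x => \sum_(j < N) c * \1_(V j) x)).
  elim: N => [|N [IH1 IH2]].
    rewrite big_ord0; under eq_fun do rewrite big_ord0.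
    split; first by rewrite Rintegral_cst// mul0r.
    by apply: (@bounded_integrable _ _ _ _ _ 0) => // x; rewrite normr0.
  have iN : P.-integrable setT (EFin \o (fun x : borel x0 => \1_(V N) x)).
    apply: (@bounded_integrable _ _ _ _ _ 1); first exact: measurable_indic.
    by move=> x; rewrite indicE; case: (_ \in _); rewrite ?normr1 ?normr0.
  have iN' : P.-integrable setT (EFin \o (fun x : borel x0 => c * \1_(V N) x)).
    have := integrableZl measurableT c iN; exact: eq_integrable.
  have -> : (fun x => \sum_(j < N.+1) c * \1_(V j) x) =
      (fun x : borel x0 => \sum_(j < N) c * \1_(V j) x + c * \1_(V N) x).
    by apply/funext => x; rewrite big_ord_recr.
  rewrite big_ord_recr/=.
  split.
    rewrite RintegralD// RintegralZl// -IH1; congr (_ + _ * _).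
    by rewrite /Rintegral integral_indic// setIT.
  have := integrableD measurableT IH2 iN'; exact: eq_integrable.
have ptw N x : \sum_(j < N) c * \1_(V j) x <= Num.min (f x + c) (N%:R * c).
  have /andP[f0 _] := f01 x.
  elim: N => [|N IH]; first by rewrite big_ord0 mul0r le_min lexx andbT addr_ge0// ltW.
  rewrite big_ord_recr/= indicE; move: IH; rewrite !le_min => /andP[h1 h2].
  have Nc : N.+1%:R * c = N%:R * c + c by rewrite -natr1; ring.
  have [/set_mem|_] := boolP (x \in V N); rewrite /V/= Nc; last by rewrite mulr0; lra.
  by rewrite mulr1 => h3; apply/andP; split; lra.
have [IV1 IV2] := IV n; have if_ : P.-integrable setT (EFin \o f) by exact: continuous_integrable.
have ic : P.-integrable setT (EFin \o (fun _ : borel x0 => c)).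
  by apply: (@bounded_integrable _ _ _ _ _ `|c|) => // x.
rewrite -mf; apply: (le_trans (LN n)); rewrite IV1 mf.
apply: (@le_trans _ _ (Rintegral P setT (fun x => f x + c))).
  apply: le_Rintegral => // [|x _].
    by have := integrableD measurableT if_ ic; apply: eq_integrable.
  by have := ptw n x; rewrite le_min => /andP[].
by rewrite RintegralD// Rint_cst lerD2l ltW.
Qed.

(* Applying the previous inequality to [f] and to [1 - f]. *)
Let L_integral01 (f : T -> R) : continuous f -> (forall x, 0 <= f x <= 1) ->
  L f = Rintegral P setT f.
Proof.
move=> cf f01; apply/eqP; rewrite eq_le L_le_integral01//=.
have c1 : continuous (fun _ : T => 1 : R) by move=> x; exact: cvg_cst.
have := @L_le_integral01 (fun x => -1 * f x + 1) (@continuous_lincomb R T (-1) f _ cf c1).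
rewrite L_lin// L_one Rintegral_lincomb// Rint_cst => h.
have : -1 * L f + 1 <= -1 * Rintegral P setT f + 1.
  by apply: h => x; have := f01 x; lra.
by lra.
Qed.

Theorem riesz_representation : exists P : probability (borel x0) R,
  (forall f : T -> R, continuous f -> Rintegral P setT f = L f) /\
  (forall V, open V -> P V = capacity L V).
Proof.
exists P; split; last exact: riesz_probability_open.
move=> f cf; have [B B0 fB] := compact_continuous_bounded compactT cf.
(* An affine change brings [f] into [0, 1]; taking [B + 1] keeps the divisor positive when
   [B = 0]. *)
pose b := B + 1; have b0 : 0 < b by rewrite /b; lra.
have c1 : continuous (fun _ : T => 1 : R) by move=> x; exact: cvg_cst.
pose h x := (2 * b)^-1 * f x + 1 / 2.
have c2 : continuous (fun _ : T => 1 / 2 : R) by move=> x; exact: cvg_cst.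
have ch : continuous h by exact: (@continuous_lincomb R T (2 * b)^-1 f _ cf c2).
have h01 x : 0 <= h x <= 1.
  have := fB x; rewrite ler_norml => /andP[f1 f2].
  have -> : h x = (f x + b) / (2 * b) by rewrite /h; field; lra.
  by rewrite divr_ge0 ?ler_pdivrMr//=; rewrite /b; lra.
have -> : f = fun x => (2 * b) * h x + (- b) * 1.
  by apply/funext => x; rewrite /h; field; lra.
have c3 : continuous (fun _ : T => - b * 1 : R) by move=> x; exact: cvg_cst.
rewrite Rintegral_lincomb// L_lin// L_integral01//; congr (_ + _).
have -> : (fun _ : T => - b * 1) = (fun _ => (- b - 1) * 1 + 1).
  by apply/funext => x; ring.
by rewrite L_lin// L_one Rint_cst; ring.
Qed.

End riesz_representation.

(** * Uniform lower bounds on the mass of open sets *)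

Section uniform_support.
Context {R : realType} {T : pseudoMetricType R} (x0 : T).
Hypothesis compactT : compact [set: T].
Implicit Types S : set (probability (borel x0) R).

(** The weak topology is initial for the map into a space of pointwise convergence, whose topology
    is a supremum over the test functions; convergence along [G] can thus be checked one integral at
    a time. *)
Lemma closure_weak_proba S (P : probability (borel x0) R)
    (G : set_system (probability (borel x0) R)) : ProperFilter G -> G S ->
  (forall f : T -> R, continuous f ->
    (fun Q : probability (borel x0) R => Rintegral Q setT f) @ G -->
      Rintegral P setT f) ->
  closure (S : set (weak_proba R x0)) P.
Proof.
move=> GF GS Gf B [V [[W oW <-] WP VB]].
have cvgG : (fun (Q : probability (borel x0) R) => ((fun f => Rintegral Q setT (set_val f)) :
    {ptws [set f : T -> R | continuous f] -> R})) @ G -->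
    (((fun f => Rintegral P setT (set_val f))) :
    {ptws [set f : T -> R | continuous f] -> R}).
  apply/cvg_sup => f A [_ [[B' oB' <-] B'P B'A]]; apply: filterS B'A _.
  by apply: (Gf _ (set_valP f)); exact: open_nbhs_nbhs.
have : G (B `&` S).
  apply: filterI => //; apply: filterS VB _.
  by apply: cvgG; exact: open_nbhs_nbhs.
by rewrite setIC => /filter_ex.
Qed.

Lemma uniform_full_support S (U : set T) :
  (forall P : weak_proba R x0, closure (S : set (weak_proba R x0)) P ->
    supp (P : probability (borel x0) R) = setT) ->
  open U -> U !=set0 ->
  exists2 kappa : R, 0 < kappa & forall P, S P -> (kappa%:E <= P U)%E.
Proof.
move=> suppS oU [u Uu]; apply: contrapT => nk.
have small (k : R) : 0 < k -> exists2 P, S P & (P U < k%:E)%E.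
  move=> k0; apply: contrapT => h; apply: nk; exists k => // P SP.
  by rewrite leNgt; apply/negP => Pk; apply: h; exists P.
(* Negating the conclusion makes the sets of measures in [S] with mass below [e] on [U] a filter
   base. Along an ultrafilter refining it, the integrals of all continuous functions converge
   simultaneously, since each stays in a compact interval. *)
pose F := filter_from [set e : R | 0 < e]
  (fun e => [set P : probability (borel x0) R | S P /\ (P U < e%:E)%E]).
have FF : ProperFilter F.
  apply: filter_from_proper; last by move=> e e0; have [P SP Pe] := small e e0; exists P.
  apply: filter_from_filter; first by exists 1 => /=.
  move=> e1 e2 /= e10 e20; exists (Num.min e1 e2) => /=; first by rewrite lt_min e10.
  move=> P [SP]; rewrite EFin_min lt_min => /andP[h1 h2].
  by split; split.
have [G [GU FG]] := ultraFilterLemma FF.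
have GS : G S by apply: FG; exists 1 => //= P [].
pose int (f : T -> R) (Q : probability (borel x0) R) := Rintegral Q setT f.
have int_bound (f : T -> R) (B : R) : continuous f -> (forall x, `|f x| <= B) ->
    forall Q, `|int f Q| <= B.
  move=> cf fB Q; have fi := continuous_integrable Q compactT cf.
  apply: (le_trans (le_normr_Rintegral measurableT fi)).
  rewrite -[leRHS](Rintegral_probability_cst Q); apply: le_Rintegral => //.
  - exact: integrable_norm.
  - by apply: (@bounded_integrable _ _ _ _ _ `|B|) => // x; rewrite lexx.
have cvgL (f : T -> R) : continuous f -> exists l : R, int f @ G --> l.
  move=> cf; have [B B0 fB] := compact_continuous_bounded compactT cf.
  have hK Q : `[- B, B]%classic (int f Q).
    by rewrite /= in_itv/= -ler_norml; exact: (int_bound f B).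
  have cK : compact (`[- B, B]%classic : set R) by exact: segment_compact.
  by have [l _ hl] := ultra_cvg GU cK hK; exists l.
pose L (f : T -> R) := lim (int f @ G).
have GL (f : T -> R) : continuous f -> int f @ G --> L f.
  by move=> /cvgL[l hl]; apply: (cvgP l hl).
have LE (f : T -> R) l : int f @ G --> l -> L f = l.
  by move=> h; apply: cvg_lim => //; exact: Rhausdorff.
have L_lin a (f g : T -> R) : continuous f -> continuous g ->
    L (fun x => a * f x + g x) = a * L f + L g.
  move=> cf cg; apply: LE.
  have -> : int (fun x => a * f x + g x) = fun Q => a * int f Q + int g Q.
    by apply/funext => Q; exact: Rintegral_lincomb.
  apply: cvgD; last exact: GL.
  by apply: cvgMr; exact: GL.
have L_ge0 (f : T -> R) : continuous f -> (forall x, 0 <= f x) -> 0 <= L f.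
  move=> cf f0; apply: (limr_ge (cvgP _ (GL f cf))).
  by near=> Q; apply: Rintegral_ge0.
have L_one : L (fun=> 1) = 1.
  apply: LE; rewrite (_ : int _ = cst 1); first exact: cvg_cst.
  by apply/funext => Q; exact: Rintegral_probability_cst.
have [P [PL PV]] := riesz_representation x0 compactT L_lin L_ge0 L_one.
have Pcl : closure (S : set (weak_proba R x0)) P.
  by apply: (closure_weak_proba (G := G)) => // f cf; rewrite PL//; exact: GL.
(* [P U] is the supremum of [L f] over [f] below the indicator of [U]. The integral of such an [f]
   is at most the mass of [U], hence at most [e] along [G], for every [e]. *)
have PU0 : P U = 0%E.
  rewrite PV//; apply/eqP; rewrite eq_le; apply/andP; split; last first.
    exact: (capacity_ge0 L_lin L_one).
  apply: ge_ereal_sup => _ [f [cf f01] <-]; rewrite lee_fin.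
  apply/ler_addgt0Pr => e e0; rewrite add0r.
  apply: (limr_le (cvgP _ (GL f cf))).
  have : G [set P | S P /\ (P U < e%:E)%E] by apply: FG; exists e.
  apply: filterS => Q [_ Qe].
  have mU : measurable (U : set (borel x0)) by exact: measurable_open.
  have iU : Q.-integrable setT (EFin \o (fun x : borel x0 => \1_U x)).
    apply: (@bounded_integrable _ _ _ _ _ 1); first exact: measurable_indic.
    by move=> x; rewrite indicE; case: (_ \in _); rewrite ?normr1 ?normr0.
  apply: (@le_trans _ _ (Rintegral Q setT (\1_U : borel x0 -> R))).
    apply: le_Rintegral => //; first exact: continuous_integrable.
    move=> x _; change (f x <= (x \in U)%:R); have [/andP[_ f1] fU] := f01 x.
    have [//|/negP nU] := boolP (x \in U); rewrite fU// => Ux.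
    by apply: nU; exact: mem_set.
  rewrite /Rintegral integral_indic// setIT -lee_fin fineK ?fin_num_measure//.
  exact: ltW.
have : supp P u by rewrite (suppS P Pcl).
by move=> /(_ U (conj oU Uu)); rewrite PU0 ltxx.
Unshelve. all: by end_near. Qed.

End uniform_support.

(** * Functions dominated by a smooth kernel *)

Section finite_filter.
Context {I : Type} {F : set_system I} {FF : Filter F}.

Lemma near_seq (T : eqType) (P : T -> I -> Prop) (s : seq T) :
  (forall p, p \in s -> \forall t \near F, P p t) ->
  \forall t \near F, forall p, p \in s -> P p t.
Proof.
elim: s => [|a s IH] h; first by apply: nearW.
have h1 := h a (mem_head a s).
have h2 : \forall t \near F, forall p, p \in s -> P p t.
  by apply: IH => p ps; apply: h; rewrite inE ps orbT.
apply: filterS2 h1 h2 => t Pa Ps p.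
by rewrite inE => /orP[/eqP->//|]; exact: Ps.
Qed.

Lemma cvg_sum_seq {R : realType} (T : eqType) (s : seq T) (f : T -> I -> R)
    (l : T -> R) : (forall p, p \in s -> f p @ F --> l p) ->
  (fun i => \sum_(p <- s) f p i) @ F --> \sum_(p <- s) l p.
Proof.
elim: s => [|a s IH] h.
  by rewrite big_nil; under eq_fun do rewrite big_nil; exact: cvg_cst.
rewrite big_cons; under eq_fun do rewrite big_cons.
apply: cvgD; first exact: h (mem_head a s).
by apply: IH => p ps; apply: h; rewrite inE ps orbT.
Qed.

End finite_filter.

Section directional_mean_value.
Context {R : realType} {V : normedModType R}.
Implicit Types (f : V -> R) (u v : V).

Lemma is_derive_line f u v (r : R) : derivable f (u + r *: v) v ->
  is_derive r 1 (fun r => f (u + r *: v)) ('D_v f (u + r *: v)).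
Proof.
move=> df.
have E : (fun h : R =>
    h^-1 *: (((fun r => f (u + r *: v)) \o shift r) (h *: 1) - f (u + r *: v))) =
    (fun h : R => h^-1 *: ((f \o shift (u + r *: v)) (h *: v) - f (u + r *: v))).
  apply/funext => h; congr (_ *: (f _ - _)).
  by rewrite /= [h *: 1]mulr1 scalerDl addrCA.
by split; rewrite /derivable /derive E.
Qed.

Lemma mean_value0 (f df : R -> R) (s : R) :
  (forall r : R, `|r| <= `|s| -> is_derive r (1 : R) f (df r)) ->
  exists2 t : R, `|t| <= `|s| & f s - f 0 = df t * s.
Proof.
move=> fdf.
have cont a b : - `|s| <= a -> b <= `|s| -> {within `[a, b], continuous f}.
  move=> sa bs; apply: derivable_within_continuous => x.
  rewrite in_itv/= => /andP[ax xb].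
  have /fdf[] // : `|x| <= `|s|.
  by rewrite ler_norml (le_trans sa ax) (le_trans xb bs).
have [s0|s0] := leP 0 s.
  have [x||c cs ->] := @MVT_segment R f df 0 s s0.
  - rewrite in_itv/= => /andP[x0 xs]; apply: fdf.
    by rewrite !ger0_norm// ltW.
  - by apply: cont; rewrite ?ger0_norm// oppr_le0.
  - exists c; last by rewrite subr0.
    by move: cs; rewrite in_itv/= => /andP[c0 cs]; rewrite !ger0_norm.
have [x||c cs E] := @MVT_segment R f df s 0 (ltW s0).
- rewrite in_itv/= => /andP[x0 xs]; apply: fdf.
  by rewrite !ler0_norm ?lerN2// ltW.
- by apply: cont; rewrite ltr0_norm ?opprK// oppr_ge0 ltW.
- exists c; last by rewrite -opprB E; ring.
  move: cs; rewrite in_itv/= => /andP[c0 cs]; rewrite !ler0_norm ?lerN2//.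
  exact: ltW.
Qed.

Lemma directional_mean_value f u v (s : R) :
  (forall r : R, `|r| <= `|s| -> derivable f (u + r *: v) v) ->
  exists2 t : R, `|t| <= `|s| & f (u + s *: v) - f u = 'D_v f (u + t *: v) * s.
Proof.
move=> df.
have [|t ts E] := @mean_value0 (fun r => f (u + r *: v)) (fun r => 'D_v f (u + r *: v)) s.
  by move=> r rs; apply: is_derive_line; exact: df.
by exists t => //; rewrite -E/= scale0r addr0.
Qed.

End directional_mean_value.

Section mixed_difference.
Context {R : realType} {V : normedModType R}.
Implicit Types (k : V * V -> R) (u v w : V).

Lemma pair_shiftl u v w (x : R) : (u, w) + x *: (v, 0) = (u + x *: v, w) :> V * V.
Proof. by apply: injective_projections => //=; rewrite scaler0 addr0. Qed.

Lemma pair_shiftr u v w (x : R) : (u, w) + x *: (0, v) = (u, w + x *: v) :> V * V.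
Proof. by apply: injective_projections => //=; rewrite scaler0 addr0. Qed.

(** The mixed second difference quotient, with limit the mixed derivative of [k] along [v]. The two
    steps are independent because the Cauchy criterion for the quotients of [f] compares two
    different steps. *)
Definition mixed_difference k v (s t : R) u w :=
  (k (u + s *: v, w + t *: v) - k (u + s *: v, w) - k (u, w + t *: v) + k (u, w))
  / (s * t).

Lemma smooth_on_iter_derive {V' W : normedModType R} (O : set V') (f : V' -> W) vs :
  smooth_on O f -> smooth_on O (iter_derive vs f).
Proof.
by move=> sf ws x Ox; have := sf (ws ++ vs) x Ox; rewrite /iter_derive foldr_cat.
Qed.

(** Two mean value theorems: one in the first variable for the difference of [k] at heights
    [w + t *: v] and [w], then one in the second variable for [D]. The quotient is thereby a value
    of [D'] at a nearby point. *)
Lemma mixed_difference_cvg k (D D' : V * V -> R) v (U : set V) u w e : open U ->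
  (forall p, (U `*` U) p -> derivable k p (v, 0)) ->
  (forall p, (U `*` U) p -> 'D_(v, 0) k p = D p) ->
  (forall p, (U `*` U) p -> derivable D p (0, v)) ->
  (forall p, (U `*` U) p -> 'D_(0, v) D p = D' p) ->
  {for (u, w), continuous D'} -> U u -> U w -> 0 < e ->
  exists2 d : R, 0 < d & forall s t : R, 0 < `|s| < d -> 0 < `|t| < d ->
    `|mixed_difference k v s t u w - D' (u, w)| <= e.
Proof.
move=> oU dk kD dD DD' cD' Uu Uw e0.
have nearUU : \forall p \near (u, w), (U p.1 /\ U p.2) /\
    `|D' p - D' (u, w)| <= e.
  apply: filterI.
    exists (U, U) => [|[a b] []//].
    by split; exact: open_nbhs_nbhs.
  by move/cvgrPdist_le : cD' => /(_ e e0); apply: filterS => p; rewrite distrC.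
have [d /= d0 hd] : exists2 d : R, 0 < d & forall r q : R, `|r| < d -> `|q| < d ->
    (U (u + r *: v) /\ U (w + q *: v)) /\
    `|D' (u + r *: v, w + q *: v) - D' (u, w)| <= e.
  move/nbhs_ballP : nearUU => [r /= r0 hr].
  have nv0 : 0 < `|v| + 1 by rewrite ltr_wpDl.
  exists (r / (`|v| + 1)); first by rewrite divr_gt0.
  have small (a : V) (q : R) : `|q| < r / (`|v| + 1) -> ball a r (a + q *: v).
    move=> qr; rewrite -ball_normE /ball_/= opprD addrA subrr add0r normrN normrZ.
    rewrite ltr_pdivlMr// in qr; apply: le_lt_trans qr.
    by rewrite ler_wpM2l// lerDl.
  by move=> q q' hq hq'; apply: (hr (_, _)); split; exact: small.
exists d => // s t /andP[s0 sd] /andP[t0 td].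
have lt0d (r : R) : `|r| <= 0 -> `|r| < d by move=> /le_lt_trans; apply.
have dk1 (r q : R) : `|r| < d -> `|q| < d ->
    derivable k ((u, w + q *: v) + r *: (v, 0)) (v, 0).
  move=> rd qd; have [[Ur Uq] _] := hd r q rd qd.
  rewrite pair_shiftl.
  by apply: dk; split.
have smalls (r : R) : `|r| <= `|s| -> `|r| < d by move=> /le_lt_trans; apply.
have smallt (r : R) : `|r| <= `|t| -> `|r| < d by move=> /le_lt_trans; apply.
pose phi (r : R) := k ((u, w + t *: v) + r *: (v, 0)) - k ((u, w + 0 *: v) + r *: (v, 0)).
have der (q r : R) : `|q| < d -> `|r| < d ->
    is_derive r (1 : R) (fun r => k ((u, w + q *: v) + r *: (v, 0))) (D (u + r *: v, w + q *: v)).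
  move=> qd rd; have [UU _] := hd r q rd qd.
  have := is_derive_line (dk1 r q rd qd).
  by rewrite pair_shiftl (kD (u + r *: v, w + q *: v)).
have [r rs phiE] : exists2 r : R, `|r| <= `|s| & phi s - phi 0 =
    (D (u + r *: v, w + t *: v) - D (u + r *: v, w + 0 *: v)) * s.
  apply: (@mean_value0 _ phi
    (fun r : R => D (u + r *: v, w + t *: v) - D (u + r *: v, w + 0 *: v))).
  move=> r rs; apply: is_deriveB; apply: der; rewrite ?normr0//; exact: smalls.
have rd := smalls r rs.
have [q qt DE] : exists2 q : R, `|q| <= `|t| &
    D ((u + r *: v, w) + t *: (0, v)) - D (u + r *: v, w) =
    'D_(0, v) D ((u + r *: v, w) + q *: (0, v)) * t.
  apply: directional_mean_value => q qt; rewrite pair_shiftr.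
  by have [UU _] := hd r q rd (smallt q qt); exact: dD.
have [UU] := hd r q rd (smallt q qt).
rewrite !pair_shiftr (DD' (u + r *: v, w + q *: v))// in DE.
congr (`|_ - _| <= _); rewrite /mixed_difference.
move: phiE; rewrite /phi !pair_shiftl !scale0r !addr0 DE => phiE.
have -> : k (u + s *: v, w + t *: v) - k (u + s *: v, w) - k (u, w + t *: v) + k (u, w) =
    k (u + s *: v, w + t *: v) - k (u + s *: v, w) - (k (u, w + t *: v) - k (u, w)) by ring.
by rewrite phiE; field; rewrite -!normr_gt0 s0 t0.
Qed.

End mixed_difference.

Section dominated.
Context {R : realType} {V : normedModType R}.
Implicit Types (k : V * V -> R) (u v w : V) (f : V -> R).

(* For [C] at least the norm of [f], this holds for [f] in the reproducing kernel
   Hilbert space of [k]: it is the Cauchy-Schwarz inequality. *)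
Definition dominated (U : set V) k (C : R) f :=
  forall s : seq (R * V), (forall p, p \in s -> U p.2) ->
  (\sum_(p <- s) p.1 * f p.2) ^+ 2 <=
  C ^+ 2 * \sum_(p <- s) \sum_(q <- s) p.1 * q.1 * k (p.2, q.2).

Lemma dominated_dist (U : set V) k C f u w : dominated U k C f -> U u -> U w ->
  (f u - f w) ^+ 2 <= C ^+ 2 * (k (u, u) - k (u, w) - k (w, u) + k (w, w)).
Proof.
move=> df Uu Uw; have := df [:: (1, u); (-1, w)].
have sU : forall p : R * V, p \in [:: (1, u); (-1, w)] -> U p.2.
  by move=> p; rewrite !inE => /orP[] /eqP->.
rewrite !big_cons !big_nil /= => /(_ sU); congr (is_true (_ <= _)); ring.
Qed.

Lemma dnbhs0_norm (d : R) : 0 < d -> \forall t \near (0 : R)^', 0 < `|t| < d.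
Proof.
move=> d0; exists d => //= t; rewrite /ball/= sub0r normrN => td t0.
by rewrite normr_gt0 t0.
Qed.

Lemma near_open_line (U : set V) u v : open U -> U u ->
  \forall t \near (0 : R)^', U (u + t *: v).
Proof.
move=> oU Uu; have /nbhs_ballP[r /= r0 hr] := open_nbhs_nbhs (conj oU Uu).
have nv0 : 0 < `|v| + 1 by rewrite ltr_wpDl.
have d0 : 0 < r / (`|v| + 1) by rewrite divr_gt0.
apply: filterS (dnbhs0_norm d0) => t /andP[_ td]; apply: hr.
rewrite -ball_normE /ball_/= opprD addrA subrr add0r normrN normrZ.
rewrite ltr_pdivlMr// in td; apply: le_lt_trans td.
by rewrite ler_wpM2l// lerDl.
Qed.

(** Domination is applied to every point and its shift, with opposite weights [p.1 / t]; the kernel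
    values then group into mixed differences. *)
Lemma dominated_difference (U : set V) k C f v (t : R) (s : seq (R * V)) :
  dominated U k C f -> (forall p, p \in s -> U p.2) ->
  (forall p, p \in s -> U (p.2 + t *: v)) ->
  (\sum_(p <- s) p.1 * (t^-1 * (f (p.2 + t *: v) - f p.2))) ^+ 2 <=
  C ^+ 2 * \sum_(p <- s) \sum_(q <- s) p.1 * q.1 * mixed_difference k v t t p.2 q.2.
Proof.
move=> df sU sU'.
pose l := [seq (p.1 / t, p.2 + t *: v) | p <- s] ++ [seq (- (p.1 / t), p.2) | p <- s].
have lU : forall p, p \in l -> U p.2.
  by move=> p; rewrite mem_cat => /orP[] /mapP[q qs ->] /=; [exact: sU'|exact: sU].
have := df l lU; congr (is_true (_ ^+ 2 <= _ * _)).
  rewrite big_cat !big_map /= -big_split; apply: eq_bigr => p _ /=; ring.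
rewrite big_cat !big_map /= -big_split; apply: eq_bigr => p _ /=.
rewrite !big_cat !big_map /= -!big_split; apply: eq_bigr => q _ /=.
rewrite /mixed_difference invfM; ring.
Qed.

Section derivative.
Variables (U : set V) (k D D' : V * V -> R) (v : V).
Hypotheses (oU : open U)
  (dk : forall p, (U `*` U) p -> derivable k p (v, 0))
  (kD : forall p, (U `*` U) p -> 'D_(v, 0) k p = D p)
  (dD : forall p, (U `*` U) p -> derivable D p (0, v))
  (DD' : forall p, (U `*` U) p -> 'D_(0, v) D p = D' p)
  (cD' : forall p, (U `*` U) p -> {for p, continuous D'}).

(** The Cauchy criterion. The difference of the quotients with steps [s] and [t] is a combination of
    values of [f], so its square is at most [C ^+ 2] times an alternating sum of four mixed
    differences at [(u, u)]. All four are close to [D' (u, u)], and these limits cancel. *)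
Lemma dominated_derivable C f u : dominated U k C f -> U u -> derivable f u v.
Proof.
move=> df Uu; apply/cauchy_cvgP/cauchy_ballP => e e0.
(* Four errors [e1] times [C ^+ 2] must stay below [e ^+ 2]; the added 1 covers [C = 0]. *)
pose e1 := e ^+ 2 / (8 * (C ^+ 2 + 1)).
have C1 : 0 < 8 * (C ^+ 2 + 1) by rewrite mulr_gt0// ltr_wpDl// sqr_ge0.
have e10 : 0 < e1 by rewrite divr_gt0// exprn_gt0.
have [d d0 hd] := mixed_difference_cvg oU dk kD dD DD'
  (cD' (conj Uu Uu : (U `*` U) (u, u))) Uu Uu e10.
pose Q := [set h : R | 0 < `|h| < d /\ U (u + h *: v)].
have nQ : \forall h \near (0 : R)^', Q h.
  by apply: filterI; [exact: dnbhs0_norm|exact: near_open_line].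
pose q (h : R) : R := h^-1 *: ((f \o shift u) (h *: v) - f u).
have qQ : (q @ 0^') (q @` Q).
  by apply: filterS nQ => h Qh; exists h.
exists (q @` Q, q @` Q) => [//|[_ _] [/= [s [sd sU] <-] [t [td tU] <-]]].
have qE h : q h = h^-1 * (f (u + h *: v) - f u) by rewrite /q/= [h *: v + u]addrC.
rewrite !qE /ball/=.
pose l := [:: (s^-1, u + s *: v); (- s^-1, u); (- t^-1, u + t *: v); (t^-1, u)].
have lU : forall p : R * V, p \in l -> U p.2.
  by move=> p; rewrite !inE => /or4P[] /eqP->.
have := df l lU; rewrite /l !big_cons !big_nil /= => h.
have hss := hd s s sd sd; have hst := hd s t sd td.
have hts := hd t s td sd; have htt := hd t t td td.
have {}h : (s^-1 * (f (u + s *: v) - f u) - t^-1 * (f (u + t *: v) - f u)) ^+ 2 <=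
   C ^+ 2 * (mixed_difference k v s s u u - mixed_difference k v s t u u
     - mixed_difference k v t s u u + mixed_difference k v t t u u).
  move: h; congr (is_true (_ <= _)); first by ring.
  by rewrite /mixed_difference !invfM; ring.
rewrite -(@ltr_pXn2r _ 2)// ?nnegrE ?ltW// real_normK ?num_real//.
apply: (le_lt_trans h); apply: (@le_lt_trans _ _ (C ^+ 2 * (4 * e1))).
  apply: ler_wpM2l; first exact: sqr_ge0.
  move: hss hst hts htt; rewrite !ler_norml.
  move=> /andP[_ h1] /andP[h2 _] /andP[h3 _] /andP[_ h4]; lra.
have C0 := sqr_ge0 C.
rewrite /e1 mulrA mulrA ltr_pdivrMr//.
have e20 : 0 < e ^+ 2 by rewrite exprn_gt0.
nra.
Qed.

(** Let [t] tend to 0 in [dominated_difference]. The constant [C] is unchanged, so the step can be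
    iterated to any order. *)
Lemma dominated_derive C f : dominated U k C f -> dominated U D' C ('D_v f).
Proof.
move=> df s sU.
have near1 : \forall t \near (0 : R)^', forall p, p \in s -> U (p.2 + t *: v).
  by apply: near_seq => p ps; apply: near_open_line => //; exact: sU.
have cvgq p : p \in s -> (fun t : R => p.1 * (t^-1 * (f (p.2 + t *: v) - f p.2))) @ 0^' -->
    p.1 * 'D_v f p.2.
  move=> ps; apply: cvgMr; have := dominated_derivable df (sU p ps).
  rewrite /derivable /derive
    (_ : (fun h : R => _) = (fun t : R => t^-1 * (f (p.2 + t *: v) - f p.2))) //.
  by apply/funext => h /=; rewrite [h *: v + p.2]addrC.
have cvgm p q : p \in s -> q \in s ->
   (fun t : R => p.1 * q.1 * mixed_difference k v t t p.2 q.2) @ 0^' --> p.1 * q.1 * D' (p.2, q.2).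
  move=> ps qs; apply: cvgMr; apply/cvgrPdist_le => e e0.
  have Up := sU p ps; have Uq := sU q qs.
  have [d d0 hd] := mixed_difference_cvg oU dk kD dD DD'
    (cD' (conj Up Uq : (U `*` U) (p.2, q.2))) Up Uq e0.
  by apply: filterS (dnbhs0_norm d0) => t td; rewrite distrC; exact: hd.
have lhs : (fun t : R => \sum_(p <- s) p.1 * (t^-1 * (f (p.2 + t *: v) - f p.2))) @ 0^' -->
    \sum_(p <- s) p.1 * 'D_v f p.2 by exact: cvg_sum_seq.
have rhs : (fun t : R => C ^+ 2 * \sum_(p <- s) \sum_(q <- s)
    p.1 * q.1 * mixed_difference k v t t p.2 q.2) @ 0^' -->
   C ^+ 2 * \sum_(p <- s) \sum_(q <- s) p.1 * q.1 * D' (p.2, q.2).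
  apply: cvgMr; apply: cvg_sum_seq => p ps; apply: cvg_sum_seq => q qs; exact: cvgm.
rewrite expr2; refine (ler_cvg_to (cvgM lhs lhs) rhs _).
apply: filterS near1 => t ht; have := dominated_difference df sU ht.
by rewrite expr2.
Qed.

End derivative.

Lemma mixed_derivatives (U : set V) k v : smooth_on (U `*` U) k ->
  exists D D' : V * V -> R, [/\ smooth_on (U `*` U) D',
    forall p, (U `*` U) p -> derivable k p (v, 0) /\ 'D_(v, 0) k p = D p,
    forall p, (U `*` U) p -> derivable D p (0, v) /\ 'D_(0, v) D p = D' p &
    forall p, (U `*` U) p -> {for p, continuous D'}].
Proof.
move=> sk; exists (iter_derive [:: (v, 0)] k), (iter_derive [:: (0, v); (v, 0)] k).
split; first exact: smooth_on_iter_derive.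
- by move=> p Up; split=> //; have [_ h] := sk [::] p Up; exact: h.
- by move=> p Up; split=> //; have [_ h] := sk [:: (v, 0)] p Up; exact: h.
- by move=> p Up; have [h _] := sk [:: (0, v); (v, 0)] p Up; exact: h.
Qed.

(** The kernel [k'] is chosen before [C] and [f]: one kernel controls the derivatives of a whole
    ball of the Hilbert space. *)
Lemma dominated_smooth (U : set V) k v : open U -> smooth_on (U `*` U) k ->
  exists2 k' : V * V -> R, smooth_on (U `*` U) k' & forall C f, dominated U k C f ->
    dominated U k' C ('D_v f) /\ forall u, U u -> derivable f u v.
Proof.
move=> oU /(mixed_derivatives v)[D [D' [sD' hk hD cD']]]; exists D' => // C f df.
pose dk p Up := (hk p Up).1; pose kD p Up := (hk p Up).2.
pose dD p Up := (hD p Up).1; pose DD' p Up := (hD p Up).2.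
split; first exact: (dominated_derive oU dk kD dD DD' cD' df).
by move=> u; exact: (dominated_derivable oU dk kD dD DD' cD' df).
Qed.

Lemma dominated_iter_derive (U : set V) k (vs : seq V) : open U ->
  smooth_on (U `*` U) k -> exists k' : V * V -> R,
  smooth_on (U `*` U) k' /\
  forall C f, dominated U k C f -> dominated U k' C (iter_derive vs f) /\
    forall u v, U u -> derivable (iter_derive vs f) u v.
Proof.
move=> oU; elim: vs => [|v vs IH] sk.
  exists k; split=> // C f df; split=> // u v Uu.
  by have [k' _ /(_ C f df)[_]] := dominated_smooth v oU sk; exact.
have [k1 [sk1 h1]] := IH sk; have [k2 sk2 h2] := dominated_smooth v oU sk1.
exists k2; split; first exact: sk2.
move=> C f df; have [df1 _] := h1 C f df.
have [df2 _] := h2 C _ df1; split=> // u w Uu.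
by have [k' _ /(_ C _ df2)[_]] := dominated_smooth w oU sk2; exact.
Qed.

End dominated.

(** * From small values to small derivatives *)

Section interpolation.
Context {R : realType}.

(** Induction on the number of derivatives. For [g] the derivative along [vs], the mean value
    theorem over a fixed step [t] makes ['D_v g] small at some [u + q *: v] with [|q| <= t], and
    domination by [k1] bounds the difference between its values there and at [u]. Both [eta] and the
    neighbourhood are independent of [f], as the compactness argument on a chart requires. *)
Lemma dominated_interpolation {V : normedModType R} (U : set V) (k : V * V -> R)
    (vs : seq V) (B : R) : open U -> smooth_on (U `*` U) k ->
  forall (u0 : V) (e : R), U u0 -> 0 < e -> exists2 eta : R, 0 < eta &
  \forall u \near u0, forall f : V -> R, dominated U k B f ->
    (forall u, U u -> `|f u| <= eta) -> `|iter_derive vs f u| <= e.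
Proof.
move=> oU sk; elim: vs => [|v vs IH] u0 e Uu0 e0.
  exists e => //.
  have nU : \forall u \near u0, U u by exact: open_nbhs_nbhs.
  by apply: filterS nU => u Uu f _ /(_ u Uu).
have [k0 [_ hk0]] := dominated_iter_derive vs oU sk.
have [k1 [sk1 hk1]] := dominated_iter_derive (v :: vs) oU sk.
have ck1 : {for (u0, u0), continuous k1}.
  have [+ _] := sk1 [::] (u0, u0) (conj Uu0 Uu0); exact.
have C1 : 0 < 16 * (B ^+ 2 + 1) by rewrite mulr_gt0// ltr_wpDl// sqr_ge0.
(* Makes [B ^+ 2 * (4 * e1)] smaller than [(e / 2) ^+ 2]. *)
pose e1 := e ^+ 2 / (16 * (B ^+ 2 + 1)).
have e10 : 0 < e1 by rewrite divr_gt0// exprn_gt0.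
have /nbhs_ballP[r1 /= r10 hr1] : \forall p \near (u0, u0), `|k1 (u0, u0) - k1 p| <= e1.
  by move/cvgrPdist_le : ck1 => /(_ e1 e10).
have /nbhs_ballP[r2 /= r20 hr2] := open_nbhs_nbhs (conj oU Uu0).
pose r := Num.min r1 r2; have r0 : 0 < r by rewrite lt_min r10.
have rU u : ball u0 r u -> U u.
  by move=> h; apply: hr2; apply: le_ball h; rewrite ge_min lexx orbT.
have rk u w : ball u0 r u -> ball u0 r w -> `|k1 (u0, u0) - k1 (u, w)| <= e1.
  by move=> hu hw; apply: hr1; split; apply: (@le_ball _ _ _ r) => //=; rewrite ge_min lexx.
have nv0 : 0 < `|v| + 1 by rewrite ltr_wpDl.
pose t := r / 2 / (`|v| + 1).
have t0 : 0 < t by rewrite !divr_gt0.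
have line u q : ball u0 (r / 2) u -> `|q| <= t -> ball u0 r (u + q *: v).
  move=> hu qt; rewrite [r]splitr; apply: ball_triangle hu _.
  rewrite -ball_normE /ball_/= opprD addrA subrr add0r normrN normrZ.
  have tv : t * (`|v| + 1) = r / 2 by rewrite /t divfK// gt_eqF.
  apply: (@le_lt_trans _ _ (t * `|v|)); first by rewrite ler_wpM2r.
  by rewrite -tv mulrDr mulr1 ltrDl.
have u0b : ball u0 (r / 2) u0 by apply: ballxx; rewrite divr_gt0.
have Ut : U (u0 + t *: v) by apply: rU; apply: line => //; rewrite ger0_norm// ltW.
(* Bounds [e * t / 8] at both ends of the step give a difference quotient of at most [e / 4]. The
   induction hypothesis is local, hence its separate uses at [u0] and at [u0 + t *: v]. *)
have e'0 : 0 < e * t / 8 by rewrite divr_gt0// mulr_gt0.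
have [eta1 eta10 near1] := IH u0 _ Uu0 e'0.
have [eta2 eta20 near2] := IH (u0 + t *: v) _ Ut e'0.
exists (Num.min eta1 eta2); first by rewrite lt_min eta10.
have shift_cvg : (fun u => u + t *: v) @ u0 --> u0 + t *: v.
  by apply: cvgD; [exact: cvg_id|exact: cvg_cst].
have near2' := shift_cvg _ near2.
have nb : \forall u \near u0, ball u0 (r / 2) u by apply: nbhsx_ballx; rewrite divr_gt0.
apply: filterS3 near1 near2' nb => u h1 h2 hu f df feta.
have le_eta1 w : U w -> `|f w| <= eta1.
  by move=> /feta; rewrite le_min => /andP[].
have le_eta2 w : U w -> `|f w| <= eta2.
  by move=> /feta; rewrite le_min => /andP[].
have g1 := h1 f df le_eta1; have g2 := h2 f df le_eta2.
have [_ dg] := hk0 B f df.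
have [|q qt E] := @directional_mean_value R V (iter_derive vs f) u v t.
  by move=> q; rewrite (ger0_norm (ltW t0)) => qt; apply: dg; apply: rU; exact: line.
rewrite (ger0_norm (ltW t0)) in qt.
have hw := line u q hu qt.
have hu' : ball u0 r u by apply: le_ball hu; rewrite ler_pdivrMr// mulr_natr mulr2n lerDl ltW.
have [dg1 _] := hk1 B f df.
have dist := dominated_dist dg1 (rU _ hu') (rU _ hw).
rewrite -/(iter_derive (v :: vs) f) in E *.
set a := iter_derive (v :: vs) f u in dist *.
set b := iter_derive (v :: vs) f (u + q *: v) in dist E *.
have bt : `|b| <= e / 4.
  have : `|b * t| <= e * t / 4.
    by rewrite -E; apply: (le_trans (ler_normB _ _)); rewrite /= in g2 *; lra.
  rewrite normrM (ger0_norm (ltW t0)) -ler_pdivlMr//; move/le_trans; apply.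
  by rewrite mulrAC mulfK// gt_eqF.
have ab : `|a - b| < e / 2.
  rewrite -(@ltr_pXn2r _ 2)// ?nnegrE ?divr_ge0// ?ltW// real_normK ?num_real//.
  apply: (le_lt_trans dist); apply: (@le_lt_trans _ _ (B ^+ 2 * (4 * e1))).
    apply: ler_wpM2l; first exact: sqr_ge0.
    move: (rk _ _ hu' hu') (rk _ _ hu' hw) (rk _ _ hw hu') (rk _ _ hw hw).
    rewrite !ler_norml => /andP[h3 _] /andP[_ h4] /andP[_ h5] /andP[h6 _]; lra.
  have B0 := sqr_ge0 B; have e20 : 0 < e ^+ 2 by rewrite exprn_gt0.
  rewrite expr_div_n /e1 mulrA mulrA ltr_pdivrMr//; nra.
change (`|a| <= e); have := ler_normD (a - b) b; rewrite subrK => h.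
by apply: (le_trans h); lra.
Qed.

(** The chart-free form of [dominated]: the norm bound reduced to an inequality about values of [f]
    and of [K], which can be pulled back along any parametrization. *)
Definition kernel_dominated {T : choiceType} (K : T -> T -> R) (C : R) (f : T -> R) :=
  forall s : seq (R * T), (\sum_(p <- s) p.1 * f p.2) ^+ 2 <=
    C ^+ 2 * \sum_(p <- s) \sum_(q <- s) p.1 * q.1 * K p.2 q.2.

Lemma kernel_dominated_comp {T : choiceType} {V : normedModType R}
    (K : T -> T -> R) C f (phi : V -> T) U :
  kernel_dominated K C f ->
  dominated U (fun p => K (phi p.1) (phi p.2)) C (fun u => f (phi u)).
Proof.
move=> Kf s _; have := Kf [seq (p.1, phi p.2) | p <- s].
rewrite !big_map/=; congr (is_true (_ <= _ * _)).
by apply: eq_bigr => p _; rewrite big_map.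
Qed.

Lemma kernel_dominated_dist {T : choiceType} (K : T -> T -> R) C f x y :
  kernel_dominated K C f ->
  (f x - f y) ^+ 2 <= C ^+ 2 * (K x x - K x y - K y x + K y y).
Proof.
move=> /(_ [:: (1, x); (-1, y)]); rewrite !big_cons !big_nil/=.
congr (is_true (_ <= _)); ring.
Qed.

Lemma Cr_norm_small (d n : nat) (X : set 'rV[R]_d) (A : finite_atlas n X)
    (K : X -> X -> R) (r : nat) (B e : R) : smooth_kernel n K -> 0 < e ->
  exists2 eta : R, 0 < eta & forall f : X -> R, kernel_dominated K B f ->
    (forall x, `|f x| <= eta) -> (Cr_norm A r f <= e%:E)%E.
Proof.
move=> sK e0.
(* All coordinate lists of length at most [r]. Since they and the charts are finitely many, and each
   compact piece is handled by a near-covering argument, a single [eta] serves for all. *)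
pose dirs := flatten [seq [seq val t | t <- enum {:k.-tuple 'I_n}] | k <- iota 0 r.+1].
have dirsP (js : seq 'I_n) : (size js <= r)%N -> js \in dirs.
  move=> jsr; apply/flattenP; exists [seq val t | t <- enum {:(size js).-tuple 'I_n}].
    by apply/mapP; exists (size js) => //; rewrite mem_iota add0n ltnS.
  by apply/mapP; exists (in_tuple js) => //; rewrite mem_enum.
pose P (p : 'I_(at_size A) * seq 'I_n) (eta : R) := forall u, at_compact p.1 u ->
  forall f : X -> R, kernel_dominated K B f -> (forall x, `|f x| <= eta) ->
  `|iter_derive [seq delta_mx ord0 j | j <- p.2] (fun w => f (at_param p.1 w)) u| <= e.
have nearP p : \forall eta \near (0 : R)^'+, P p eta.
  case: p => i js.
  have /compact_near_coveringP/(_ R (0 : R)^'+ (fun eta u => forall f : X -> R,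
     kernel_dominated K B f -> (forall x, `|f x| <= eta) ->
    `|iter_derive [seq delta_mx ord0 j | j <- js] (fun w => f (at_param i w)) u| <= e)) :=
    @at_compactP _ _ _ _ A i.
  apply => u0 Cu0.
  have lp := @at_paramP _ _ _ _ A i.
  have oU := lp_open lp; have Uu0 := @at_compact_sub _ _ _ _ A i u0 Cu0.
  have [eta eta0 hn] := dominated_interpolation
    [seq delta_mx ord0 j | j <- js] B oU (sK _ _ _ _ lp lp) Uu0 e0.
  exists ([set u | forall f : 'rV[R]_n -> R,
     dominated (at_dom i) (fun p => K (at_param i p.1) (at_param i p.2)) B f ->
    (forall u, at_dom i u -> `|f u| <= eta) ->
    `|iter_derive [seq delta_mx ord0 j | j <- js] f u| <= e], [set t | t <= eta]).
    split => //=; exact: nbhs_right_le.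
  move=> [u t] /= [hu te] f Kf ft; apply: hu; first exact: kernel_dominated_comp.
  by move=> w _; apply: (le_trans (ft _)).
have : \forall eta \near (0 : R)^'+, (0 < eta) /\
   forall p, p \in [seq (i, js) | i <- enum 'I_(at_size A), js <- dirs] -> P p eta.
  apply: filterI; first exact: nbhs_right_gt.
  by apply: (@near_seq R (0 : R)^'+ _ _ P) => p _; exact: nearP.
move=> /filter_ex[eta [eta0 hP]]; exists eta => // f Kf feta.
apply: ge_ereal_sup => _ [i [js [u [jsr Cu ->]]]]; rewrite lee_fin.
apply: (hP (i, js)) => //.
by apply/allpairsP; exists (i, js); split=> //=; [rewrite mem_enum|exact: dirsP].
Qed.

End interpolation.

(** * Reproducing kernel Hilbert spaces *)

Section rkhs_theory.
Context {R : realType} {T : choiceType} {K : T -> T -> R} (H : rkhs K).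
Implicit Types f h : T -> R.
Local Notation car := (rk_car H).
Local Notation ip := (rk_ip H).

Lemma rk_sub f h : car f -> car h -> car (f \- h).
Proof.
move=> cf ch; rewrite (_ : f \- h = fun x => -1 * h x + f x); first exact: rk_lin.
by apply/funext => x /=; ring.
Qed.

Lemma rk_ip_lincomb2 a f h : car f -> car h ->
  ip (fun x => a * f x + h x) (fun x => a * f x + h x) =
  a ^+ 2 * ip f f + 2 * a * ip f h + ip h h.
Proof.
move=> cf ch; have cl := rk_lin a cf ch.
rewrite rk_ip_lin// (rk_ip_sym cf cl) (rk_ip_sym ch cl) !rk_ip_lin//.
by rewrite (rk_ip_sym ch cf); ring.
Qed.

Lemma rk_ip_sub2 f h : car f -> car h ->
  ip (f \- h) (f \- h) = ip f f - 2 * ip f h + ip h h.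
Proof.
move=> cf ch; rewrite (_ : f \- h = fun x => -1 * h x + f x); last first.
  by apply/funext => x /=; ring.
by rewrite rk_ip_lincomb2// (rk_ip_sym ch cf); ring.
Qed.

Lemma rk_cauchy_schwarz f h : car f -> car h -> ip f h ^+ 2 <= ip f f * ip h h.
Proof.
move=> cf ch; have [f0|f0] := eqVneq (ip f f) 0.
  suff -> : ip f h = 0 by rewrite f0 mul0r expr0n.
  have := rk_ip_eq0 cf f0 => ->.
  have := rk_ip_lin (-1) (rk_zero H) (rk_zero H) ch.
  rewrite (_ : (fun x : T => -1 * 0 + 0) = fun=> 0); last by apply/funext => x; ring.
  by move=> h0; lra.
have fgt0 : 0 < ip f f by rewrite lt_neqAle eq_sym f0 rk_ip_ge0.
have := rk_ip_ge0 (rk_lin (- (ip f h / ip f f)) cf ch).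
rewrite rk_ip_lincomb2// => h1.
have h2 : 0 <= (- (ip f h / ip f f)) ^+ 2 * ip f f +
  2 * - (ip f h / ip f f) * ip f h + ip h h := h1.
have E : ip f f * ip h h - ip f h ^+ 2 = ip f f * ((- (ip f h / ip f f)) ^+ 2 * ip f f +
  2 * - (ip f h / ip f f) * ip f h + ip h h) by field.
by rewrite -subr_ge0 E mulr_ge0// ltW.
Qed.

Lemma rk_kernelE x y : K x y = ip (K x) (K y).
Proof. by rewrite rk_reproducing//; exact: rk_kernel. Qed.

Lemma rk_kernel_sum (s : seq (R * T)) :
  let k := fun x => \sum_(p <- s) p.1 * K p.2 x in
  car k /\ forall f, car f -> ip k f = \sum_(p <- s) p.1 * f p.2.
Proof.
elim: s => [|p s [IH1 IH2]] /=.
  rewrite (_ : (fun x => _) = fun=> 0); last by apply/funext => x; rewrite big_nil.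
  split => [|f cf]; first exact: rk_zero.
  have := rk_ip_lin (-1) (rk_zero H) (rk_zero H) cf.
  rewrite (_ : (fun x : T => -1 * 0 + 0) = fun=> 0); last by apply/funext => x; ring.
  by rewrite big_nil => h0; lra.
rewrite (_ : (fun x => _) = fun x => p.1 * K p.2 x + \sum_(q <- s) q.1 * K q.2 x); last first.
  by apply/funext => x; rewrite big_cons.
have cK := rk_kernel H p.2.
split => [|f cf]; first exact: rk_lin.
by rewrite rk_ip_lin// IH2// big_cons rk_ip_sym// rk_reproducing.
Qed.

Lemma rk_kernel_dominated f B : car f -> rk_norm H f <= B -> kernel_dominated K B f.
Proof.
move=> cf fB s; have [ck ipk] := rk_kernel_sum s.
rewrite -ipk//; apply: (le_trans (rk_cauchy_schwarz ck cf)).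
set k := (fun x => _) in ck ipk *.
have -> : \sum_(p <- s) \sum_(q <- s) p.1 * q.1 * K p.2 q.2 = ip k k.
  rewrite ipk//; apply: eq_bigr => p _; rewrite /k mulr_sumr; apply: eq_bigr => q _.
  by rewrite !rk_kernelE (rk_ip_sym (rk_kernel H q.2) (rk_kernel H p.2)); ring.
rewrite mulrC ler_wpM2r ?rk_ip_ge0//.
rewrite -[leLHS]sqr_sqrtr ?rk_ip_ge0// ler_pXn2r// ?nnegrE ?sqrtr_ge0//.
by apply: le_trans fB; exact: sqrtr_ge0.
Qed.

Lemma rk_kernel_ge0 x : 0 <= K x x.
Proof. by rewrite rk_kernelE rk_ip_ge0//; exact: rk_kernel. Qed.

Lemma rk_eval_le f x : car f -> f x ^+ 2 <= ip f f * K x x.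
Proof.
move=> cf; rewrite -(rk_reproducing x cf) [K x x]rk_kernelE.
exact: rk_cauchy_schwarz (rk_kernel H x).
Qed.

Lemma rk_cvg_eval (u : nat -> T -> R) f x : (forall k, car (u k)) -> car f ->
  (fun k => ip (u k \- f) (u k \- f)) @ \oo --> (0 : R) ->
  (fun k => u k x) @ \oo --> f x.
Proof.
move=> cu cf uf; apply/cvgrPdist_le => e e0.
have K1 : 0 < K x x + 1 by rewrite ltr_wpDl// rk_kernel_ge0.
have e20 : 0 < e ^+ 2 / (K x x + 1) by rewrite divr_gt0// exprn_gt0.
move/cvgrPdist_lt : uf => /(_ _ e20); apply: filterS => k.
rewrite sub0r normrN => uk.
have := rk_eval_le x (rk_sub (cu k) cf); rewrite /= => h.
rewrite distrC ltW// -(@ltr_pXn2r _ 2)// ?nnegrE ?ltW// real_normK ?num_real//.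
have i0 := rk_ip_ge0 (rk_sub (cu k) cf).
rewrite (ger0_norm i0) ltr_pdivlMr// in uk.
apply: (le_lt_trans h); apply: le_lt_trans uk.
by apply: ler_wpM2l => //; rewrite lerDl.
Qed.

Lemma rk_cvg_norm (u : nat -> T -> R) f : (forall k, car (u k)) -> car f ->
  (fun k => ip (u k \- f) (u k \- f)) @ \oo --> (0 : R) ->
  (fun k => ip (u k) (u k)) @ \oo --> ip f f.
Proof.
move=> cu cf uf.
pose e k := ip (u k \- f) (u k \- f).
have E k : ip (u k) (u k) = e k + 2 * ip (u k \- f) f + ip f f.
  have := @rk_ip_lincomb2 1 _ _ (rk_sub (cu k) cf) cf.
  rewrite (_ : (fun x => _) = u k); first by move=> ->; rewrite /e expr1n !mul1r mulr1.
  by apply/funext => x /=; ring.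
have cross : (fun k => ip (u k \- f) f) @ \oo --> (0 : R).
  apply/cvgrPdist_le => d d0.
  have f0 := rk_ip_ge0 cf.
  have F1 : 0 < ip f f + 1 by rewrite ltr_wpDl.
  have e20 : 0 < d ^+ 2 / (ip f f + 1) by rewrite divr_gt0// exprn_gt0.
  move/cvgrPdist_lt : uf => /(_ _ e20); apply: filterS => k.
  rewrite !sub0r !normrN => uk.
  have h := rk_cauchy_schwarz (rk_sub (cu k) cf) cf.
  have i0 := rk_ip_ge0 (rk_sub (cu k) cf).
  rewrite (ger0_norm i0) ltr_pdivlMr// in uk.
  rewrite ltW// -(@ltr_pXn2r _ 2)// ?nnegrE ?ltW// real_normK ?num_real//.
  apply: (le_lt_trans h); apply: le_lt_trans uk.
  by apply: ler_wpM2l => //; rewrite lerDl.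
rewrite (_ : (fun k => _) = fun k => e k + 2 * ip (u k \- f) f + ip f f); last first.
  by apply/funext => k; rewrite E.
rewrite -[X in _ --> X]add0r -[X in _ --> X + _](addr0 0) -[X in _ --> (_ + X) + _](mulr0 2).
apply: cvgD; last exact: cvg_cst.
by apply: cvgD => //; exact: cvgMr.
Qed.

(* The midpoint inequality makes minimizing sequences Cauchy. *)
Lemma rk_minimizer (W : (T -> R) -> R) (c : R) : 0 < c ->
  (forall f, 0 <= W f) ->
  (forall f h, W (fun x => 2^-1 * (f x + h x)) <= (W f + W h) / 2) ->
  (forall (u : nat -> T -> R) f, (forall x, (fun k => u k x) @ \oo --> f x) ->
    (fun k => W (u k)) @ \oo --> W f) ->
  exists2 f, car f & forall h, car h -> W f + c * ip f f <= W h + c * ip h h.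
Proof.
move=> c0 W0 Wmid Wcvg; pose J f := W f + c * ip f f.
have J0 f : car f -> 0 <= J f.
  by move=> cf; rewrite addr_ge0// mulr_ge0 ?rk_ip_ge0// ltW.
pose I := inf [set J f | f in car].
have hinf : has_inf [set J f | f in car].
  split; first by exists (J (fun=> 0)); exists (fun=> 0) => //; exact: rk_zero.
  by exists 0 => _ [f cf <-]; exact: J0.
have IJ f : car f -> I <= J f.
  by move=> cf; apply: ge_inf; [exact: hinf.2|exists f].
have /choice[u hu] : forall k : nat, exists f, car f /\ J f < I + k.+1%:R^-1.
  move=> k; have k0 : 0 < k.+1%:R^-1 :> R by rewrite invr_gt0.
  by have [_ [f cf <-] Jf] := inf_adherent k0 hinf; exists f.
have cu k : car (u k) := (hu k).1.
have dist f h : car f -> car h -> c / 4 * ip (f \- h) (f \- h) <= (J f + J h) / 2 - I.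
  move=> cf ch.
  have cm : car (fun x => 2^-1 * (f x + h x)).
    rewrite (_ : (fun x => _) = fun x => 2^-1 * f x + (2^-1 * h x + 0)).
      by apply: rk_lin => //; apply: rk_lin => //; exact: rk_zero.
    by apply/funext => x; ring.
  have := IJ _ cm; rewrite {1}/J.
  have -> : ip (fun x => 2^-1 * (f x + h x)) (fun x => 2^-1 * (f x + h x)) =
      (ip f f + 2 * ip f h + ip h h) / 4.
    have cs := rk_lin 1 cf ch; have E1 := rk_ip_lincomb2 1 cf ch.
    have E2 := rk_ip_lincomb2 2^-1 cs (rk_zero H).
    have z : ip (fun x => 1 * f x + h x) (fun=> 0) = 0.
      have := rk_ip_lin (-1) (rk_zero H) (rk_zero H) cs.
      rewrite (_ : (fun x : T => -1 * 0 + 0) = fun=> 0); last by apply/funext => x; ring.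
      by rewrite (rk_ip_sym cs (rk_zero H)) => h0; lra.
    have z' : ip (fun=> 0) (fun=> 0) = 0.
      have := rk_ip_lin (-1) (rk_zero H) (rk_zero H) (rk_zero H).
      rewrite (_ : (fun x : T => -1 * 0 + 0) = fun=> 0); last by apply/funext => x; ring.
      by move=> h0; lra.
    rewrite (_ : (fun x => _) = fun x => 2^-1 * (1 * f x + h x) + 0).
      by rewrite E2 E1 z z'; field.
    by apply/funext => x; ring.
  rewrite rk_ip_sub2//; have := Wmid f h; rewrite /J; nra.
have cauchy (e : R) : 0 < e -> exists N : nat, forall k l : nat,
    (N <= k)%N -> (N <= l)%N -> ip (u k \- u l) (u k \- u l) < e.
  move=> e0; have ce : 0 < c / 4 * e by rewrite mulr_gt0// divr_gt0.
  have [N _ hN] := near_infty_natSinv_lt (PosNum ce).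
  exists N => k l Nk Nl; have := dist _ _ (cu k) (cu l).
  have h1 : k.+1%:R^-1 < c / 4 * e := hN k Nk.
  have h2 : l.+1%:R^-1 < c / 4 * e := hN l Nl.
  have h3 := (hu k).2; have h4 := (hu l).2; move=> h5.
  have c4 : 0 < c / 4 by rewrite divr_gt0.
  rewrite -(ltr_pM2l c4); apply: (le_lt_trans h5).
  move: h1 h2 h3 h4; set a := k.+1%:R^-1; set b := l.+1%:R^-1; set q := c / 4 * e.
  move: a b q => a b q h1 h2 h3 h4; lra.
have [f cf uf] := rk_complete cu cauchy.
exists f => // h ch; apply: le_trans (IJ h ch).
have JuJ : (fun k => J (u k)) @ \oo --> J f.
  apply: cvgD; last by apply: cvgMr; exact: rk_cvg_norm.
  by apply: Wcvg => x; exact: rk_cvg_eval.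
have JuI : (fun k : nat => I + k.+1%:R^-1) @ \oo --> I + 0.
  by apply: cvgD; [exact: cvg_cst|exact: cvg_harmonic].
rewrite addr0 in JuI; refine (ler_cvg_to JuJ JuI _).
by apply: nearW => k; exact: ltW (hu k).2.
Qed.

End rkhs_theory.

(** * Product measures *)

Section sigma_finite_measures.
Context {R : realType} {d1 d2 : measure_display} {T1 : measurableType d1}
  {T2 : measurableType d2}.

Section product.
Variables (m1 : {sigma_finite_measure set T1 -> \bar R})
  (m2 : {sigma_finite_measure set T2 -> \bar R}).

Definition prod_measure : set (T1 * T2) -> \bar R := (m1 \x m2)%E.

HB.instance Definition _ := Measure.copy prod_measure (m1 \x m2)%E.

Let prod_measure_sigma_finite : sigma_finite setT prod_measure.
Proof.
have /sigma_finiteP[F [FT ndF Ffin]] := sigma_finiteT m1.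
have /sigma_finiteP[G [GT ndG Gfin]] := sigma_finiteT m2.
exists (fun k => F k `*` G k) => [|k]; last first.
  have [mF Flt] := Ffin k; have [mG Glt] := Gfin k.
  split; first exact: measurableX.
  by rewrite /prod_measure product_measure1E// lte_mul_pinfty// ge0_fin_numE.
apply/esym/seteqP; split=> // -[x y] _.
have [i _ Fx] : (\bigcup_i F i) x by rewrite -FT.
have [j _ Gy] : (\bigcup_i G i) y by rewrite -GT.
exists (maxn i j) => //; split=> /=.
- by have /subsetPset/(_ x Fx) := ndF _ _ (leq_maxl i j).
- by have /subsetPset/(_ y Gy) := ndG _ _ (leq_maxr i j).
Qed.

HB.instance Definition _ := Measure_isSigmaFinite.Build _ _ _ prod_measure
  prod_measure_sigma_finite.

Definition prod_sigma_finite : {sigma_finite_measure set (T1 * T2)%type -> \bar R} :=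
  prod_measure.

End product.

Section transport.
Variables (m : {sigma_finite_measure set T1 -> \bar R}) (f : T1 -> T2) (g : T2 -> T1).
Hypotheses (mf : measurable_fun setT f) (mg : measurable_fun setT g) (fK : cancel f g).

(** A pushforward need not be sigma-finite. Here the measurable left inverse [g] helps: preimages
    under [g] of the covering sets cover [T2], and pulling them back along [f] returns the original
    sets. *)
Definition transport : set T2 -> \bar R := pushforward m f.

Let measurable_preimage_f A : measurable A -> measurable (f @^-1` A).
Proof. by move=> mA; rewrite -[X in measurable X]setTI; exact: mf. Qed.

Let transport0 : transport set0 = 0%E.
Proof. by rewrite /transport /pushforward preimage_set0 measure0. Qed.

Let transport_ge0 A : (0 <= transport A)%E.
Proof. by rewrite /transport /pushforward measure_ge0. Qed.

Let transport_sigma_additive : semi_sigma_additive transport.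
Proof.
move=> F mF tF mUF; rewrite /transport /pushforward preimage_bigcup.
apply: measure_semi_sigma_additive.
- by move=> k; exact: measurable_preimage_f.
- apply/trivIsetP => i j _ _ ij; rewrite -preimage_setI.
  by move/trivIsetP : tF => /(_ i j Logic.I Logic.I ij) ->; rewrite preimage_set0.
- by rewrite -preimage_bigcup; exact: measurable_preimage_f.
Qed.

HB.instance Definition _ := isMeasure.Build _ _ _ transport
  transport0 transport_ge0 transport_sigma_additive.

Let transport_sigma_finite : sigma_finite setT transport.
Proof.
have [F FT Foo] := sigma_finiteT m.
exists (fun k => g @^-1` F k); first by rewrite -preimage_bigcup -FT preimage_setT.
move=> k; have [mF Flt] := Foo k; split.
  by rewrite -[X in measurable X]setTI; exact: mg.
by rewrite /transport /pushforward -comp_preimage (_ : g \o f = id)//; exact/funext.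
Qed.

HB.instance Definition _ := Measure_isSigmaFinite.Build _ _ _ transport
  transport_sigma_finite.

Definition transport_measure : {sigma_finite_measure set T2 -> \bar R} := transport.

End transport.
End sigma_finite_measures.

Section product_integral.
Context {R : realType} {d1 d2 : measure_display} {T1 : measurableType d1}
  {T2 : measurableType d2}.
Variables (m1 : {sigma_finite_measure set T1 -> \bar R})
  (m2 : {sigma_finite_measure set T2 -> \bar R}).

Lemma integrable_prod (f : T1 -> R) (h : T2 -> R) :
  m1.-integrable setT (EFin \o f) -> m2.-integrable setT (EFin \o h) ->
  (m1 \x m2)%E.-integrable setT (fun p => (f p.1 * h p.2)%:E).
Proof.
move=> /integrableP[mf intf] /integrableP[mh inth].
have mfR : measurable_fun setT f by exact/measurable_EFinP.
have mhR : measurable_fun setT h by exact/measurable_EFinP.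
have mfh : measurable_fun [set: T1 * T2] (fun p => (f p.1 * h p.2)%:E).
  by apply/measurable_EFinP; apply: measurable_funM; exact: measurableT_comp.
apply/(integrable12ltyP m1 m2 mfh).
have E x : (\int[m2]_y `|(f x * h y)%:E| = `|f x|%:E * \int[m2]_y `|(h y)%:E|)%E.
  rewrite -ge0_integralZl_EFin//.
  - by apply: eq_integral => y _; rewrite /= normrM EFinM.
  - by apply: measurableT_comp.
under eq_integral do rewrite /= E.
have hfin : (\int[m2]_y `|(h y)%:E|)%E \is a fin_num.
  by rewrite ge0_fin_numE ?integral_ge0.
rewrite ge0_integralZr//; [|exact/measurable_EFinP/measurableT_comp|exact: integral_ge0].
by rewrite lte_mul_pinfty ?integral_ge0// ge0_fin_numE ?integral_ge0.
Qed.

Lemma Rintegral_prod (f : T1 -> R) (h : T2 -> R) :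
  m1.-integrable setT (EFin \o f) -> m2.-integrable setT (EFin \o h) ->
  Rintegral (m1 \x m2)%E setT (fun p => f p.1 * h p.2) =
  Rintegral m1 setT f * Rintegral m2 setT h.
Proof.
move=> intf inth; rewrite /Rintegral -integral12_prod_meas1; last exact: integrable_prod.
have hfin := integrable_fin_num measurableT inth.
have ffin := integrable_fin_num measurableT intf.
have E x : (\int[m2]_y (f x * h y)%:E = (f x * fine (\int[m2]_y (h y)%:E))%:E)%E.
  by rewrite EFinM fineK// -integralZl.
have -> : (\int[m1]_x fubini_F m2 (fun p => (f p.1 * h p.2)%:E) x =
    \int[m1]_x ((fine (\int[m2]_y (h y)%:E))%:E * (f x)%:E))%E.
  by apply: eq_integral => x _; rewrite /fubini_F E mulrC EFinM.
by rewrite integralZl// mulrC fineM.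
Qed.

End product_integral.

Section power_measure_theory.
Context {R : realType} {d : measure_display} {T : measurableType d}.

Definition tuple_cons (n : nat) (p : T * n.-tuple T) : n.+1.-tuple T :=
  cons_tuple p.1 p.2.

Lemma measurable_tuple_cons n : measurable_fun setT (@tuple_cons n).
Proof. by apply: measurable_cons; [exact: measurable_fst|exact: measurable_snd]. Qed.

Lemma measurable_tuple_uncons n :
  measurable_fun setT (fun t : n.+1.-tuple T => (thead t, [tuple of behead t])).
Proof.
apply/measurable_fun_pairP; split; last exact: measurable_behead.
exact: measurable_tnth.
Qed.

(** [power_measure] yields a bare set function. The induction rebuilds it with a sigma-finite
    measure structure, so that Fubini applies to the next factor; a sigma type is used because this
    structure is data. *)
Lemma power_measure_exists (m : {sigma_finite_measure set T -> \bar R}) n :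
  {P : {sigma_finite_measure set (n.-tuple T) -> \bar R} |
    (P : set _ -> \bar R) = power_measure m n}.
Proof.
elim: n => [|n [P PE]].
  by exists (dirac [tuple] : probability _ R).
have K : cancel (@tuple_cons n) (fun t => (thead t, [tuple of behead t])).
  by move=> [x t]; rewrite /tuple_cons theadE; congr pair; apply: val_inj.
exists (transport_measure (prod_sigma_finite m P) (@measurable_tuple_cons n)
  (@measurable_tuple_uncons n) K).
by rewrite /= -PE.
Qed.

Definition power_sigma_finite (m : {sigma_finite_measure set T -> \bar R}) n :
  {sigma_finite_measure set (n.-tuple T) -> \bar R} := sval (power_measure_exists m n).

Lemma power_sigma_finiteE m n :
  (power_sigma_finite m n : set _ -> \bar R) = power_measure m n.
Proof. exact: svalP (power_measure_exists m n). Qed.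

Lemma power_sigma_finiteS m n : (power_sigma_finite m n.+1 : set _ -> \bar R) =
  pushforward (m \x power_sigma_finite m n)%E (@tuple_cons n).
Proof. by rewrite power_sigma_finiteE /= -power_sigma_finiteE. Qed.

Lemma integrable_powerS (m : {sigma_finite_measure set T -> \bar R}) n
    (f : n.+1.-tuple T -> R) : measurable_fun setT f ->
  (m \x power_sigma_finite m n)%E.-integrable setT (fun p => (f (tuple_cons p))%:E) ->
  (power_sigma_finite m n.+1).-integrable setT (EFin \o f) /\
  Rintegral (power_sigma_finite m n.+1) setT f =
  Rintegral (m \x power_sigma_finite m n)%E setT (fun p => f (tuple_cons p)).
Proof.
move=> mf intf; have mf' : measurable_fun setT (EFin \o f) by exact/measurable_EFinP.
have intf' : (m \x power_sigma_finite m n)%E.-integrable (@tuple_cons n @^-1` setT)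
    ((EFin \o f) \o @tuple_cons n) by rewrite preimage_setT.
split.
  have := integrable_pushforward (@measurable_tuple_cons n) mf' intf' measurableT.
  by rewrite power_sigma_finiteS.
congr fine; transitivity
  (\int[pushforward (m \x power_sigma_finite m n) (@tuple_cons n)]_x (f x)%:E)%E.
  by rewrite -power_sigma_finiteS.
by rewrite (integral_pushforward (@measurable_tuple_cons n) mf' intf')// preimage_setT.
Qed.

Lemma Rintegral_power_prod (m : {sigma_finite_measure set T -> \bar R}) n (F : 'I_n -> T -> R) :
  (forall i, m.-integrable setT (EFin \o F i)) ->
  (power_sigma_finite m n).-integrable setT
    (EFin \o (fun t => \prod_(i < n) F i (tnth t i))) /\
  Rintegral (power_sigma_finite m n) setT (fun t => \prod_(i < n) F i (tnth t i)) =
  \prod_(i < n) Rintegral m setT (F i).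
Proof.
elim: n F => [|n IH] F intF.
  rewrite (_ : (fun t => _) = cst 1); last by apply/funext => t; rewrite big_ord0.
  have P1 : power_sigma_finite m 0 setT = 1%E.
    by rewrite power_sigma_finiteE/= diracE in_setT.
  split; last by rewrite big_ord0 Rintegral_cst// [X in fine X]P1 mulr1.
  apply: measurable_bounded_integrable => //; first by rewrite [X in (X < _)%E]P1 ltry.
  by exists 1; split=> [|M BM x _ /=]; rewrite ?num_real// normr1 ltW.
have [I1 I2] := IH (fun i => F (lift ord0 i)) (fun i => intF (lift ord0 i)).
have E p : \prod_(i < n.+1) F i (tnth (tuple_cons p) i) =
    F ord0 p.1 * \prod_(i < n) F (lift ord0 i) (tnth p.2 i).
  rewrite big_ord_recl/=; congr (_ * _); apply: eq_bigr => i _.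
  by rewrite /tuple_cons tnthS.
have mF i : measurable_fun setT (F i).
  by have /integrableP[/measurable_EFinP] := intF i.
have mprod : measurable_fun setT (fun t : n.+1.-tuple T => \prod_(i < n.+1) F i (tnth t i)).
  by apply: measurable_prod => i _; apply: measurableT_comp => //; exact: measurable_tnth.
have intprod : (m \x power_sigma_finite m n)%E.-integrable setT
    (fun p => (\prod_(i < n.+1) F i (tnth (tuple_cons p) i))%:E).
  by under eq_fun do rewrite E; exact: integrable_prod (intF ord0) I1.
have [J1 J2] := integrable_powerS mprod intprod.
split => //; rewrite J2; under eq_Rintegral do rewrite E.
by rewrite (Rintegral_prod (intF ord0) I1) I2 big_ord_recl.
Qed.

End power_measure_theory.

(** * Second moments of degenerate double sums *)

Section markov.
Context {R : realType} {d : measure_display} {T : measurableType d}.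

Lemma markov_Rintegral (nu : {measure set T -> \bar R}) (f : T -> R) (c : R) :
  0 < c -> nu.-integrable setT (EFin \o f) -> (forall x, 0 <= f x) ->
  (nu [set x | (c <= f x)%R] <= (Rintegral nu setT f / c)%:E)%E.
Proof.
move=> c0 intf f0; have /integrableP[/measurable_EFinP mf _] := intf.
have mA : measurable [set x | c <= f x].
  rewrite (_ : [set x | _] = f @^-1` `[c, +oo[%classic).
    by rewrite -[X in measurable X]setTI; exact: mf.
  by apply/seteqP; split => x /=; rewrite in_itv/= andbT.
rewrite EFinM fineK ?(integrable_fin_num _ intf)// lee_pdivlMr//.
apply: (@le_trans _ _ (\int[nu]_(x in [set x | (c <= f x)%R]) (f x)%:E)%E).
  rewrite muleC -integral_cst//; apply: ge0_le_integral => //.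
  - by move=> x _; rewrite lee_fin ltW.
  - by apply/measurable_EFinP; exact: measurable_funTS.
by apply: ge0_subset_integral => //; [exact/measurable_EFinP|move=> x _; rewrite lee_fin].
Qed.

(** The passage from a possibly nonmeasurable event to a measurable set containing it: cover by [B]
    followed by empty sets. *)
Lemma mu_ext_le (nu : set T -> \bar R) (A B : set T) : nu set0 = 0%E ->
  measurable B -> A `<=` B -> ((nu^*)%mu A <= nu B)%E.
Proof.
move=> nu0 mB AB; apply: ereal_inf_lbound.
exists (fun k => if k is 0%N then B else set0).
  by split=> [[|k]//|x /AB Bx]; exists 0%N.
apply: lim_near_cst => //; near=> k.
rewrite (_ : k = k.-1.+1); last by rewrite prednK//; near: k; exact: nbhs_infty_gt.
by rewrite big_nat_recl//= big1 ?adde0.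
Unshelve. all: by end_near. Qed.

End markov.

Section degenerate_second_moment.
Context {R : realType} {d : measure_display} {T : measurableType d}.
Variable mu : probability T R.
Local Notation P m := (power_sigma_finite mu m).

Lemma power_probability_setT m : P m setT = 1%E.
Proof.
elim: m => [|m IH]; first by rewrite power_sigma_finiteE/= diracE in_setT.
rewrite power_sigma_finiteS /pushforward preimage_setT -setXTT product_measure1E//.
by rewrite [X in (X * _)%E]probability_setT IH mule1.
Qed.

Lemma integrable_power_cst m (c : R) : (P m).-integrable setT (EFin \o (fun=> c)).
Proof.
apply: measurable_bounded_integrable => //.
  by rewrite [X in (X < _)%E]power_probability_setT ltry.
by exists `|c|; split=> [|M BM x _ /=]; rewrite ?num_real// ltW.
Qed.

Lemma Rintegral_power_cst m (c : R) : Rintegral (P m) setT (fun=> c) = c.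
Proof. by rewrite Rintegral_cst// [X in fine X]power_probability_setT mulr1. Qed.

Variables (w : T -> R) (G : T -> T -> R).
Hypotheses (mw : measurable_fun setT w)
  (mG : measurable_fun setT (fun p : T * T => G p.1 p.2))
  (Gsym : forall z z', G z z' = G z' z)
  (Gle1 : forall z z', `|G z z'| <= 1)
  (w2 : mu.-integrable setT (EFin \o (fun z => w z ^+ 2)))
  (wG0 : forall z', Rintegral mu setT (fun z => w z * G z z') = 0).

(** This serves both concentration bounds: with [w] the residual [f - g] and [G] the Gram kernel of
    the orthants, and with [w] a centred indicator and [G = 1]. *)
Definition double_sum (s : seq T) : R :=
  \sum_(a <- s) \sum_(b <- s) w a * w b * G a b.

Let cross (x : T) (s : seq T) : R := 2 * \sum_(b <- s) w b * (w x * G x b).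

(** The source of an integrable majorant for [cross]. *)
Let abs_sum (s : seq T) : R := \sum_(b <- s) `|w b|.

Let double_sum_cons x s :
  double_sum (x :: s) = w x ^+ 2 * G x x + (cross x s + double_sum s).
Proof.
rewrite /double_sum /cross !big_cons; under [X in _ + X]eq_bigr do rewrite big_cons.
rewrite big_split/= (_ : \sum_(i <- s) w i * w x * G i x = \sum_(i <- s) w i * (w x * G x i)).
  rewrite (_ : \sum_(j <- s) w x * w j * G x j = \sum_(i <- s) w i * (w x * G x i)).
    by ring.
  by apply: eq_bigr => i _; ring.
by apply: eq_bigr => i _; rewrite Gsym; ring.
Qed.

Let int1 : mu.-integrable setT (EFin \o (fun=> 1 : R)).
Proof. by apply: (@bounded_integrable _ _ _ _ _ 1) => // x; rewrite normr1. Qed.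

Let intw : mu.-integrable setT (EFin \o (fun x => `|w x|)).
Proof.
have := integrableD measurableT int1 w2; apply: le_integrable => //.
  by apply/measurable_EFinP; exact: measurableT_comp.
move=> x _; rewrite /= lee_fin normr_id [leRHS]ger0_norm; last by rewrite addr_ge0// sqr_ge0.
by rewrite -real_normK ?num_real//; have := sqr_ge0 (`|w x| - 1); nra.
Qed.

Let measurable_nth m i : measurable_fun setT (fun S : m.-tuple T => w (tnth S i)).
Proof. by apply: measurableT_comp => //; exact: measurable_tnth. Qed.

Let measurable_abs_sum m : measurable_fun setT (fun S : m.-tuple T => abs_sum S).
Proof.
rewrite /abs_sum; under eq_fun do rewrite big_tuple.
by apply: measurable_sum => i; apply: measurableT_comp => //; exact: measurable_nth.
Qed.

Let measurable_double_sum m : measurable_fun setT (fun S : m.-tuple T => double_sum S).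
Proof.
rewrite /double_sum; under eq_fun do rewrite big_tuple.
apply: measurable_sum => i; under eq_fun do rewrite big_tuple.
apply: measurable_sum => j; apply: measurable_funM.
  by apply: measurable_funM; exact: measurable_nth.
apply: (measurableT_comp mG (g := fun S : m.-tuple T => (tnth S i, tnth S j))).
by apply/measurable_fun_pairP; split; exact: measurable_tnth.
Qed.

Let measurable_cross m :
  measurable_fun setT (fun p : T * m.-tuple T => cross p.1 p.2).
Proof.
apply: measurable_funM => //; under eq_fun do rewrite big_tuple.
have mt i : measurable_fun setT (fun p : T * m.-tuple T => tnth p.2 i).
  by apply: (measurableT_comp (measurable_tnth i)); exact: measurable_snd.
apply: measurable_sum => i; apply: measurable_funM.
  by apply: (measurableT_comp mw).
apply: measurable_funM; first by apply: (measurableT_comp mw); exact: measurable_fst.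
apply: (measurableT_comp mG (g := fun p : T * m.-tuple T => (p.1, tnth p.2 i))).
by apply/measurable_fun_pairP; split; [exact: measurable_fst|exact: mt].
Qed.

Let abs_sum_ge0 s : 0 <= abs_sum s.
Proof. by apply: sumr_ge0. Qed.

Let cross_le x s : `|cross x s| <= `|w x| * (2 * abs_sum s).
Proof.
rewrite normrM ger0_norm// mulrCA ler_wpM2l// mulr_sumr.
apply: (le_trans (ler_norm_sum _ _ _)); apply: ler_sum => b _.
rewrite !normrM mulrCA ler_wpM2l//; have := Gle1 x b; have := normr_ge0 (w b); nra.
Qed.

Let int_abs_sum m : (P m).-integrable setT (EFin \o (fun S : m.-tuple T => abs_sum S)).
Proof.
elim: m => [|m IH].
  have := integrable_power_cst 0 0; apply: eq_integrable => // S _.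
  by rewrite /= /abs_sum (tuple0 S) big_nil.
have intS : (mu \x P m)%E.-integrable setT
    (fun p => (abs_sum (tuple_cons p))%:E).
  have := integrableD measurableT (integrable_prod intw (integrable_power_cst m 1))
    (integrable_prod int1 IH).
  apply: eq_integrable => // -[x S] _ /=.
  by rewrite /abs_sum /= big_cons mulr1 mul1r EFinD.
by have [] := integrable_powerS (@measurable_abs_sum m.+1) intS.
Qed.

Let int_cross m : (mu \x P m)%E.-integrable setT (fun p => (cross p.1 p.2)%:E).
Proof.
have int2 : (P m).-integrable setT (EFin \o (fun S : m.-tuple T => 2 * abs_sum S)).
  by have := integrableZl measurableT 2 (int_abs_sum m); exact: eq_integrable.
have := integrable_prod intw int2; apply: le_integrable => //.
  by apply/measurable_EFinP; exact: measurable_cross.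
move=> [x S] _; rewrite /= lee_fin [leRHS]ger0_norm; first exact: cross_le.
by rewrite !mulr_ge0// abs_sum_ge0.
Qed.

Let int_wG z : mu.-integrable setT (EFin \o (fun x => w x * G x z)).
Proof.
apply: le_integrable intw => //.
  apply/measurable_EFinP; apply: measurable_funM => //.
  apply: (measurableT_comp mG (g := fun x => (x, z))).
  by apply/measurable_fun_pairP; split; [exact: measurable_id|exact: measurable_cst].
move=> x _; rewrite /= lee_fin normr_id normrM.
by have := Gle1 x z; have := normr_ge0 (w x); nra.
Qed.

Let Rintegral_cross_sum s :
  mu.-integrable setT (EFin \o (fun x => \sum_(b <- s) w b * (w x * G x b))) /\
  Rintegral mu setT (fun x => \sum_(b <- s) w b * (w x * G x b)) = 0.
Proof.
elim: s => [|b s [IH1 IH2]].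
  under eq_fun do rewrite big_nil.
  split; last by rewrite Rintegral_probability_cst.
  by apply: (@bounded_integrable _ _ _ _ _ 0) => // x; rewrite normr0.
have E : (fun x => \sum_(c <- b :: s) w c * (w x * G x c)) =
    (fun x => w b * (w x * G x b) + \sum_(c <- s) w c * (w x * G x c)).
  by apply/funext => x; rewrite big_cons.
have intb : mu.-integrable setT (EFin \o (fun x => w b * (w x * G x b))).
  by have := integrableZl measurableT (w b) (int_wG b); exact: eq_integrable.
rewrite E; split.
  by have := integrableD measurableT intb IH1; exact: eq_integrable.
by rewrite RintegralD// IH2 (RintegralZl _ measurableT (int_wG b)) wG0 mulr0 addr0.
Qed.

(** By Fubini the new point is integrated first, with the tuple frozen; degeneracy ([wG0]) then
    kills every summand. *)
Let Rintegral_cross m :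
  Rintegral (mu \x P m)%E setT (fun p => cross p.1 p.2) = 0.
Proof.
rewrite /Rintegral -(integral21_prod_meas1 (int_cross m)).
rewrite (eq_integral (fun=> 0%E)) ?integral0// => S _.
have [I1 I2] := Rintegral_cross_sum S.
rewrite /fubini_G /cross; under eq_integral do rewrite /= EFinM.
rewrite integralZl// -[X in (_ * X)%E]fineK ?(integrable_fin_num _ I1)//.
by rewrite -[fine _]/(Rintegral mu setT _) I2 mule0.
Qed.

Let int_diag : mu.-integrable setT (EFin \o (fun x => w x ^+ 2 * G x x)).
Proof.
apply: le_integrable w2 => //.
  apply/measurable_EFinP; apply: measurable_funM; first exact: measurable_funX.
  apply: (measurableT_comp mG (g := fun x => (x, x))).
  by apply/measurable_fun_pairP; split; exact: measurable_id.
move=> x _; rewrite /= lee_fin normrM.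
by have := Gle1 x x; have := normr_ge0 (w x ^+ 2); nra.
Qed.

Let Rintegral_diag : Rintegral mu setT (fun x => w x ^+ 2 * G x x) <=
  Rintegral mu setT (fun x => w x ^+ 2).
Proof.
apply: (le_Rintegral measurableT int_diag w2) => x _.
by have := Gle1 x x; rewrite ler_norml => /andP[_]; have := sqr_ge0 (w x); nra.
Qed.

(** Adding a point contributes its diagonal term, of mean at most that of [w ^+ 2], and cross terms
    of mean 0. The growth is therefore linear in [m] although the sum has [m ^ 2] terms. *)
Lemma Rintegral_double_sum m :
  (P m).-integrable setT (EFin \o (fun S : m.-tuple T => double_sum S)) /\
  Rintegral (P m) setT (fun S : m.-tuple T => double_sum S) <=
  m%:R * Rintegral mu setT (fun x => w x ^+ 2).
Proof.
elim: m => [|m [IH1 IH2]].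
  have E : (fun S : 0.-tuple T => double_sum S) = fun=> 0.
    by apply/funext => S; rewrite (tuple0 S) /double_sum big_nil.
  rewrite E Rintegral_power_cst mul0r; split => //; exact: integrable_power_cst.
have E p : double_sum (tuple_cons p : m.+1.-tuple T) =
    w p.1 ^+ 2 * G p.1 p.1 * 1 + (cross p.1 p.2 + 1 * double_sum p.2).
  by case: p => x S; rewrite /= double_sum_cons mulr1 mul1r.
have I1 := integrable_prod int_diag (integrable_power_cst m 1).
have I2 := integrable_prod int1 IH1.
have I3 := integrableD measurableT (int_cross m) I2.
have intS : (mu \x P m)%E.-integrable setT
    (fun p => (double_sum (tuple_cons p : m.+1.-tuple T))%:E).
  have := integrableD measurableT I1 I3; apply: eq_integrable => // p _.
  by rewrite E !EFinD.
have [J1 J2] := integrable_powerS (@measurable_double_sum m.+1) intS.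
split=> //; rewrite J2; under eq_Rintegral do rewrite E.
rewrite RintegralD// RintegralD//.
rewrite (Rintegral_prod int_diag (integrable_power_cst m 1)) (Rintegral_prod int1 IH1).
rewrite Rintegral_cross Rintegral_power_cst Rintegral_probability_cst.
by have := Rintegral_diag; rewrite -natr1; lra.
Qed.

Hypothesis double_sum_ge0 : forall s, 0 <= double_sum s.

Lemma double_sum_tail m (c : R) : (0 < m)%N -> 0 < c ->
  (power_measure mu m [set S : m.-tuple T | (c <= (m%:R ^+ 2)^-1 * double_sum S)%R] <=
  (Rintegral mu setT (fun x => w x ^+ 2) / (m%:R * c))%:E)%E.
Proof.
move=> m0 c0; rewrite -power_sigma_finiteE.
have [I1 I2] := Rintegral_double_sum m.
have m0' : 0 < m%:R :> R by rewrite ltr0n.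
have mc : 0 < m%:R ^+ 2 * c by rewrite mulr_gt0// exprn_gt0.
rewrite (_ : [set S | _] = [set S : m.-tuple T | m%:R ^+ 2 * c <= double_sum S]); last first.
  by apply/seteqP; split => S /=; rewrite ler_pdivlMl// exprn_gt0.
apply: le_trans (markov_Rintegral mc I1 (fun S => double_sum_ge0 S)) _.
rewrite lee_fin ler_pdivrMr//; apply: (le_trans I2).
by rewrite le_eqVlt; apply/orP; left; apply/eqP; field; rewrite !gt_eqF.
Qed.

Lemma measurable_double_sum_ge m (c : R) :
  measurable [set S : m.-tuple T | c <= (m%:R ^+ 2)^-1 * double_sum S].
Proof.
rewrite (_ : [set S | _] =
  (fun S : m.-tuple T => (m%:R ^+ 2)^-1 * double_sum S) @^-1` `[c, +oo[%classic).
  have mf : measurable_fun setT (fun S : m.-tuple T => (m%:R ^+ 2)^-1 * double_sum S).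
    by apply: measurable_funM => //; exact: measurable_double_sum.
  by rewrite -[X in measurable X]setTI; exact: mf.
by apply/seteqP; split => x /=; rewrite in_itv/= andbT.
Qed.

End degenerate_second_moment.

(** * Conditional expectations *)

Section disintegration.
Context {R : realType} {d1 d2 : measure_display} {T1 : measurableType d1}
  {T2 : measurableType d2}.

Section graph_kernel.
Variable k : R.-pker T1 ~> T2.

(** The law of [(x, y)] with [x = p.2] fixed and [y] drawn from [k x]. The argument is a pair
    because the second kernel in [kcomp] receives the starting point together with the intermediate
    one. *)
Definition graph_measure (p : T1 * T1) (C : set (T1 * T2)) : \bar R :=
  k p.2 (xsection C p.2).

Section measure.
Variable p : T1 * T1.

Let graph_measure0 : graph_measure p set0 = 0%E.
Proof. by rewrite /graph_measure xsection0 measure0. Qed.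

Let graph_measure_ge0 C : (0 <= graph_measure p C)%E.
Proof. by rewrite /graph_measure measure_ge0. Qed.

Let graph_measure_sigma_additive : semi_sigma_additive (graph_measure p).
Proof.
move=> F mF tF mUF; rewrite /graph_measure xsection_bigcup.
apply: measure_semi_sigma_additive.
- by move=> i; exact: measurable_xsection.
- exact: trivIset_xsection.
- by rewrite -xsection_bigcup; exact: measurable_xsection.
Qed.

HB.instance Definition _ := isMeasure.Build _ _ _ (graph_measure p)
  graph_measure0 graph_measure_ge0 graph_measure_sigma_additive.

End measure.

Definition graph_kernel (p : T1 * T1) : {measure set (T1 * T2) -> \bar R} :=
  graph_measure p.

Let measurable_graph_kernel C : measurable C ->
  measurable_fun setT (graph_kernel ^~ C).
Proof.
move=> mC.
apply: (@measurableT_comp _ _ _ _ _ _ (fun x => k x (xsection C x)) _ snd) => //.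
by apply: measurable_fun_xsection_finite_kernel; exact: mem_set.
Qed.

HB.instance Definition _ := isKernel.Build _ _ _ _ _ graph_kernel
  measurable_graph_kernel.

Let graph_kernel_prob p : graph_kernel p setT = 1%E.
Proof. by rewrite /graph_kernel/= /graph_measure xsectionE preimage_setT prob_kernel. Qed.

HB.instance Definition _ := Kernel_isProbability.Build _ _ _ _ _ graph_kernel
  graph_kernel_prob.

Lemma integral_graph_kernel p (F : T1 * T2 -> \bar R) : (forall z, 0 <= F z)%E ->
  measurable_fun setT F ->
  (\int[graph_kernel p]_z F z = \int[k p.2]_y F (p.2, y))%E.
Proof.
move=> F0 mF.
have -> : (graph_kernel p : set _ -> \bar R) = pushforward (k p.2) (fun y => (p.2, y)).
  by apply/funext => C; rewrite /pushforward/= /graph_measure xsectionE.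
have mp : measurable_fun setT (fun y : T2 => (p.2, y)).
  by apply/measurable_fun_pairP; split; [exact: measurable_cst|exact: measurable_id].
by rewrite (ge0_integral_pushforward mp).
Qed.

End graph_kernel.

Variables (mu : probability (T1 * T2)%type R) (k : R.-pker T1 ~> T2).
Hypothesis muk : regular_cond_proba mu k.

Let k1 : R.-pker T1 ~> T1 :=
  kprobability (measurable_cst (marginal1 mu : pprobability T1 R)).

(** The composition of the constant kernel [marginal1 mu] with the graph kernel agrees with [mu] on
    rectangles, which generate the product sigma-algebra and are stable under intersection. The
    starting point of the composition is arbitrary. *)
Lemma ge0_integral_disintegration (F : T1 * T2 -> \bar R) : (forall z, 0 <= F z)%E ->
  measurable_fun setT F ->
  (\int[mu]_z F z = \int[marginal1 mu]_x \int[k x]_y F (x, y))%E.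
Proof.
move=> F0 mF.
have := integral_kcomp k1 (graph_kernel k) point F0 mF.
rewrite (eq_measure_integral mu).
  move=> ->; rewrite /k1 /kprobability/=.
  by apply: eq_integral => x _; rewrite integral_graph_kernel.
have rect X1 X2 : measurable X1 -> measurable X2 ->
    kcomp k1 (graph_kernel k) point (X1 `*` X2) = mu (X1 `*` X2).
  move=> mX1 mX2; rewrite [RHS](muk mX1 mX2)/= /kcomp.
  rewrite /k1 /kprobability/= [RHS]integral_mkcond; apply: eq_integral => x _.
  rewrite /graph_measure/= patchE; case: ifPn => xX1.
    by rewrite in_xsectionX.
  by rewrite notin_xsectionX// measure0.
move=> A mA _; apply: (measure_unique
  [set C | exists A, measurable A /\ exists B, measurable B /\ C = A `*` B]
  (fun=> setT)) => //.
- rewrite measurable_prod_measurableType //; congr (<<s _ >>).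
  rewrite predeqE => C; split => [[B mB [D mD <-]]|[B [mB [D [mD ->]]]]].
    by exists B; split => //; exists D.
  by exists B => //; exists D.
- move=> _ _ [X1 [mX1 [X2 [mX2 ->]]]] [Y1 [mY1 [Y2 [mY2 ->]]]].
  rewrite -setXI; exists (X1 `&` Y1); split; first exact: measurableI.
  by exists (X2 `&` Y2); split => //; exact: measurableI.
- move=> _; exists setT; split => //; exists setT; split => //.
  by rewrite setXTT.
- by rewrite bigcup_const.
- by move=> _ [X1 [mX1 [X2 [mX2 ->]]]]; exact: rect.
- by move=> _; rewrite -setXTT [X in (X < _)%E]rect// setXTT probability_setT ltry.
Qed.

Lemma integrable_snd (g : T2 -> R) : measurable_fun setT g ->
  (marginal2 mu).-integrable setT (EFin \o g) ->
  mu.-integrable setT (fun z => (g z.2)%:E).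
Proof.
move=> mg /integrableP[_ ig]; apply/integrableP; split.
  by apply/measurable_EFinP; exact: measurableT_comp.
apply: le_lt_trans ig; rewrite /marginal2 /distribution.
rewrite (ge0_integral_pushforward measurable_snd)//.
by apply: measurableT_comp => //; exact/measurable_EFinP.
Qed.

(** To disintegrate nonnegative functions only, the signed integrand is written as [F2 - F1], where
    the positive part of [g] goes to [F1], the negative part to [F2], and [B] makes [f + B]
    nonnegative. The inner integrals of [F1] and [F2] agree almost everywhere because [f] is the
    difference of the conditional integrals of the two parts. *)
Lemma cond_exp_orthogonal (g : T2 -> R) (f phi : T1 -> R) (B : R) :
  measurable_fun setT g -> (marginal2 mu).-integrable setT (EFin \o g) ->
  measurable_fun setT f -> (forall x, `|f x| <= B) ->
  {ae marginal1 mu, forall x, (\int[k x]_y (g y)%:E)%E = (f x)%:E} ->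
  measurable_fun setT phi -> (forall x, 0 <= phi x <= 1) ->
  Rintegral mu setT (fun z => (f z.1 - g z.2) * phi z.1) = 0.
Proof.
move=> mg ig mf fB fE mphi phi01.
pose gp y := Num.max (g y) 0; pose gm y := Num.max (- g y) 0.
have mgp : measurable_fun setT gp by apply: measurable_maxr => //; exact: measurable_cst.
have mgm : measurable_fun setT gm.
  by apply: measurable_maxr; [exact: measurableT_comp|exact: measurable_cst].
have gp0 y : 0 <= gp y by rewrite /gp le_max lexx orbT.
have gm0 y : 0 <= gm y by rewrite /gm le_max lexx orbT.
pose F1 (z : T1 * T2) := phi z.1 * (B + gp z.2).
pose F2 (z : T1 * T2) := phi z.1 * (f z.1 + B + gm z.2).
have phi0 x : 0 <= phi x by case/andP: (phi01 x).
have B0 : 0 <= B by exact: le_trans (fB point).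
have fB0 x : 0 <= f x + B by have := fB x; rewrite ler_norml => /andP[]; lra.
have F10 z : (0 <= (F1 z)%:E)%E by rewrite lee_fin mulr_ge0// addr_ge0.
have F20 z : (0 <= (F2 z)%:E)%E by rewrite lee_fin mulr_ge0// addr_ge0.
have mF1 : measurable_fun setT F1.
  apply: measurable_funM; first exact: measurableT_comp.
  by apply: measurable_funD => //; exact: measurableT_comp.
have mF2 : measurable_fun setT F2.
  apply: measurable_funM; first exact: measurableT_comp.
  apply: measurable_funD; last exact: measurableT_comp.
  by apply: measurable_funD => //; exact: measurableT_comp.
have intk (h : T2 -> R) c x : measurable_fun setT h -> (forall y, 0 <= h y) -> 0 <= c ->
    (\int[k x]_y (phi x * (c + h y))%:E = (phi x)%:E * (c%:E + \int[k x]_y (h y)%:E))%E.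
  move=> mh h0 c0; under eq_integral do rewrite EFinM EFinD.
  have mch : measurable_fun setT (fun y => (c%:E + (h y)%:E)%E).
    by apply/measurable_EFinP; apply: measurable_funD.
  have ch0 y : setT y -> (0 <= c%:E + (h y)%:E)%E by move=> _; rewrite lee_fin addr_ge0.
  rewrite ge0_integralZl_EFin//.
  have h0' y : setT y -> (0 <= (h y)%:E)%E by rewrite lee_fin.
  rewrite ge0_integralD//; last exact/measurable_EFinP.
  by rewrite integral_cst// prob_kernel mule1.
have mk (F : T1 * T2 -> R) : measurable_fun setT F -> (forall z, 0 <= (F z)%:E)%E ->
    measurable_fun setT (fun x => \int[k x]_y (F (x, y))%:E)%E.
  by move=> /measurable_EFinP mF F0; exact: (measurable_kfcomp k mF F0).
have E12 : (\int[mu]_z (F1 z)%:E = \int[mu]_z (F2 z)%:E)%E.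
  have mE1 : measurable_fun setT (EFin \o F1) by exact/measurable_EFinP.
  have mE2 : measurable_fun setT (EFin \o F2) by exact/measurable_EFinP.
  rewrite (ge0_integral_disintegration F10 mE1) (ge0_integral_disintegration F20 mE2).
  apply: ge0_ae_eq_integral => //.
  - exact: mk mF1 F10.
  - exact: mk mF2 F20.
  - by move=> x _; apply: integral_ge0.
  - by move=> x _; apply: integral_ge0.
  apply: filterS fE => x gx _; rewrite /F1 /F2/= intk// intk//.
  congr (_ * _)%E.
  move: gx; rewrite integralE.
  rewrite (_ : (\int[k x]_y (fun y => (g y)%:E)^\+ y = \int[k x]_y (gp y)%:E)%E); last first.
    by apply: eq_integral => y _; rewrite funeposE EFin_max.
  rewrite (_ : (\int[k x]_y (fun y => (g y)%:E)^\- y = \int[k x]_y (gm y)%:E)%E); last first.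
    by apply: eq_integral => y _; rewrite funenegE -EFinN EFin_max.
  have := integral_ge0 (k x) (fun y (_ : setT y) => gp0 y : (0 <= (gp y)%:E)%E).
  have := integral_ge0 (k x) (fun y (_ : setT y) => gm0 y : (0 <= (gm y)%:E)%E).
  (* Nonnegativity excludes [-oo]. If either part were [+oo], the difference would be infinite too,
     against its real value [f x]; so both are finite. *)
  move: (\int[k x]_y (gp y)%:E)%E (\int[k x]_y (gm y)%:E)%E => [p| |] [q| |] //= _ _ [].
  by rewrite -!EFinD => <-; congr EFin; ring.
have ig' := integrable_snd mg ig.
have iB : mu.-integrable setT (EFin \o (fun=> B)).
  by apply: (@bounded_integrable _ _ _ _ _ `|B|) => // x; rewrite lexx.
have iF1 : mu.-integrable setT (EFin \o F1).
  have := integrableD measurableT iB (integrable_abse ig'); apply: le_integrable => //.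
    exact/measurable_EFinP.
  move=> z _; rewrite /= lee_fin ger0_norm ?mulr_ge0 ?addr_ge0//.
  rewrite [leRHS]ger0_norm ?addr_ge0//.
  have gn : gp z.2 <= `|g z.2| by rewrite /gp ge_max ler_norm normr_ge0.
  have /andP[_ p1] := phi01 z.1; apply: (@le_trans _ _ (1 * (B + gp z.2))).
    by rewrite ler_wpM2r// addr_ge0.
  by rewrite mul1r lerD2l.
have iF2 : mu.-integrable setT (EFin \o F2).
  apply/integrableP; split; first exact/measurable_EFinP.
  have absE (F : T1 * T2 -> R) : (forall z, 0 <= (F z)%:E)%E ->
      (\int[mu]_z `|(EFin \o F) z| = \int[mu]_z (F z)%:E)%E.
    by move=> F0; apply: eq_integral => z _; rewrite gee0_abs//; exact: F0.
  by move: iF1 => /integrableP[_]; rewrite !absE// E12.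
have -> : (fun z : T1 * T2 => (f z.1 - g z.2) * phi z.1) = (fun z => F2 z - F1 z).
  apply/funext => z; rewrite /F2 /F1.
  have -> : g z.2 = gp z.2 - gm z.2.
    by rewrite /gp /gm; case: (lerP (g z.2) 0) => h; case: (lerP (- g z.2) 0) => h'; lra.
  ring.
by rewrite RintegralB// /Rintegral E12 subrr.
Qed.

End disintegration.

(** * Lebesgue measure on a box *)

Section row_measurability.
Context {R : realType} {d : nat}.

Definition row_of_tuple (t : d.-tuple (measurableTypeR R)) : borel (0 : 'rV[R]_d) :=
  \row_i tnth t i.

Lemma mx_ballP (u v : 'rV[R]_d) (e : R) : 0 < e ->
  ball u e v <-> forall i, `|u ord0 i - v ord0 i| < e.
Proof.
move=> e0; split=> [[_ h] i|h]; first exact: h.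
by split=> // j i; rewrite (ord1 j); exact: h.
Qed.

(** The Borel sets are generated by open sets and not by boxes. An open set is a countable union of
    balls with rational centres and radii [1 / (k + 1)], and a ball of the sup norm is a finite
    intersection of conditions on coordinates. *)
Lemma measurable_row_of_tuple : measurable_fun setT row_of_tuple.
Proof.
apply: (@measurability _ _ _ _ setT row_of_tuple (@open 'rV[R]_d) erefl).
move=> _ [U oU <-]; rewrite setTI.
pose B (p : 'rV[rat]_d * nat) := ball (map_mx ratr p.1 : 'rV[R]_d) (p.2.+1%:R^-1 : R).
pose F p := if `[< B p `<=` U >] then row_of_tuple @^-1` B p else set0.
have -> : row_of_tuple @^-1` U = \bigcup_p F p.
  apply/seteqP; split=> [t Ut|t [p _]]; last first.
    by rewrite /F; case: asboolP => // BU /BU.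
  have /nbhs_ballP[e /= e0 eU] := open_nbhs_nbhs (conj oU Ut).
  have [k _ hk] := near_infty_natSinv_lt (PosNum (divr_gt0 e0 (@ltr0Sn R 1))).
  have {}hk : k.+1%:R^-1 < e / 2 := hk k (leqnn k).
  have k0 : 0 < k.+1%:R^-1 :> R by rewrite invr_gt0.
  have /choice[q hq] : forall i : 'I_d, exists q : rat,
      `|ratr q - row_of_tuple t ord0 i| < k.+1%:R^-1.
    move=> i; have := @rat_in_itvoo R (row_of_tuple t ord0 i - k.+1%:R^-1)
      (row_of_tuple t ord0 i + k.+1%:R^-1).
    have h : row_of_tuple t ord0 i - k.+1%:R^-1 < row_of_tuple t ord0 i + k.+1%:R^-1.
      by rewrite ltrD2l gtrN.
    move=> /(_ h)[r]; rewrite in_itv/= => /andP[r1 r2]; exists r.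
    by rewrite ltr_distl r1 r2.
  have tB : B (\row_i q i, k) (row_of_tuple t).
    by apply/mx_ballP => // i; rewrite !mxE; have := hq i; rewrite !mxE.
  exists (\row_i q i, k) => //; rewrite /F; case: asboolP => // nBU; exfalso; apply: nBU.
  move=> v vB; apply: eU; have -> : e = e / 2 + e / 2 by rewrite -splitr.
  have h1 : ball (map_mx ratr (\row_i q i) : 'rV[R]_d) (e / 2) (row_of_tuple t).
    by apply: le_ball tB; exact: ltW.
  have h2 : ball (map_mx ratr (\row_i q i) : 'rV[R]_d) (e / 2) v.
    by apply: le_ball vB; exact: ltW.
  exact: ball_triangle (ball_sym h1) h2.
apply: countable_bigcupT_measurable => [|p]; first exact: countableP.
rewrite /F; case: asboolP => // _.
have p0 : 0 < p.2.+1%:R^-1 :> R by rewrite invr_gt0.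
have -> : row_of_tuple @^-1` B p = \bigcap_(i in [set: 'I_d])
    [set t : d.-tuple (measurableTypeR R) | `|ratr (p.1 ord0 i) - tnth t i| < p.2.+1%:R^-1].
  apply/seteqP; split=> t /=.
    by move=> /(mx_ballP _ _ p0) h i _ /=; have := h i; rewrite !mxE.
  by move=> h; apply/(mx_ballP _ _ p0) => i; have := h i Logic.I; rewrite /= !mxE.
apply: fin_bigcap_measurable => // i _.
have mt : measurable_fun setT
    (fun t : d.-tuple (measurableTypeR R) => `|ratr (p.1 ord0 i) - tnth t i|).
  apply: measurableT_comp => //; apply: measurable_funB => //.
  exact: (@measurable_tnth _ (measurableTypeR R) d i).
have := mt measurableT `]-oo, p.2.+1%:R^-1[%classic (measurable_itv _).
by rewrite setTI; congr measurable; apply/seteqP; split=> t; rewrite /preimage/= in_itv.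
Qed.

Lemma measurable_coord (i : 'I_d) :
  measurable_fun setT (fun a : borel (0 : 'rV[R]_d) => (a : 'rV[R]_d) ord0 i).
Proof.
apply: (@continuous_borel_measurable R 'rV[R]_d 0 (fun a => a ord0 i)).
exact: coord_continuous.
Qed.

End row_measurability.

Section box_integral.
Context {R : realType} {d : nat} (lo hi : 'rV[R]_d).
Hypothesis lohi : forall i, lo ord0 i < hi ord0 i.
Local Notation Q := (rectangle lo hi).
Local Notation leb := (@lebesgue_measure R).
Local Notation pm := (power_sigma_finite leb d).

Lemma measurable_rectangle : measurable (Q : set (borel (0 : 'rV[R]_d))).
Proof.
have -> : Q = \bigcap_(i in [set: 'I_d])
    ((fun a : borel (0 : 'rV[R]_d) => (a : 'rV[R]_d) ord0 i) @^-1` `[lo ord0 i, hi ord0 i]%classic).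
  apply/seteqP; split=> a h i; first by move=> _; rewrite /preimage/= in_itv/=; exact: h.
  by have := h i Logic.I; rewrite /preimage/= in_itv/=.
apply: fin_bigcap_measurable => // i _.
by rewrite -[X in measurable X]setTI; apply: measurable_coord.
Qed.

Lemma lebesgue_rVE : @lebesgue_rV R d = pushforward pm row_of_tuple.
Proof. by apply/funext => B; rewrite /lebesgue_rV -power_sigma_finiteE. Qed.

Let lebesgue_rV0 : @lebesgue_rV R d set0 = 0%E.
Proof. by rewrite lebesgue_rVE /pushforward preimage_set0 measure0. Qed.

Let lebesgue_rV_ge0 B : (0 <= @lebesgue_rV R d B)%E.
Proof. by rewrite lebesgue_rVE /pushforward measure_ge0. Qed.

Let lebesgue_rV_sigma_additive : semi_sigma_additive (@lebesgue_rV R d).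
Proof.
rewrite lebesgue_rVE => F mF tF mUF; rewrite /pushforward preimage_bigcup.
have mp B : measurable B -> measurable (row_of_tuple @^-1` B).
  by move=> mB; rewrite -[X in measurable X]setTI; exact: measurable_row_of_tuple.
apply: measure_semi_sigma_additive.
- by move=> k; exact: mp.
- apply/trivIsetP => i j _ _ ij; rewrite -preimage_setI.
  by move/trivIsetP : tF => /(_ i j Logic.I Logic.I ij) ->; rewrite preimage_set0.
- by rewrite -preimage_bigcup; exact: mp.
Qed.

HB.instance Definition _ := isMeasure.Build _ _ _ (@lebesgue_rV R d)
  lebesgue_rV0 lebesgue_rV_ge0 lebesgue_rV_sigma_additive.

Let J i : set R := `[lo ord0 i, hi ord0 i]%classic.

(** Extending each factor by 0 outside its side of the box turns the integral over [Q] into the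
    integral of a product over all tuples, where the product formula for powers applies. *)
Lemma lebesgue_box_integral (F : 'I_d -> R -> R) (B : R) :
  (forall i, measurable_fun setT (F i)) -> (forall i x, `|F i x| <= B) ->
  (\int[@lebesgue_rV R d]_(a in Q) (\prod_i F i ((a : 'rV[R]_d) ord0 i))%:E)%E =
  (\prod_i Rintegral leb (J i) (F i))%:E.
Proof.
move=> mF FB.
have intF i : leb.-integrable setT (EFin \o (F i \_ (J i))).
  have iJ : leb.-integrable (J i) (EFin \o F i).
    apply: measurable_bounded_integrable => //.
    - exact: measurable_itv.
    - have : (lebesgue_measure (J i) < +oo)%E.
        by rewrite /J lebesgue_measure_itv/= lte_fin lohi ltry.
      exact.
    - exact: (measurable_funTS (mF i)).
    - by exists B; split=> [|M BM x _ /=]; [exact: num_real|exact: le_trans (FB i x) (ltW BM)].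
  have mJ : measurable (J i) by exact: measurable_itv.
  by rewrite -restrict_EFin -integrable_mkcond.
have [I1 I2] := Rintegral_power_prod intF.
have E (t : d.-tuple (measurableTypeR R)) : \prod_i (F i \_ (J i)) (tnth t i) =
   ((fun a : 'rV[R]_d => \prod_i F i (a ord0 i)) \_ Q) (row_of_tuple t).
  rewrite patchE; case: ifPn => [/set_mem tQ|tQ].
    apply: eq_bigr => i _; rewrite patchE mxE ifT//; apply/mem_set; rewrite /J/= in_itv/=.
    by have := tQ i; rewrite mxE.
  have [i ti] : exists i, ~ (J i (tnth t i)).
    apply: contrapT => h; move/negP: tQ; apply; apply/mem_set => i; rewrite mxE.
    by apply: contrapT => hi'; apply: h; exists i; rewrite /J/= in_itv/=.
  apply/eqP; rewrite prodf_seq_eq0; apply/hasP; exists i; first by rewrite mem_index_enum.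
  by rewrite /= patchE ifF//; apply/negP => /set_mem.
pose f (a : borel (0 : 'rV[R]_d)) := (((fun a : 'rV[R]_d => \prod_i F i (a ord0 i)) \_ Q) a)%:E.
have mf : measurable_fun setT f.
  apply/measurable_EFinP; apply/(measurable_restrict _ measurable_rectangle) => //.
  rewrite setTI; apply: measurable_funTS; apply: measurable_prod => i _.
  by apply: measurableT_comp => //; exact: measurable_coord.
have intf : pm.-integrable (row_of_tuple @^-1` setT) (f \o row_of_tuple).
  rewrite preimage_setT; have := I1; apply: eq_integrable => // t _.
  by rewrite /= E.
rewrite integral_mkcond.
transitivity (\int[pushforward pm row_of_tuple]_a f a)%E.
  rewrite -lebesgue_rVE; by apply: eq_integral => a _; rewrite /f/= !patchE; case: ifP.
rewrite (integral_pushforward measurable_row_of_tuple mf intf measurableT) preimage_setT.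
transitivity (\int[pm]_t (\prod_i (F i \_ (J i)) (tnth t i))%:E)%E.
  by apply: eq_integral => t _; rewrite /= E.
rewrite -[LHS]fineK ?(integrable_fin_num _ I1)//; congr EFin.
by rewrite [LHS]I2; apply: eq_bigr => i _; rewrite [RHS]Rintegral_mkcond.
Qed.

End box_integral.

(** * Gram matrices of bounded families of functions *)

Section finite_families.
Context {R : realType} {d : measure_display} {T : measurableType d}.
Variables (m : {measure set T -> \bar R}) (D : set T).
Hypotheses (mD : measurable D) (mfin : (m D < +oo)%E).

Lemma bounded_integrable_on (f : T -> R) B : measurable_fun D f ->
  (forall x, `|f x| <= B) -> m.-integrable D (EFin \o f).
Proof.
move=> mf fB; apply: measurable_bounded_integrable => //.
by exists B; split=> [|M BM x _ /=]; [exact: num_real|exact: le_trans (fB x) (ltW BM)].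
Qed.

Lemma Rintegral_sum_seq (I : Type) (s : seq I) (c : I -> R) (h : I -> T -> R) :
  (forall i, m.-integrable D (EFin \o h i)) ->
  m.-integrable D (EFin \o (fun a => \sum_(i <- s) c i * h i a)) /\
  Rintegral m D (fun a => \sum_(i <- s) c i * h i a) =
  \sum_(i <- s) c i * Rintegral m D (h i).
Proof.
move=> ih; elim: s => [|i s [IH1 IH2]].
  under eq_fun do rewrite big_nil; rewrite big_nil.
  split; last by rewrite Rintegral_cst// mul0r.
  by apply: (@bounded_integrable_on _ 0) => // x; rewrite normr0.
have E : (fun a => \sum_(j <- i :: s) c j * h j a) =
    (fun a => c i * h i a + \sum_(j <- s) c j * h j a).
  by apply/funext => x; rewrite big_cons.
have ii : m.-integrable D (EFin \o (fun a => c i * h i a)).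
  by have := integrableZl mD (c i) (ih i); exact: eq_integrable.
rewrite E big_cons; split.
  by have := integrableD mD ii IH1; exact: eq_integrable.
by rewrite RintegralD// RintegralZl// IH2.
Qed.

Context {X : Type}.
Variables (phi : X -> T -> R).
Hypotheses (mphi : forall x, measurable_fun D (phi x))
  (phi1 : forall x a, `|phi x a| <= 1).

Definition gram (x y : X) : R := Rintegral m D (fun a => phi x a * phi y a).

Let int_phi2 (f h : T -> R) : measurable_fun D f -> measurable_fun D h ->
  (forall a, `|f a| <= 1) -> (forall a, `|h a| <= 1) ->
  m.-integrable D (EFin \o (fun a => f a * h a)).
Proof.
move=> mf mh f1 h1; apply: (@bounded_integrable_on _ 1); first exact: measurable_funM.
by move=> x; rewrite normrM mulr_ile1.
Qed.

Lemma gram_quadratic (s : seq (R * X)) :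
  m.-integrable D (EFin \o (fun a => (\sum_(p <- s) p.1 * phi p.2 a) ^+ 2)) /\
  Rintegral m D (fun a => (\sum_(p <- s) p.1 * phi p.2 a) ^+ 2) =
  \sum_(p <- s) \sum_(q <- s) p.1 * q.1 * gram p.2 q.2.
Proof.
have E : (fun a => (\sum_(p <- s) p.1 * phi p.2 a) ^+ 2) =
    (fun a => \sum_(r <- [seq (p, q) | p <- s, q <- s])
      (r.1.1 * r.2.1) * (phi r.1.2 a * phi r.2.2 a)).
  apply/funext => a; rewrite big_allpairs expr2 mulr_suml; apply: eq_bigr => p _ /=.
  by rewrite mulr_sumr; apply: eq_bigr => q _ /=; ring.
have [I1 I2] := Rintegral_sum_seq [seq (p, q) | p <- s, q <- s]
  (fun r : (R * X) * (R * X) => r.1.1 * r.2.1)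
  (h := fun r a => phi r.1.2 a * phi r.2.2 a)
  (fun r => int_phi2 (mphi _) (mphi _) (phi1 _) (phi1 _)).
by rewrite E; split => //; rewrite I2 big_allpairs.
Qed.

Lemma gram_ge0 (s : seq (R * X)) :
  0 <= \sum_(p <- s) \sum_(q <- s) p.1 * q.1 * gram p.2 q.2.
Proof.
by rewrite -(gram_quadratic s).2; apply: Rintegral_ge0 => x _; exact: sqr_ge0.
Qed.

(* Cauchy-Schwarz: expand the square of [\sum_p p.1 * phi p.2 - b * psi] where
   [b] is its inner product with [psi]. *)
Lemma gram_test (psi : T -> R) (s : seq (R * X)) : measurable_fun D psi ->
  (forall a, `|psi a| <= 1) -> m D = 1%E ->
  (\sum_(p <- s) p.1 * Rintegral m D (fun a => phi p.2 a * psi a)) ^+ 2 <=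
  \sum_(p <- s) \sum_(q <- s) p.1 * q.1 * gram p.2 q.2.
Proof.
move=> mpsi psi1 mD1.
have [I1 I2] := gram_quadratic s.
have [J1 J2] := Rintegral_sum_seq s fst (h := fun p a => phi p.2 a * psi a)
  (fun p => int_phi2 (mphi p.2) mpsi (phi1 p.2) psi1).
have K := int_phi2 mpsi mpsi psi1 psi1.
rewrite -I2 -J2; set b := Rintegral m D (fun a => \sum_(i <- s) i.1 * _) in J2 *.
have c1 : Rintegral m D (fun a => psi a * psi a) <= 1.
  rewrite -[leRHS](_ : Rintegral m D (fun=> 1) = 1); last first.
    by rewrite Rintegral_cst// mD1 mulr1.
  apply: le_Rintegral => //.
    by apply: (@bounded_integrable_on _ 1) => // x; rewrite normr1.
  by move=> x _; have := psi1 x; rewrite ler_norml => /andP[h1 h2]; nra.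
have K' : m.-integrable D (EFin \o (fun a => b ^+ 2 * (psi a * psi a))).
  by have := integrableZl mD (b ^+ 2) K; exact: eq_integrable.
have J' : m.-integrable D (EFin \o (fun a => (- 2 * b) * \sum_(p <- s) p.1 * (phi p.2 a * psi a))).
  by have := integrableZl mD (- 2 * b) J1; exact: eq_integrable.
have KJ : m.-integrable D (EFin \o (fun a => b ^+ 2 * (psi a * psi a) +
    (- 2 * b) * \sum_(p <- s) p.1 * (phi p.2 a * psi a))).
  by have := integrableD mD K' J'; exact: eq_integrable.
have : 0 <= Rintegral m D (fun a => (\sum_(p <- s) p.1 * phi p.2 a) ^+ 2 +
    (b ^+ 2 * (psi a * psi a) + (- 2 * b) * \sum_(p <- s) p.1 * (phi p.2 a * psi a))).
  apply: Rintegral_ge0 => a _.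
  have -> : \sum_(p <- s) p.1 * (phi p.2 a * psi a) = (\sum_(p <- s) p.1 * phi p.2 a) * psi a.
    by rewrite mulr_suml; apply: eq_bigr => p _; ring.
  set S := \sum_(p <- s) _.
  rewrite (_ : _ + _ = (S - b * psi a) ^+ 2); first exact: sqr_ge0.
  by ring.
rewrite RintegralD// RintegralD// RintegralZl// RintegralZl// -/b => h.
by have := sqr_ge0 b; nra.
Qed.

End finite_families.

(** * Integrals of rays and hats on an interval *)

Section one_dimensional.
Context {R : realType}.
Local Notation leb := (@lebesgue_measure R).

Definition ray (x a : R) : R := \1_(`[0%R, +oo[%classic : set R) (a - x).

Lemma rayE x a : ray x a = ((x <= a)%R)%:R.
Proof.
rewrite /ray indicE; congr (_%:R); congr nat_of_bool.
by apply/idP/idP => [/set_mem|h]; [|apply/mem_set]; rewrite /= in_itv/= andbT subr_ge0.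
Qed.

Lemma measurable_ray x : measurable_fun setT (ray x).
Proof.
have -> : ray x = \1_(`[x, +oo[%classic : set R).
  apply/funext => a; rewrite rayE indicE; congr (_%:R); congr nat_of_bool.
  by apply/idP/idP => [h|/set_mem]; [apply/mem_set|]; rewrite /= in_itv/= andbT.
by apply: measurable_indic; exact: measurable_itv.
Qed.

Lemma ray_le1 x a : `|ray x a| <= 1.
Proof. by rewrite rayE normr_nat lern1 leq_b1. Qed.

Lemma Rintegral_indic_itv (lo hi u v : R) (b : bool) : lo <= u -> v <= hi ->
  leb.-integrable `[lo, hi]%classic
    (EFin \o (\1_([set` Interval (BSide b u) (BRight v)] : set R) : R -> R)) /\
  Rintegral leb `[lo, hi]%classic (\1_([set` Interval (BSide b u) (BRight v)] : set R)) =
    Num.max 0 (v - u).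
Proof.
move=> lu vh; have mI := measurable_itv (Interval (BSide b u) (BRight v)).
split.
  have finJ : (lebesgue_measure (`[lo, hi]%classic : set R) < +oo)%E.
    by rewrite lebesgue_measure_itv/=; case: ifP => _; rewrite ?ltry// -EFinB ltry.
  have mJ : measurable (`[lo, hi]%classic : set (measurableTypeR R)).
    exact: measurable_itv.
  refine (@bounded_integrable_on R _ (measurableTypeR R) leb _ mJ finJ _ 1 _ _).
    exact: measurable_indic.
  by move=> x; rewrite indicE normr_nat lern1 leq_b1.
rewrite /Rintegral integral_indic//.
rewrite setIidl; last first.
  move=> x /=; rewrite !itv_boundlr => /andP[h1 h2].
  apply/andP; split.
    by apply: le_trans h1; case: (b); rewrite /= bnd_simp//.
  by apply: le_trans h2 _; rewrite bnd_simp.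
have E : lebesgue_measure ([set` Interval (BSide b u) (BRight v)] : set R) =
    (if (u < v)%R then (v - u)%:E else 0)%E.
  by rewrite lebesgue_measure_itv/= lte_fin.
rewrite [X in fine X]E.
by case: ltP => uv /=; [rewrite max_r// subr_ge0 ltW|rewrite max_l// subr_le0].
Qed.

(** Minus the derivative of the tent of height and half-width [rho] centred at [z], so that its
    integral to the right of [x] is the value of the tent at [x]. *)
Definition hat (z rho a : R) : R :=
  \1_(`]z, (z + rho)]%classic : set R) a - \1_(`](z - rho), z]%classic : set R) a.

Lemma measurable_hat z rho : measurable_fun setT (hat z rho).
Proof. by apply: measurable_funB; apply: measurable_indic; exact: measurable_itv. Qed.

Lemma hat_le1 z rho a : `|hat z rho a| <= 1.
Proof.
rewrite /hat !indicE.
by case: (_ \in _); case: (_ \in _); rewrite ?subrr ?subr0 ?sub0r ?normrN ?normr1 ?normr0.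
Qed.

Lemma Rintegral_ray_ray (lo hi x y : R) : lo <= x <= hi -> lo <= y <= hi ->
  Rintegral leb `[lo, hi]%classic (fun a => ray x a * ray y a) = hi - Num.max x y.
Proof.
move=> /andP[lx xh] /andP[ly yh].
have [|_ E] := @Rintegral_indic_itv lo hi (Num.max x y) hi true _ (lexx hi).
  by rewrite le_max lx.
transitivity (Num.max 0 (hi - Num.max x y)); last first.
  by rewrite max_r// subr_ge0 ge_max xh.
rewrite -E; apply: eq_Rintegral => a /set_mem; rewrite /= in_itv/= => /andP[la ah].
transitivity ((a \in (`[Num.max x y, hi]%classic : set R))%:R : R); last by [].
rewrite !rayE -natrM mulnb; congr (_%:R); congr nat_of_bool.
by apply/idP/idP => [h|/set_mem]; [apply/mem_set|]; rewrite /= in_itv/= ge_max ah andbT.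
Qed.

Lemma Rintegral_ray_half (lo hi x u v : R) : lo <= u -> u <= v -> v <= hi ->
  leb.-integrable `[lo, hi]%classic (EFin \o (fun a => ray x a * \1_(`]u, v]%classic : set R) a)) /\
  Rintegral leb `[lo, hi]%classic (fun a => ray x a * \1_(`]u, v]%classic : set R) a) =
    Num.max 0 (v - Num.max u x).
Proof.
move=> lu uv vh; have [xu|ux] := leP x u.
  have [I E] := @Rintegral_indic_itv lo hi u v false lu vh.
  have -> : (fun a => ray x a * \1_(`]u, v]%classic : set R) a) = \1_(`]u, v]%classic : set R).
    apply/funext => a; rewrite rayE indicE -natrM mulnb; congr (_%:R); congr nat_of_bool.
    apply/idP/idP => [/andP[]//|h]; rewrite h andbT.
    by move: h => /set_mem; rewrite /= in_itv/= => /andP[ua _]; exact: le_trans xu (ltW ua).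
  by split=> //; rewrite E.
have [I E] := @Rintegral_indic_itv lo hi x v true (le_trans lu (ltW ux)) vh.
have -> : (fun a => ray x a * \1_(`]u, v]%classic : set R) a) = \1_(`[x, v]%classic : set R).
  apply/funext => a; rewrite rayE !indicE -natrM mulnb; congr (_%:R); congr nat_of_bool.
  apply/idP/idP => [/andP[xa /set_mem]|/set_mem].
    by rewrite /= in_itv/= => /andP[_ av]; apply/mem_set; rewrite /= in_itv/= xa.
  rewrite /= in_itv/= => /andP[xa av]; rewrite xa/=; apply/mem_set.
  by rewrite /= in_itv/= av (lt_le_trans ux xa).
by split=> //; rewrite E.
Qed.

Lemma Rintegral_ray_hat (lo hi x z rho : R) : 0 < rho ->
  lo <= z - rho -> z + rho <= hi ->
  Rintegral leb `[lo, hi]%classic (fun a => ray x a * hat z rho a) =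
    Num.max 0 (rho - `|x - z|).
Proof.
move=> r0 lz zh.
have [|||I1 E1] := @Rintegral_ray_half lo hi x z (z + rho) => //; try lra.
have [|||I2 E2] := @Rintegral_ray_half lo hi x (z - rho) z => //; try lra.
under eq_Rintegral do rewrite /hat mulrBr.
rewrite RintegralB// E1 E2.
have [zx|xz] := leP z x.
  rewrite (max_r (x := z - rho) (y := x)); last by lra.
  rewrite (max_l (x := 0) (y := z - x)); last by lra.
  by rewrite subr0 ger0_norm ?subr_ge0//; congr Num.max; ring.
rewrite (max_r (x := 0) (y := z + rho - z)); last by lra.
rewrite ltr0_norm ?subr_lt0//.
have [h|h] := leP (z - rho) x.
  by rewrite (max_r (x := 0) (y := z - x)) ?(max_r (x := 0)); lra.
by rewrite (max_r (x := 0)) ?(max_l (x := 0)); lra.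
Qed.

End one_dimensional.

(** * Orthant indicators under the normalized measure of the box *)

Section box_measure.
Context {R : realType} {d : nat} (lo hi : 'rV[R]_d).
Hypothesis lohi : forall i, lo ord0 i < hi ord0 i.
Local Notation Q := (rectangle lo hi).
Local Notation leb := (@lebesgue_measure R).
Local Notation mQ := (measurable_rectangle lo hi).
Local Notation len i := (hi ord0 i - lo ord0 i).

Let vol := \prod_i len i.

Let len_gt0 i : 0 < len i. Proof. by rewrite subr_gt0. Qed.

Let vol_gt0 : 0 < vol. Proof. by apply: prodr_gt0 => i _. Qed.

Let Rintegral_itv_cst i : Rintegral leb `[lo ord0 i, hi ord0 i]%classic (fun=> 1) = len i.
Proof.
have E : lebesgue_measure (`[lo ord0 i, hi ord0 i]%classic : set R) = (len i)%:E.
  by rewrite lebesgue_measure_itv/= lte_fin lohi.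
rewrite Rintegral_cst; last exact: measurable_itv.
by rewrite [X in fine X]E mul1r.
Qed.

Lemma lebesgue_rV_rectangle : @lebesgue_rV R d Q = vol%:E.
Proof.
have := @lebesgue_box_integral R d lo hi lohi (fun _ _ => 1) 1 (fun=> measurable_cst _).
rewrite (_ : (fun a : 'rV[R]_d => (\prod_(i < d) 1)%:E) = cst 1%E); last first.
  by apply/funext => a; rewrite big1.
rewrite integral_cst ?mul1e; last exact: mQ.
move=> ->; first by congr EFin; apply: eq_bigr => i _; exact: Rintegral_itv_cst.
by move=> *; rewrite normr1.
Qed.

Let vol_inv_ge0 : 0 <= vol^-1. Proof. by rewrite invr_ge0 ltW. Qed.

Definition box_measure : {measure set (borel (0 : 'rV[R]_d)) -> \bar R} :=
  mscale (NngNum vol_inv_ge0) (mrestr (@lebesgue_rV R d) mQ).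

Lemma box_measureE : (box_measure : set _ -> \bar R) = normalized_lebesgue Q.
Proof. by apply/funext => B; rewrite /normalized_lebesgue lebesgue_rV_rectangle. Qed.

Lemma box_measure_rectangle : box_measure Q = 1%E.
Proof.
rewrite box_measureE /normalized_lebesgue setIid lebesgue_rV_rectangle/= -EFinM mulVf//.
by rewrite gt_eqF.
Qed.

Lemma box_measure_lty : (box_measure Q < +oo)%E.
Proof. by rewrite [X in (X < _)%E]box_measure_rectangle ltry. Qed.

Lemma integral_box_measure (f : borel (0 : 'rV[R]_d) -> \bar R) :
  (@lebesgue_rV R d).-integrable Q f ->
  (\int[box_measure]_(a in Q) f a = vol^-1%:E * \int[@lebesgue_rV R d]_(a in Q) f a)%E.
Proof.
move=> intf; have /integrableP[mf _] := intf.
have E (h : borel (0 : 'rV[R]_d) -> \bar R) :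
    measurable_fun (Q : set (borel (0 : 'rV[R]_d))) h -> (forall x, Q x -> 0 <= h x)%E ->
    (\int[box_measure]_(a in Q) h a = vol^-1%:E * \int[@lebesgue_rV R d]_(a in Q) h a)%E.
  move=> mh h0; rewrite ge0_integral_mscale//; last exact: mQ.
  congr (_ * _)%E; apply: eq_measure_integral => B mB BQ.
  by rewrite /= /mrestr setIidl.
rewrite integralE E//; last exact: measurable_funepos.
rewrite E//; last exact: measurable_funeneg.
rewrite [in RHS]integralE; symmetry; apply: muleBr => //.
apply: fin_num_adde_defl; rewrite fin_numN.
exact: (integrable_fin_num mQ (integrable_funeneg mQ intf)).
Qed.

Lemma box_product_integral (F : 'I_d -> R -> R) (B : R) :
  (forall i, measurable_fun setT (F i)) -> (forall i x, `|F i x| <= B) ->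
  Rintegral box_measure Q (fun a => \prod_i F i ((a : 'rV[R]_d) ord0 i)) =
  \prod_i ((len i)^-1 * Rintegral leb `[lo ord0 i, hi ord0 i]%classic (F i)).
Proof.
move=> mF FB.
rewrite /Rintegral integral_box_measure.
  rewrite (lebesgue_box_integral lohi mF FB)/= big_split/=; congr (_ * _).
  by rewrite prodfV.
apply: (@bounded_integrable_on _ _ _ _ _ mQ _ _ (\prod_(i < d) B)).
- by rewrite [X in (X < _)%E]lebesgue_rV_rectangle ltry.
- apply: measurable_funTS; apply: measurable_prod => i _.
  by apply: measurableT_comp => //; exact: measurable_coord.
- by move=> a; rewrite normr_prod; apply: ler_prod => i _; rewrite normr_ge0 FB.
Qed.

Definition orthant (x : 'rV[R]_d) (a : borel (0 : 'rV[R]_d)) : R :=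
  orthant_ind (a : 'rV[R]_d) x.

Lemma orthantE x a : orthant x a = \prod_i ray (x ord0 i) ((a : 'rV[R]_d) ord0 i).
Proof. by []. Qed.

Lemma measurable_orthant x : measurable_fun setT (orthant x).
Proof.
apply: measurable_prod => i _; apply: (measurableT_comp (measurable_ray (x ord0 i))).
exact: measurable_coord.
Qed.

Lemma norm_prod_le1 (F : 'I_d -> R) : (forall i, `|F i| <= 1) -> `|\prod_i F i| <= 1.
Proof.
move=> F1; rewrite normr_prod; apply: (@le_trans _ _ (\prod_(i < d) 1)); last by rewrite big1.
by apply: ler_prod => i _; rewrite normr_ge0 F1.
Qed.

Lemma orthant_le1 x a : `|orthant x a| <= 1.
Proof. by rewrite orthantE; apply: norm_prod_le1 => i; exact: ray_le1. Qed.

(** For [x] and [y] in [Q], the inner product of their orthant indicators: within [Q] the two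
    orthants meet in the box whose lower corner is the coordinatewise maximum. From this closed
    form, measurability in [(x, y)] and the bounds 0 and 1 are direct. *)
Definition box_gram (x y : 'rV[R]_d) : R :=
  \prod_i ((hi ord0 i - Num.max (x ord0 i) (y ord0 i)) / len i).

Lemma box_gramE x y : Q x -> Q y -> gram box_measure Q orthant x y = box_gram x y.
Proof.
move=> Qx Qy; rewrite /gram /box_gram.
transitivity (Rintegral box_measure Q (fun a => \prod_i
    (ray (x ord0 i) ((a : 'rV[R]_d) ord0 i) * ray (y ord0 i) ((a : 'rV[R]_d) ord0 i)))).
  by apply: eq_Rintegral => a _; rewrite !orthantE big_split.
rewrite (@box_product_integral (fun i a => ray (x ord0 i) a * ray (y ord0 i) a) 1).
- apply: eq_bigr => i _; have := Rintegral_ray_ray (Qx i) (Qy i).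
  by move=> ->; exact: mulrC.
- by move=> i; apply: measurable_funM; exact: measurable_ray.
- by move=> i a; rewrite normrM mulr_ile1// ray_le1.
Qed.

Definition tent (z : 'rV[R]_d) (rho : R) (x : 'rV[R]_d) : R :=
  \prod_i ((len i)^-1 * Num.max 0 (rho - `|x ord0 i - z ord0 i|)).

Definition hat_prod (z : 'rV[R]_d) (rho : R) (a : borel (0 : 'rV[R]_d)) : R :=
  \prod_i hat (z ord0 i) rho ((a : 'rV[R]_d) ord0 i).

Lemma tentE (z : 'rV[R]_d) (rho : R) (x : 'rV[R]_d) : 0 < rho ->
  (forall i, lo ord0 i <= z ord0 i - rho) -> (forall i, z ord0 i + rho <= hi ord0 i) ->
  Rintegral box_measure Q (fun a => orthant x a * hat_prod z rho a) = tent z rho x.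
Proof.
move=> r0 lz zh.
transitivity (Rintegral box_measure Q (fun a => \prod_i
    (ray (x ord0 i) ((a : 'rV[R]_d) ord0 i) * hat (z ord0 i) rho ((a : 'rV[R]_d) ord0 i)))).
  by apply: eq_Rintegral => a _; rewrite !orthantE big_split.
rewrite (@box_product_integral (fun i a => ray (x ord0 i) a * hat (z ord0 i) rho a) 1).
- by apply: eq_bigr => i _; rewrite Rintegral_ray_hat.
- by move=> i; apply: measurable_funM; [exact: measurable_ray|exact: measurable_hat].
- by move=> i a; rewrite normrM mulr_ile1// ?ray_le1 ?hat_le1.
Qed.

Lemma box_gram_quadratic (s : seq (R * 'rV[R]_d)) : (forall p, p \in s -> Q p.2) ->
  \sum_(p <- s) \sum_(q <- s) p.1 * q.1 * gram box_measure Q orthant p.2 q.2 =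
  \sum_(p <- s) \sum_(q <- s) p.1 * q.1 * box_gram p.2 q.2.
Proof.
move=> sQ; rewrite big_seq [RHS]big_seq; apply: eq_bigr => p ps.
rewrite big_seq [RHS]big_seq; apply: eq_bigr => q qs.
by rewrite box_gramE//; exact: sQ.
Qed.

Let mortho x : measurable_fun (Q : set (borel (0 : 'rV[R]_d))) (orthant x).
Proof. by apply: measurable_funTS; exact: measurable_orthant. Qed.

Lemma box_gram_ge0 (s : seq (R * 'rV[R]_d)) : (forall p, p \in s -> Q p.2) ->
  0 <= \sum_(p <- s) \sum_(q <- s) p.1 * q.1 * box_gram p.2 q.2.
Proof.
move=> sQ; rewrite -box_gram_quadratic//.
exact: (gram_ge0 mQ box_measure_lty mortho orthant_le1).
Qed.

Lemma tent_bound (z : 'rV[R]_d) (rho : R) (s : seq (R * 'rV[R]_d)) : (forall p, p \in s -> Q p.2) ->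
  0 < rho ->
  (forall i, lo ord0 i <= z ord0 i - rho) -> (forall i, z ord0 i + rho <= hi ord0 i) ->
  (\sum_(p <- s) p.1 * tent z rho p.2) ^+ 2 <=
  \sum_(p <- s) \sum_(q <- s) p.1 * q.1 * box_gram p.2 q.2.
Proof.
move=> sQ r0 lz zh; rewrite -box_gram_quadratic//.
have mhat : measurable_fun (Q : set (borel (0 : 'rV[R]_d))) (hat_prod z rho).
  apply: measurable_funTS; apply: measurable_prod => i _.
  by apply: (measurableT_comp (measurable_hat (z ord0 i) rho)); exact: measurable_coord.
have hat1 a : `|hat_prod z rho a| <= 1.
  by apply: norm_prod_le1 => i; exact: hat_le1.
have := gram_test mQ box_measure_lty mortho orthant_le1 s mhat hat1 box_measure_rectangle.
by under eq_bigr do rewrite tentE//.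
Qed.

Lemma box_gram01 x y : Q x -> Q y -> 0 <= box_gram x y <= 1.
Proof.
move=> Qx Qy; have h i : 0 <= (hi ord0 i - Num.max (x ord0 i) (y ord0 i)) / len i <= 1.
  have /andP[x1 x2] := Qx i; have /andP[y1 y2] := Qy i.
  apply/andP; split.
    by apply: divr_ge0; [rewrite subr_ge0 ge_max x2 y2|exact: ltW].
  by rewrite ler_pdivrMr// mul1r lerD2l lerN2 le_max x1.
apply/andP; split; first by apply: prodr_ge0 => i _; have /andP[] := h i.
apply: (@le_trans _ _ (\prod_(i < d) 1)); last by rewrite big1.
by apply: ler_prod => i _; exact: h.
Qed.

Lemma box_gramC x y : box_gram x y = box_gram y x.
Proof. by apply: eq_bigr => i _; rewrite maxC. Qed.

Lemma tent_ge0 z rho x : 0 <= tent z rho x.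
Proof. by apply: prodr_ge0 => i _; rewrite mulr_ge0 ?invr_ge0 ?le_max ?lexx// ltW. Qed.

Lemma tent_out z rho x : 0 < rho -> ~ ball z rho x -> tent z rho x = 0.
Proof.
move=> r0 nb; have [i hi'] : exists i, ~ (`|z ord0 i - x ord0 i| < rho).
  apply: contrapT => h; apply: nb; apply/mx_ballP => // i; apply: contrapT => h'.
  by apply: h; exists i.
apply/eqP; rewrite prodf_seq_eq0; apply/hasP; exists i; first by rewrite mem_index_enum.
move/negP: hi'; rewrite -leNgt distrC => h.
by rewrite /= max_l ?mulr0// subr_le0.
Qed.

Lemma tent_in z rho : 0 < rho -> exists2 c, 0 < c &
  forall x, ball z (rho / 2) x -> c <= tent z rho x.
Proof.
move=> r0; exists (\prod_i ((len i)^-1 * (rho / 2))).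
  by apply: prodr_gt0 => i _; rewrite mulr_gt0 ?invr_gt0 ?divr_gt0.
have r2 : 0 < rho / 2 by rewrite divr_gt0.
move=> x /(mx_ballP _ _ r2) h; apply: ler_prod => i _.
apply/andP; split; first by rewrite mulr_ge0 ?invr_ge0 ?ltW.
rewrite ler_pM2l ?invr_gt0// le_max; by apply/orP; right; have := h i; rewrite distrC; lra.
Qed.

End box_measure.

(** * The empirical objective *)

Section objective_formula.
Context {R : realType} {d : nat} (X : set 'rV[R]_d) (lo hi : 'rV[R]_d).
Hypotheses (lohi : forall i, lo ord0 i < hi ord0 i) (XQ : X `<=` rectangle lo hi).
Context {Y : choiceType} (g : Y -> R) {K : X -> X -> R} (H : rkhs K).

(** The squared residual with the integral over [Q] carried out. Separating [m] from the length of
    [S] lets the algebra run on plain sequences. *)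
Definition residual_form (m : nat) (S : seq (X * Y)) (f : X -> R) : R :=
  (m%:R ^+ 2)^-1 * \sum_(p <- S) \sum_(q <- S) (f p.1 - g p.2) * (f q.1 - g q.2) *
    box_gram lo hi (set_val p.1) (set_val q.1).

Lemma objectiveE (gam : R) m (S : m.-tuple (X * Y)) f :
  objective (rectangle lo hi) g H gam S f =
  (residual_form m S f + gam * rk_norm H f ^+ 2)%:E.
Proof.
rewrite /objective -box_measureE.
pose s := [seq (m%:R^-1 * (f z.1 - g z.2), set_val z.1) | z <- S].
have sQ p : p \in s -> rectangle lo hi p.2.
  by move=> /mapP[z _ ->] /=; apply: XQ; exact: set_valP.
have E a : empA S f a - empB g S a = \sum_(p <- s) p.1 * orthant p.2 a.
  rewrite /empA /empB -mulrBr -sumrB big_map big_tuple mulr_sumr.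
  by apply: eq_bigr => i _; rewrite /orthant/=; ring.
have mortho x : measurable_fun (rectangle lo hi : set (borel (0 : 'rV[R]_d))) (orthant x).
  by apply: measurable_funTS; exact: measurable_orthant.
have [I1 I2] := gram_quadratic (measurable_rectangle lo hi) (box_measure_lty lohi)
  mortho (@orthant_le1 R d) s.
rewrite EFinD; congr (_ + _)%E; under eq_integral do rewrite E.
rewrite -[LHS]fineK ?(integrable_fin_num _ I1)//; last exact: measurable_rectangle.
congr EFin; rewrite [LHS]I2 box_gram_quadratic// /residual_form big_map mulr_sumr.
apply: eq_bigr => p _; rewrite big_map mulr_sumr; apply: eq_bigr => q _ /=.
by rewrite -exprVn; ring.
Qed.

Lemma residual_form_ge0 m (S : seq (X * Y)) f : 0 <= residual_form m S f.
Proof.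
apply: mulr_ge0; first by rewrite invr_ge0 sqr_ge0.
have := @box_gram_ge0 R d lo hi lohi [seq (f z.1 - g z.2, set_val z.1) | z <- S].
rewrite big_map; under eq_bigr do rewrite big_map; apply.
by move=> _ /mapP[z _ ->] /=; apply: XQ; exact: set_valP.
Qed.

(** The same expansion for the squared norm of [A_S w]. *)
Definition empirical_form (m : nat) (S : seq (X * Y)) (w : X -> R) : R :=
  (m%:R ^+ 2)^-1 * \sum_(p <- S) \sum_(q <- S) w p.1 * w q.1 *
    box_gram lo hi (set_val p.1) (set_val q.1).

Lemma empirical_form_ge0 m (S : seq (X * Y)) w : 0 <= empirical_form m S w.
Proof.
apply: mulr_ge0; first by rewrite invr_ge0 sqr_ge0.
have := @box_gram_ge0 R d lo hi lohi [seq (w z.1, set_val z.1) | z <- S].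
rewrite big_map; under eq_bigr do rewrite big_map; apply.
by move=> _ /mapP[z _ ->] /=; apply: XQ; exact: set_valP.
Qed.

Lemma residual_parallelogram m (S : seq (X * Y)) f h :
  residual_form m S (fun x => 2^-1 * (f x + h x)) + empirical_form m S (f \- h) / 4 =
  (residual_form m S f + residual_form m S h) / 2.
Proof.
rewrite /residual_form /empirical_form -mulrDr -!mulrA -!mulrDr; congr (_ * _).
rewrite mulr_suml -big_split -big_split/= mulr_suml; apply: eq_bigr => p _.
rewrite mulr_suml -big_split -big_split/= mulr_suml; apply: eq_bigr => q _.
by field.
Qed.

Lemma empirical_form_le m (S : seq (X * Y)) f h :
  empirical_form m S (f \- h) <= 2 * (residual_form m S f + residual_form m S h).
Proof.
have := residual_parallelogram m S f h.
by have := residual_form_ge0 m S (fun x => 2^-1 * (f x + h x)); lra.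
Qed.

Lemma estimator_spec (gam : R) m (S : m.-tuple (X * Y)) : 0 < gam ->
  let f := estimator (rectangle lo hi) g H gam S in
  rk_car H f /\ forall h, rk_car H h ->
    residual_form m S f + gam * rk_norm H f ^+ 2 <=
    residual_form m S h + gam * rk_norm H h ^+ 2.
Proof.
move=> gam0 f.
have [||u v uv|f0 cf0 minf0] := rk_minimizer H (W := residual_form m S) gam0.
- by move=> h; exact: residual_form_ge0.
- move=> h1 h2; rewrite -residual_parallelogram lerDl.
  by rewrite divr_ge0//; exact: empirical_form_ge0.
- apply: cvgMr; apply: cvg_sum_seq => p _; apply: cvg_sum_seq => q _.
  by apply: cvgMl; apply: cvgM; apply: cvgB => //; exact: cvg_cst.
have ipE h : rk_car H h -> rk_norm H h ^+ 2 = rk_ip H h h.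
  by move=> ch; rewrite sqr_sqrtr// rk_ip_ge0.
have [cf minf] : rk_car H f /\ forall h, rk_car H h ->
    (objective (rectangle lo hi) g H gam S f <= objective (rectangle lo hi) g H gam S h)%E.
  apply: (@getPex _ [set f | rk_car H f /\ forall h, rk_car H h ->
    (objective (rectangle lo hi) g H gam S f <= objective (rectangle lo hi) g H gam S h)%E]).
  exists f0; split=> // h ch; rewrite !objectiveE lee_fin !ipE//; exact: minf0.
by split=> // h ch; have := minf h ch; rewrite !objectiveE lee_fin.
Qed.

End objective_formula.

(** * Dominated functions on a compact submanifold *)

Section submanifold.
Context {R : realType} {d n : nat} (X : set 'rV[R]_d) (K : X -> X -> R).
Hypotheses (cX : compact X) (smX : smooth_submanifold n X) (sK : smooth_kernel n K).

Lemma compact_set_type : compact [set: X].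
Proof.
move=> F PF _; have FX : (set_val @ F) X.
  by apply: (@filterS _ F _ setT _ _ filterT) => x _; exact: set_valP.
have [y [Xy Fy]] := cX (fmap_proper_filter _ PF) FX.
exists (SigSub (mem_set Xy)); split=> // B1 B2 FB1 /nbhs_ballP[e e0 eB].
have [||_ [[x B1x <-] xe]] := Fy (set_val @` B1) (ball y e).
- by apply: (@filterS _ F _ B1 _ _ FB1) => x B1x; exists x.
- exact: nbhsx_ballx.
- by exists x; split=> //; apply: eB.
Qed.

(** [K] is known to be regular only through charts. A chart maps open sets to open sets, so a
    property holding near [u] in the chart holds near its image in [X]. *)
Lemma chart_near (P : X -> X -> Prop) (z : X) :
  (forall (U : set 'rV[R]_n) (phi : 'rV[R]_n -> X) u, local_param U phi -> U u -> phi u = z ->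
     \forall w \near u, P z (phi w)) -> \forall x \near z, P z x.
Proof.
move=> h; have [U [phi [u [lp Uu uz]]]] := smX z.
have : nbhs u (fun w => P z (phi w)) := h U phi u lp Uu uz.
rewrite nbhsE => -[W [oW Wu] WP].
have oWU : open (phi @` (W `&` U)).
  by apply: (lp_image_open lp); [apply: openI => //; exact: lp_open lp|exact: subIsetr].
apply: (@filterS _ _ _ (phi @` (W `&` U))).
  by move=> _ [w [Ww _] <-]; exact: WP.
by apply: open_nbhs_nbhs; split=> //; exists u.
Qed.

Lemma kernel_chart_continuous (U : set 'rV[R]_n) (phi : 'rV[R]_n -> X) u :
  local_param U phi -> U u ->
  {for (u, u), continuous (fun p : 'rV[R]_n * 'rV[R]_n => K (phi p.1) (phi p.2))}.
Proof. by move=> lp Uu; have [] := sK lp lp [::] (x := (u, u)) (conj Uu Uu). Qed.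

(** The expression inside the norm is the squared Hilbert distance between [K z] and [K x], expanded
    by reproduction. *)
Lemma kernel_dist_near z (e : R) : 0 < e ->
  \forall x \near z, `|K z z - K z x - K x z + K x x| < e.
Proof.
move=> e0; apply: (chart_near (P := fun z x => `|K z z - K z x - K x z + K x x| < e)).
move=> U phi u lp Uu <-.
have ck := kernel_chart_continuous lp Uu.
have pairc := @cvg_pair _ _ _ (nbhs u) (nbhs u) (nbhs u) _ _ _.
have cp (f : 'rV[R]_n -> 'rV[R]_n * 'rV[R]_n) : f @ u --> (u, u) ->
   (fun w => K (phi (f w).1) (phi (f w).2)) @ u --> K (phi u) (phi u).
  by move=> cf; exact: (cvg_comp f _ cf ck).
have c : (fun w => K (phi u) (phi u) - K (phi u) (phi w) - K (phi w) (phi u) + K (phi w) (phi w))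
    @ u --> (K (phi u) (phi u) - K (phi u) (phi u) - K (phi u) (phi u) + K (phi u) (phi u)).
  apply: (@cvgD R _ _ (nbhs u) _).
    apply: (@cvgB R _ _ (nbhs u) _).
      apply: (@cvgB R _ _ (nbhs u) _); first exact: cvg_cst.
      by apply: (cp (fun w => (u, w))); apply: pairc => //; exact: cvg_cst.
    by apply: (cp (fun w => (w, u))); apply: pairc => //; exact: cvg_cst.
  by apply: (cp (fun w => (w, w))); exact: (@cvg_pair _ _ _ (nbhs u) (nbhs u) (nbhs u)).
have z0 : K (phi u) (phi u) - K (phi u) (phi u) - K (phi u) (phi u) + K (phi u) (phi u) = 0.
  by ring.
rewrite z0 in c; have /cvgr0Pnorm_lt := c; exact.
Qed.

Lemma kernel_dominated_near (B e : R) z : 0 < e ->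
  \forall x \near z, forall f, kernel_dominated K B f -> `|f x - f z| <= e.
Proof.
move=> e0; have C0 : 0 < B ^+ 2 + 1 by rewrite ltr_wpDl// sqr_ge0.
have : 0 < e ^+ 2 / (B ^+ 2 + 1) by rewrite divr_gt0// exprn_gt0.
move=> /(kernel_dist_near z); apply: filterS => x hx f Kf.
have h := kernel_dominated_dist z x Kf.
have h2 : (f z - f x) ^+ 2 <= e ^+ 2.
  apply: (le_trans h); apply: (@le_trans _ _ ((B ^+ 2 + 1) * (e ^+ 2 / (B ^+ 2 + 1)))); last first.
    by rewrite mulrC divfK// gt_eqF.
  have := ler_norm (K z z - K z x - K x z + K x x); set D := (_ + K x x) in hx *.
  move=> hD; have := sqr_ge0 B; set E := e ^+ 2 / _ in hx *.
  have := normr_ge0 D; nra.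
rewrite distrC; have : `|f z - f x| ^+ 2 <= e ^+ 2 by rewrite real_normK ?num_real.
by rewrite ler_pXn2r// nnegrE ltW.
Qed.

Lemma kernel_dominated_continuous B f : kernel_dominated K B f -> continuous f.
Proof.
move=> Kf z; apply/(@cvgrPdist_le R _ _ (nbhs z) _ f (f z)) => e e0.
have := kernel_dominated_near B z e0; by apply: filterS => x /(_ f Kf); rewrite distrC.
Qed.

Lemma kernel_diag_bounded : exists2 M, 0 < M & forall x, K x x <= M.
Proof.
have : \forall M \near +oo, forall x, setT x -> K x x <= M.
  have /compact_near_coveringP := compact_set_type; apply => z _.
  have [U [phi [u [lp Uu uz]]]] := smX z.
  have near1 : \forall x \near z, K x x <= K z z + 1.
    apply: (chart_near (P := fun z x => K x x <= K z z + 1)) => {lp Uu uz}U' phi' u' lp Uu <-.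
    have : (fun w => K (phi' w) (phi' w)) @ u' --> K (phi' u') (phi' u').
      apply: (cvg_comp (fun w => (w, w)) _ _ (kernel_chart_continuous lp Uu)).
      exact: (@cvg_pair _ _ _ (nbhs u') (nbhs u') (nbhs u')).
    move=> /cvgrPdist_le/(_ 1 ltr01); apply: filterS => w.
    by rewrite ler_norml => /andP[h _]; lra.
  exists ([set x | K x x <= K z z + 1], [set M | K z z + 1 <= M]).
    by split=> //=; exact: (nbhs_pinfty_ge (num_real _)).
  by move=> [x M] /= [h1 h2]; exact: le_trans h2.
move=> h; have [M [M0 hM]] := filter_ex (filterI (nbhs_pinfty_gt (num_real (0 : R))) h).
by exists M => // x; exact: hM.
Qed.

End submanifold.

(** * Lower bound of the empirical form by local masses *)

Section lower_bound.
Context {R : realType} {d n : nat} (X : set 'rV[R]_d) (K : X -> X -> R).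
Context {Y : choiceType} (lo hi : 'rV[R]_d).
Hypotheses (cX : compact X) (smX : smooth_submanifold n X) (sK : smooth_kernel n K).
Hypothesis XQ : X `<=` interior (rectangle lo hi).

Lemma submanifold_in_rectangle : X `<=` rectangle lo hi.
Proof. by move=> x /XQ /interior_subset. Qed.

Lemma interior_cube (z : X) : exists2 rho : R, 0 < rho &
  forall i, lo ord0 i <= set_val z ord0 i - rho /\ set_val z ord0 i + rho <= hi ord0 i.
Proof.
have /nbhs_ballP[e /= e0 eQ] := XQ (set_valP z).
exists (e / 2) => [|i]; first by rewrite divr_gt0.
have shift (t : R) : `|t| < e -> rectangle lo hi (set_val z + const_mx t).
  by move=> te; apply: eQ; apply/mx_ballP => // j; rewrite !mxE opprD addrA subrr sub0r normrN.
have e2 : `|e / 2| < e by rewrite ger0_norm; lra.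
have e2' : `|- (e / 2)| < e by rewrite normrN.
have := shift _ e2 i; have := shift _ e2' i; rewrite !mxE.
by move=> /andP[h _] /andP[_ h'].
Qed.

Lemma rectangle_lt (x0 : X) i : lo ord0 i < hi ord0 i.
Proof. by have [rho r0 /(_ i)[h1 h2]] := interior_cube x0; lra. Qed.

Lemma empirical_formN m (S : seq (X * Y)) (f : X -> R) :
  empirical_form lo hi m S (fun x => - f x) = empirical_form lo hi m S f.
Proof.
congr (_ * _); apply: eq_bigr => p _; apply: eq_bigr => q _.
by rewrite mulrNN.
Qed.

(* A dominated [f] with [e <= f x] near [z] stays above [e / 2] on a fixed ball
   around [z]; testing against the tent supported in that ball bounds the form
   from below. *)
Lemma form_lower_bound_near (B e : R) (z : X) : 0 < e ->
  exists rc : R * R, [/\ 0 < rc.1, 0 < rc.2 &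
    forall f, kernel_dominated K B f -> forall x, ball z rc.1 x -> e <= `|f x| ->
    forall m (S : seq (X * Y)),
    (rc.2 * (m%:R^-1 * \sum_(p <- S) \1_(ball z rc.1) p.1)) ^+ 2 <=
      empirical_form lo hi m S f].
Proof.
move=> e0.
(* Two points of the ball are compared through its centre, each at cost [e / 4], so [f] keeps at
   least [e / 2]. *)
have e4 : 0 < e / 4 by rewrite divr_gt0.
have /nbhs_ballP[r1 /= r10 near1] := kernel_dominated_near smX sK B z e4.
have [r2 r20 cube] := interior_cube z.
pose rho := Num.min r1 r2.
have rho0 : 0 < rho by rewrite lt_min r10.
have rho1 : rho <= r1 by rewrite ge_min lexx.
have rho2 : rho <= r2 by rewrite ge_min lexx orbT.
have [c c0 hc] := tent_in (rectangle_lt z) (set_val z) rho0.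
(* The mass is counted on the half ball, where the tent is at least [c]. On the rest of the ball of
   radius [rho] the tent and [f] are both nonnegative, and outside it the tent vanishes, so no other
   term is negative. *)
exists (rho / 2, e / 2 * c); split=> /=; [by rewrite divr_gt0|by rewrite mulr_gt0 ?divr_gt0|].
have rho20 : rho / 2 <= rho by lra.
have main f : kernel_dominated K B f -> forall x, ball z (rho / 2) x -> e <= f x ->
    forall m (S : seq (X * Y)),
    (e / 2 * c * (m%:R^-1 * \sum_(p <- S) \1_(ball z (rho / 2)) p.1)) ^+ 2 <=
      empirical_form lo hi m S f.
  move=> Kf x zx efx m S.
  have fx y : ball z rho y -> e / 2 <= f y.
    move=> zy; have := near1 y (le_ball rho1 zy) f Kf.
    have := near1 x (le_ball (le_trans rho20 rho1) zx) f Kf.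
    by rewrite !ler_norml => /andP[h1 h2] /andP[h3 h4]; lra.
  pose s := [seq (m%:R^-1 * f p.1, set_val p.1) | p <- S].
  have sQ p : p \in s -> rectangle lo hi p.2.
    by move=> /mapP[q _ ->]; apply: submanifold_in_rectangle; exact: set_valP.
  have tb := tent_bound (rectangle_lt z) sQ rho0
    (fun i => le_trans (cube i).1 (lerB (lexx _) rho2))
    (fun i => le_trans (lerD (lexx _) rho2) (cube i).2).
  apply: le_trans (le_trans tb _).
    rewrite ler_sqr ?nnegrE; last 2 first.
    - rewrite mulr_ge0//; first by rewrite mulr_ge0 ?divr_ge0 ?ltW.
      rewrite mulr_ge0 ?invr_ge0//.
      by elim/big_rec: _ => // p t _ t0; rewrite addr_ge0// indicE.
    - rewrite big_map; apply: sumr_ge0 => p _ /=.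
      have [zp|zp] := pselect (ball z rho p.1); last by rewrite tent_out// mulr0.
      rewrite mulr_ge0 ?tent_ge0//; last exact: rectangle_lt.
      by rewrite mulr_ge0 ?invr_ge0//; apply: le_trans (fx _ zp); rewrite divr_ge0 ?ltW.
    rewrite big_map mulrCA mulr_sumr mulr_sumr; apply: ler_sum => p _ /=.
    rewrite -[leRHS]mulrA ler_wpM2l ?invr_ge0// indicE.
    have [zp|zp] := pselect (ball z (rho / 2) p.1).
      rewrite mem_set// mulr1; apply: ler_pM; [by rewrite divr_ge0 ?ltW|exact: ltW| |exact: hc].
      by apply: fx; exact: le_ball zp.
    rewrite memNset// mulr0.
    have [zp'|zp'] := pselect (ball z rho p.1); last by rewrite tent_out// mulr0.
    rewrite mulr_ge0 ?tent_ge0//; last exact: rectangle_lt.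
    by apply: le_trans (fx _ zp'); rewrite divr_ge0 ?ltW.
  rewrite /empirical_form big_map mulr_sumr le_eqVlt; apply/orP; left; apply/eqP.
  apply: eq_bigr => p _; rewrite big_map mulr_sumr; apply: eq_bigr => q _ /=.
  by rewrite -exprVn; ring.
move=> f Kf x zx efx m S; have [f0|f0] := leP 0 (f x).
  by apply: (main _ Kf x zx); rewrite ger0_norm in efx.
rewrite -(empirical_formN m S f); apply: (main _ _ x zx); last by rewrite -ltr0_norm.
move=> s; rewrite (_ : \sum_(p <- s) _ = - \sum_(p <- s) p.1 * f p.2) ?sqrrN//.
by rewrite -sumrN; apply: eq_bigr => p _; rewrite mulrN.
Qed.

Lemma form_lower_bound (B e : R) : 0 < e ->
  exists (s : seq X) (rad c : X -> R), (forall z, 0 < rad z /\ 0 < c z) /\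
    forall f, kernel_dominated K B f -> forall x, e <= `|f x| ->
    exists2 z, z \in s & forall m (S : seq (X * Y)),
      (c z * (m%:R^-1 * \sum_(p <- S) \1_(ball z (rad z)) p.1)) ^+ 2 <=
      empirical_form lo hi m S f.
Proof.
move=> e0; have /choice[F hF] := fun z => form_lower_bound_near B z e0.
move: cX; rewrite compact_cover.
move=> /(_ X setT (fun z => interior (ball (set_val z) (F z).1))) [||D _ hD].
- by move=> z _; exact: open_interior.
- move=> x Xx; exists (SigSub (mem_set Xx)) => //.
  by have [r0 _ _] := hF (SigSub (mem_set Xx)); exact: nbhsx_ballx.
have /finite_seqP[s Ds] : finite_set [set` D] by exact: finite_fset.
exists s, (fun z => (F z).1), (fun z => (F z).2); split.
  by move=> z; have [] := hF z.
move=> f Kf x efx; have [z zD zx] := hD (set_val x) (set_valP x).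
exists z; first by rewrite Ds in zD.
by move=> m S; have [_ _ h] := hF z; apply: (h f Kf x) => //; exact: (interior_subset zx).
Qed.

End lower_bound.

(** * Concentration and conclusion *)

Section tails.
Context {R : realType} {d : nat} (X : set 'rV[R]_d) (x0 : X).
Context {dY : measure_display} {Y : measurableType dY} (lo hi : 'rV[R]_d).
Hypotheses (lohi : forall i, lo ord0 i < hi ord0 i) (XQ : X `<=` rectangle lo hi).
Local Notation Z := (borel x0 * Y)%type.
Variable mu : probability Z R.

Lemma measurable_set_val_coord i :
  measurable_fun (setT : set (borel x0)) (fun x : borel x0 => set_val (x : X) ord0 i).
Proof.
apply: continuous_borel_measurable => x.
apply: (@continuous_comp _ _ _ (set_val : X -> 'rV[R]_d) (fun v => v ord0 i)).
  exact: initial_continuous.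
exact: coord_continuous.
Qed.

Lemma measurable_box_gram {d' : measure_display} {T : measurableType d'} (f h : T -> borel x0) :
  measurable_fun setT f -> measurable_fun setT h ->
  measurable_fun setT (fun t => box_gram lo hi (set_val (f t : X)) (set_val (h t : X))).
Proof.
move=> mf mh; apply: measurable_prod => i _; apply: measurable_funM => //.
apply: measurable_funB => //; apply: measurable_maxr.
  exact: (measurableT_comp (measurable_set_val_coord i) mf).
exact: (measurableT_comp (measurable_set_val_coord i) mh).
Qed.

Lemma square_integrable_snd (g : Y -> R) (M : R) : measurable_fun setT g ->
  (\int[marginal2 mu]_y (`|g y| ^+ 2)%:E <= M%:E)%E ->
  mu.-integrable setT (EFin \o (fun z : Z => g z.2 ^+ 2)) /\
  Rintegral mu setT (fun z : Z => g z.2 ^+ 2) <= M.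
Proof.
move=> mg gM; have mg2 : measurable_fun setT (fun y => g y ^+ 2) by exact: measurable_funX.
have E : (\int[marginal2 mu]_y (g y ^+ 2)%:E = \int[mu]_z (g z.2 ^+ 2)%:E)%E.
  rewrite /marginal2 /distribution (ge0_integral_pushforward measurable_snd)//.
    exact/measurable_EFinP.
  by move=> y _; rewrite lee_fin sqr_ge0.
have E' : (\int[marginal2 mu]_y (`|g y| ^+ 2)%:E = \int[marginal2 mu]_y (g y ^+ 2)%:E)%E.
  by apply: eq_integral => y _; rewrite real_normK ?num_real.
have ig : mu.-integrable setT (EFin \o (fun z : Z => g z.2 ^+ 2)).
  apply: (@integrable_snd _ _ _ _ _ mu (fun y => g y ^+ 2)) => //.
  apply/integrableP; split; first exact/measurable_EFinP.
  apply: (@le_lt_trans _ _ M%:E); last exact: ltry.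
  apply: le_trans gM; rewrite E' le_eqVlt; apply/orP; left; apply/eqP.
  by apply: eq_integral => y _; rewrite /= ger0_norm// sqr_ge0.
split=> //; rewrite /Rintegral -lee_fin fineK; last exact: (integrable_fin_num _ ig).
by rewrite -E -E'.
Qed.

Lemma residual_tail (g : Y -> R) (f : X -> R) (B M : R) m (c : R) :
  measurable_fun setT g -> (marginal2 mu).-integrable setT (EFin \o g) ->
  (\int[marginal2 mu]_y (`|g y| ^+ 2)%:E <= M%:E)%E ->
  cond_exp_version g mu f -> continuous f -> (forall x, `|f x| <= B) ->
  (0 < m)%N -> 0 < c ->
  exists E : set (m.-tuple Z), [/\ measurable E,
    (power_measure mu m E <= ((2 * B ^+ 2 + 2 * M) / (m%:R * c))%:E)%E &
    forall S : m.-tuple Z, ~ E S -> residual_form lo hi g m S f < c].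
Proof.
move=> mg ig gM [k muk fk] cf fB m0 c0.
have mf : measurable_fun (setT : set (borel x0)) f by exact: continuous_borel_measurable.
pose w (z : Z) := f z.1 - g z.2.
pose G (z z' : Z) := box_gram lo hi (set_val (z.1 : X)) (set_val (z'.1 : X)).
have mw : measurable_fun setT w.
  by apply: measurable_funB; [exact: (measurableT_comp mf)|exact: (measurableT_comp mg)].
have mG : measurable_fun setT (fun p : Z * Z => G p.1 p.2).
  by apply: measurable_box_gram; apply: measurableT_comp => //; exact: measurable_fst.
have Q (z : Z) : rectangle lo hi (set_val (z.1 : X)) by apply: XQ; exact: set_valP.
have Gsym z z' : G z z' = G z' z by exact: box_gramC.
have Gle1 z z' : `|G z z'| <= 1.
  by have /andP[G0 G1] := box_gram01 lohi (Q z) (Q z'); rewrite ger0_norm.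
have [ig2 g2M] := square_integrable_snd mg gM.
have w_le z : w z ^+ 2 <= 2 * B ^+ 2 + 2 * g z.2 ^+ 2.
  have := fB z.1; rewrite ler_norml => /andP[h1 h2].
  by have := sqr_ge0 (f z.1 + g z.2); rewrite /w; nra.
have iub : mu.-integrable setT (EFin \o (fun z : Z => 2 * B ^+ 2 + 2 * g z.2 ^+ 2)).
  have i1 : mu.-integrable setT (EFin \o (fun z : Z => 2 * B ^+ 2)).
    by apply: (@bounded_integrable _ _ _ mu _ `|2 * B ^+ 2|) => // z.
  have i2 : mu.-integrable setT (EFin \o (fun z : Z => 2 * g z.2 ^+ 2)).
    by have := integrableZl measurableT 2 ig2; exact: eq_integrable.
  by have := integrableD measurableT i1 i2; exact: eq_integrable.
have w2 : mu.-integrable setT (EFin \o (fun z => w z ^+ 2)).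
  apply: le_integrable iub => //; first by apply/measurable_EFinP; exact: measurable_funX.
  move=> z _; rewrite /= lee_fin ger0_norm ?sqr_ge0// ger0_norm//.
  by apply: le_trans (w_le z); exact: sqr_ge0.
have Ew2 : Rintegral mu setT (fun z => w z ^+ 2) <= 2 * B ^+ 2 + 2 * M.
  apply: (le_trans (le_Rintegral measurableT w2 iub (fun z _ => w_le z))).
  rewrite RintegralD//; last 2 first.
  - by apply: (@bounded_integrable _ _ _ mu _ `|2 * B ^+ 2|) => // z.
  - by have := integrableZl measurableT 2 ig2; exact: eq_integrable.
  by rewrite Rintegral_probability_cst RintegralZl// lerD2l ler_pM2l.
(* With [z'] frozen, the Gram kernel is a function of the first component of [z] with values in
   [0, 1], hence an admissible [phi] for [cond_exp_orthogonal]. *)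
have wG0 z' : Rintegral mu setT (fun z => w z * G z z') = 0.
  apply: (cond_exp_orthogonal muk mg ig mf fB fk
    (phi := fun x => box_gram lo hi (set_val (x : X)) (set_val (z'.1 : X)))).
    by apply: measurable_box_gram => //; exact: measurable_cst.
  by move=> x; apply: box_gram01 => //; apply: XQ; exact: set_valP.
have wge0 s : 0 <= double_sum w G s.
  rewrite /double_sum; have := @box_gram_ge0 R d lo hi lohi [seq (w z, set_val (z.1 : X)) | z <- s].
  rewrite big_map; under eq_bigr do rewrite big_map; apply.
  by move=> _ /mapP[z _ ->]; exact: Q.
exists [set S | (c <= (m%:R ^+ 2)^-1 * double_sum w G S)%R]; split.
- exact: measurable_double_sum_ge.
- apply: (le_trans (double_sum_tail mw mG Gsym Gle1 w2 wG0 wge0 m0 c0)).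
  by rewrite lee_fin ler_wpM2r// invr_ge0 mulr_ge0// ltW.
- by move=> S /negP; rewrite -ltNge.
Qed.

(** Chebyshev's inequality, as the case [G = 1] of the degenerate double sum with [w] the indicator
    centred at its mean [a]. As [a] is at least [kappa], an average of at most [kappa / 2] deviates
    by at least [kappa / 2]. *)
Lemma mass_tail (U : set X) (kappa : R) m : measurable (U : set (borel x0)) ->
  0 < kappa -> (kappa%:E <= marginal1 mu U)%E -> (0 < m)%N ->
  exists E : set (m.-tuple Z), [/\ measurable E,
    (power_measure mu m E <= ((m%:R * (kappa / 2) ^+ 2)^-1)%:E)%E &
    forall S : m.-tuple Z, ~ E S ->
      kappa / 2 < m%:R^-1 * \sum_(p <- S) \1_U (p.1 : X)].
Proof.
move=> mU k0 kU m0.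
pose a := Rintegral mu setT (fun z : Z => \1_U (z.1 : X)).
have mI : measurable_fun setT (fun z : Z => \1_U (z.1 : X) : R).
  by apply: (measurableT_comp (measurable_indic mU)); exact: measurable_fst.
have I01 x : 0 <= (\1_U x : R) <= 1 by rewrite indicE; case: (_ \in _); rewrite ?lexx ?ler01.
have iI : mu.-integrable setT (EFin \o (fun z : Z => \1_U (z.1 : X) : R)).
  apply: (@bounded_integrable _ _ _ mu _ 1) => // z.
  by have /andP[h1 h2] := I01 z.1; rewrite ger0_norm.
have aE : a%:E = marginal1 mu U.
  rewrite /a /Rintegral fineK; last exact: (integrable_fin_num _ iI).
  have mP : measurable (fst @^-1` U : set Z).
    by rewrite -[X in measurable X]setTI; exact: measurable_fst.
  by have := integral_indic mu measurableT mP; rewrite setIT => h; exact: h.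
have ka : kappa <= a by rewrite -lee_fin aE.
have a01 : 0 <= a <= 1.
  have -> : 0 <= a by exact: le_trans (ltW k0) ka.
  by rewrite -lee_fin aE; exact: probability_le1.
pose w (z : Z) := \1_U (z.1 : X) - a.
have mw : measurable_fun setT w by exact: measurable_funB.
have w1 z : `|w z| <= 1.
  by have /andP[h1 h2] := I01 z.1; have /andP[h3 h4] := a01; rewrite ler_norml /w; lra.
have w21 z : w z ^+ 2 <= 1 by rewrite -real_normK ?num_real// expr_le1.
have w2 : mu.-integrable setT (EFin \o (fun z => w z ^+ 2)).
  apply: (@bounded_integrable _ _ _ mu _ 1); first exact: measurable_funX.
  by move=> z; rewrite ger0_norm ?sqr_ge0.
have i1 : mu.-integrable setT (EFin \o (fun z : Z => a)).
  by apply: (@bounded_integrable _ _ _ mu _ `|a|).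
have Ew2 : Rintegral mu setT (fun z => w z ^+ 2) <= 1.
  rewrite -[leRHS](Rintegral_probability_cst mu); apply: le_Rintegral => //.
  by apply: (@bounded_integrable _ _ _ mu _ 1) => // z; rewrite normr1.
pose G (_ _ : Z) : R := 1.
have wG0 (z' : Z) : Rintegral mu setT (fun z => w z * G z z') = 0.
  under eq_Rintegral do rewrite /G mulr1.
  by rewrite RintegralB// Rintegral_probability_cst subrr.
have dE s : double_sum w G s = (\sum_(z <- s) w z) ^+ 2.
  rewrite /double_sum expr2 mulr_suml; apply: eq_bigr => z _.
  by rewrite mulr_sumr; apply: eq_bigr => z' _; rewrite /G mulr1.
have wge0 s : 0 <= double_sum w G s by rewrite dE sqr_ge0.
have k20 : 0 < (kappa / 2) ^+ 2 by rewrite exprn_gt0// divr_gt0.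
have m0' : 0 < m%:R :> R by rewrite ltr0n.
exists [set S | ((kappa / 2) ^+ 2 <= (m%:R ^+ 2)^-1 * double_sum w G S)%R]; split.
- by apply: measurable_double_sum_ge => //; exact: measurable_cst.
- have G1 (z z' : Z) : `|G z z'| <= 1 by rewrite /G normr1.
  have mG : measurable_fun setT (fun p : Z * Z => G p.1 p.2) by exact: measurable_cst.
  have h := double_sum_tail mw mG (fun _ _ => erefl) G1 w2 wG0 wge0 m0 k20.
  apply: (le_trans h).
  by rewrite lee_fin -[leRHS]mul1r ler_wpM2r// invr_ge0 mulr_ge0// ltW.
- move=> S /negP; rewrite -ltNge dE => h.
  have mE : m%:R^-1 * \sum_(z <- S) w z = m%:R^-1 * (\sum_(p <- S) \1_U (p.1 : X)) - a.
    have Ea : \sum_(z <- S) a = m%:R * a.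
      by rewrite big_const_seq count_predT size_tuple iter_addr_0 mulr_natl.
    by rewrite /w sumrB Ea mulrBr mulKf// gt_eqF.
  rewrite ltNge; apply/negP => h2.
  have h3 : m%:R^-1 * (\sum_(z <- S) w z) <= - (kappa / 2) by rewrite mE; lra.
  move: h; rewrite -exprVn -exprMn; nra.
Qed.

End tails.

(** Eventually [gamma m <= 1] and [beta m * Num.sqrt (gamma m) >= 1], which force [beta m >= 1]. The
    denominator of the third condition is then at least [ln 2], so its numerator diverges; this
    numerator is the denominator of the Markov bounds. *)
Lemma rate_cvg (R : realType) (gamma : nat -> R) :
  (forall m, (0 < m)%N -> 0 < gamma m) ->
  (exists beta : nat -> R,
    [/\ forall m, (0 < m)%N -> 0 < beta m,
        gamma @ \oo --> (0 : R),
        (fun m => beta m * Num.sqrt (gamma m)) @ \oo --> +oo &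
        (fun m => m%:R * gamma m / (beta m ^+ 2 * ln m%:R)) @ \oo --> +oo]) ->
  gamma @ \oo --> (0 : R) /\ (fun m => m%:R * gamma m) @ \oo --> +oo.
Proof.
move=> gamma0 [beta [beta0 cg /cvgryPge cb /cvgryPge cm]]; split=> //.
have ln2 : 0 < ln 2 :> R by rewrite ln_gt0// ltr1n.
apply/cvgryPge => A; near=> m.
have m2 : (2 <= m)%N by near: m; exact: nbhs_infty_ge.
have m0 : (0 < m)%N by exact: leq_trans m2.
have g1 : gamma m <= 1.
  near: m; have /cvgrPdist_le/(_ 1 ltr01) := cg; apply: filterS => m.
  by rewrite sub0r normrN => h; exact: le_trans (ler_norm _) h.
have b1 : 1 <= beta m * Num.sqrt (gamma m) by near: m; exact: cb.
have h : `|A| / ln 2 <= m%:R * gamma m / (beta m ^+ 2 * ln m%:R) by near: m; exact: cm.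
have s1 : Num.sqrt (gamma m) <= 1 by rewrite -sqrtr1 ler_wsqrtr.
have bm1 : 1 <= beta m.
  by apply: (le_trans b1); rewrite ler_piMr// ltW// beta0.
have lnm : ln 2 <= ln m%:R :> R by rewrite ler_ln ?posrE ?ltr0n// ler_nat.
have b2 : 1 <= beta m ^+ 2 by rewrite expr_ge1// (le_trans ler01).
have bl : ln 2 <= beta m ^+ 2 * ln m%:R.
  by apply: (le_trans lnm); rewrite ler_peMl// (le_trans (ltW ln2)).
have bl0 : 0 < beta m ^+ 2 * ln m%:R by exact: lt_le_trans bl.
move: h; rewrite ler_pdivlMr// => h; apply: le_trans h.
apply: (le_trans (ler_norm A)); rewrite mulrAC -mulrA ler_peMr//.
by rewrite ler_pdivlMr// mul1r.
Unshelve. all: by end_near. Qed.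

Lemma union_tail (R : realType) (d : measure_display) (T : measurableType d)
    (nu : {measure set T -> \bar R}) (I : eqType) (s : seq I) (b : I -> R) (P : I -> T -> Prop) :
  (forall i, exists E, [/\ measurable E, (nu E <= (b i)%:E)%E & forall x, ~ E x -> P i x]) ->
  exists E, [/\ measurable E, (nu E <= (\sum_(i <- s) b i)%:E)%E &
    forall x, ~ E x -> forall i, i \in s -> P i x].
Proof.
move=> h; elim: s => [|i s [E [mE nE PE]]].
  by exists set0; rewrite big_nil measure0.
have [E' [mE' nE' PE']] := h i; exists (E' `|` E); split.
- exact: measurableU.
- by rewrite big_cons EFinD; apply: le_trans (measureU2 _ mE' mE) _; exact: leeD.
- move=> x /not_orP[xE' xE] j; rewrite inE => /orP[/eqP->|js]; first exact: PE'.
  exact: PE.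
Qed.

Section hilbert_bounds.
Context {R : realType} {T : choiceType} {K : T -> T -> R} (H : rkhs K).

Lemma rk_norm_sqr f : rk_car H f -> rk_norm H f ^+ 2 = rk_ip H f f.
Proof. by move=> cf; rewrite sqr_sqrtr// rk_ip_ge0. Qed.

Lemma rk_norm_sub_le f h : rk_car H f -> rk_car H h ->
  rk_norm H (f \- h) <= Num.sqrt (2 * (rk_norm H f ^+ 2 + rk_norm H h ^+ 2)).
Proof.
move=> cf ch; rewrite !rk_norm_sqr// ler_wsqrtr// rk_ip_sub2//.
have := rk_cauchy_schwarz cf ch; have := rk_ip_ge0 cf; have := rk_ip_ge0 ch.
move: (rk_ip H f f) (rk_ip H f h) (rk_ip H h h) => a c b b0 a0 h'.
rewrite leNgt; apply/negP => h2.
have : a + b < - (2 * c) by lra.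
have := sqr_ge0 (a - b); nra.
Qed.

Lemma rk_eval_norm f x C M : rk_car H f -> rk_norm H f <= C -> K x x <= M -> 0 <= M ->
  `|f x| <= C * Num.sqrt M.
Proof.
move=> cf fC KM M0; have f0 : 0 <= rk_norm H f by exact: sqrtr_ge0.
have C0 : 0 <= C by exact: le_trans fC.
rewrite -(ler_pXn2r (n := 2))// ?nnegrE ?mulr_ge0 ?sqrtr_ge0//.
rewrite real_normK ?num_real// exprMn sqr_sqrtr//; apply: (le_trans (rk_eval_le x cf)).
rewrite -rk_norm_sqr//; apply: ler_pM => //; first exact: sqr_ge0.
  exact: rk_kernel_ge0 H x.
by rewrite ler_pXn2r ?nnegrE.
Qed.

End hilbert_bounds.

(* Once the residual of [f] is below [gam], minimality bounds the norm of the
   estimator and makes the empirical form of its difference with [f] of order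
   [gam]. *)
Lemma estimator_difference (R : realType) (d : nat) (X : set 'rV[R]_d) (Y : choiceType)
    (lo hi : 'rV[R]_d) (g : Y -> R) (K : X -> X -> R) (H : rkhs K) (gam C : R) m
    (S : m.-tuple (X * Y)) (f : X -> R) :
  (forall i, lo ord0 i < hi ord0 i) -> X `<=` rectangle lo hi -> 0 < gam ->
  rk_car H f -> rk_norm H f <= C -> residual_form lo hi g m S f < gam ->
  let h := estimator (rectangle lo hi) g H gam S \- f in
  rk_norm H h <= Num.sqrt (2 * (1 + 2 * C ^+ 2)) /\
  empirical_form lo hi m S h <= 2 * gam * (2 + C ^+ 2).
Proof.
move=> lohi XQ gam0 cf fC resf /=.
have [cfS minS] := estimator_spec lohi XQ g H S gam0.
set fS := estimator _ g H gam S in cfS minS *.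
have nf : rk_norm H f ^+ 2 <= C ^+ 2.
  by rewrite ler_pXn2r ?nnegrE ?sqrtr_ge0//; apply: le_trans fC; exact: sqrtr_ge0.
have := minS f cf; have := residual_form_ge0 lohi XQ g m S fS.
have := empirical_form_le lohi XQ g m S fS f.
move: (residual_form _ _ _ _ _ fS) (residual_form _ _ _ _ _ f) resf => a b bgam e a0 hm.
have nf0 : 0 <= rk_norm H fS ^+ 2 by exact: sqr_ge0.
(* Comparing the objective at [fS] with its value at [f] gives [a + gam * rk_norm H fS ^+ 2 < gam *
   (1 + C ^+ 2)]. Dropping either nonnegative term on the left yields one of the two bounds. *)
have nS : rk_norm H fS ^+ 2 <= 1 + C ^+ 2.
  rewrite -(ler_pM2l gam0); apply: (@le_trans _ _ (b + gam * rk_norm H f ^+ 2)); first by lra.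
  by rewrite mulrDr mulr1 lerD ?(ltW bgam)// ler_pM2l.
split; last by nra.
apply: (le_trans (rk_norm_sub_le cfS cf)); rewrite ler_wsqrtr//; lra.
Qed.

(* The supremum over P0 is taken in [0, +oo], so that it is 0 for empty P0. *)
Theorem theorem3p10 (R : realType) (d n : nat) (X : set 'rV[R]_d) (x0 : X)
    (A : finite_atlas n X) (dY : measure_display) (Y : measurableType dY)
    (lo hi : 'rV[R]_d) (K : X -> X -> R) (H : rkhs K) (g : Y -> R)
    (gamma : nat -> R) (P0 : set (probability (borel x0 * Y)%type R)) :
  compact X -> smooth_submanifold n X ->
  X `<=` interior (rectangle lo hi) ->
  smooth_mercer_kernel n K ->
  measurable_fun setT g ->
  (forall m, (0 < m)%N -> 0 < gamma m) ->
  (exists beta : nat -> R,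
    [/\ forall m, (0 < m)%N -> 0 < beta m,
        gamma @ \oo --> (0 : R),
        (fun m => beta m * Num.sqrt (gamma m)) @ \oo --> +oo &
        (fun m => m%:R * gamma m / (beta m ^+ 2 * ln m%:R)) @ \oo --> +oo]) ->
  P0 `<=` PK g H ->
  (exists C0 M : R,
    [/\ 0 <= C0, 0 <= M,
        forall mu, P0 mu -> rk_norm H (regression g H mu) <= C0 &
        forall mu, P0 mu ->
          (\int[marginal2 mu]_y (`|g y| ^+ 2)%:E <= M%:E)%E]) ->
  (forall P : weak_proba R x0,
    closure (marginal1 @` P0 : set (weak_proba R x0)) P ->
    supp (P : probability (borel x0) R) = setT) ->
  forall (r : nat) (eps : R), 0 < eps ->
    (fun m => maxe 0%E (ereal_sup
       [set (power_measure mu m)^*%mu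
              [set S : m.-tuple (borel x0 * Y) |
                (eps%:E <= Cr_norm A r
                   (estimator (rectangle lo hi) g H (gamma m) S \-
                    regression g H mu)%R)%E]
        | mu in P0])) @ \oo --> 0%E.
Proof.
move=> cX smX XQ mercK mg gamma0 hbeta PKP [C0 [M [C00 M0 normC gM]]] suppP r eps eps0.
have [cg cmg] := rate_cvg gamma0 hbeta.
have sK := mk_smooth mercK.
have lohi := rectangle_lt XQ x0.
have XQ' := submanifold_in_rectangle XQ.
have [MK MK0 KM] := kernel_diag_bounded cX smX sK.
(* The norm bound of [estimator_difference]. It depends on [C0] only, so [eta], the finite cover,
   [kappa] and [delta] below are common to all measures of [P0]. *)
pose B := Num.sqrt (2 * (1 + 2 * C0 ^+ 2)).
(* The bad event is the non-strict [eps <= Cr_norm], so a non-strict upper bound must aim strictly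
   below [eps]. *)
have eps2 : 0 < eps / 2 by rewrite divr_gt0.
have [eta eta0 small] := Cr_norm_small A r B sK eps2.
have [s [rad [c [rc0 lower]]]] := form_lower_bound (Y := Y) cX smX sK XQ B eta0.
(* The uniform mass bound and Borel measurability are available for open sets; returning from the
   interior to the ball only increases the empirical mass. *)
pose U z : set X := interior (ball z (rad z)).
have oU z : open (U z) by exact: open_interior.
have /choice[kappa hkappa] : forall z, exists kappa : R, 0 < kappa /\
    forall mu, P0 mu -> (kappa%:E <= marginal1 mu (U z))%E.
  move=> z; have [|kap kap0 hk] := uniform_full_support (compact_set_type cX) suppP (oU z).
    by exists z; apply: nbhsx_ballx; have [] := rc0 z.
  by exists kap; split=> // mu Pmu; apply: hk; exists mu.
have regP mu : P0 mu -> rk_car H (regression g H mu) /\ cond_exp_version g mu (regression g H mu).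
  move=> /PKP[_ _ [f cf ef]].
  apply: (@getPex _ [set f | rk_car H f /\ cond_exp_version g mu f]).
  by exists f.
pose B0 := C0 * Num.sqrt MK.
pose b m z := (m%:R * (kappa z / 2) ^+ 2)^-1.
(* The numerators of all tail bounds over the common denominator [m * gamma m]; for the masses,
   whose denominator contains [m] alone, this uses [gamma m <= 1]. *)
pose D := 2 * B0 ^+ 2 + 2 * M + \sum_(z <- s) ((kappa z / 2) ^+ 2)^-1.
have D0 : 0 <= D.
  rewrite !addr_ge0 ?mulr_ge0 ?sqr_ge0//.
  by apply: sumr_ge0 => z _; rewrite invr_ge0 sqr_ge0.
have delta_near : \forall delta \near (0 : R)^'+,
    forall z, z \in s -> delta < (c z * (kappa z / 2)) ^+ 2.
  apply: (@near_seq R (0 : R)^'+ _ _ (fun z delta => delta < (c z * (kappa z / 2)) ^+ 2)) => z _.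
  apply: nbhs_right_lt; rewrite exprn_gt0// mulr_gt0 ?divr_gt0//; first by have [] := rc0 z.
  by have [] := hkappa z.
have [delta [delta0 hdelta]] := filter_ex (filterI (nbhs_right_gt (0 : R)) delta_near).
have gsmall : \forall m \near \oo, 2 * gamma m * (2 + C0 ^+ 2) < delta.
  have C1 : 0 < 2 * (2 + C0 ^+ 2) by rewrite mulr_gt0// ltr_wpDr// sqr_ge0.
  have d1 : 0 < delta / (2 * (2 + C0 ^+ 2)) by rewrite divr_gt0.
  have /cvgr0Pnorm_lt/(_ _ d1) := cg; apply: filterS => m /(le_lt_trans (ler_norm _)).
  by rewrite ltr_pdivlMr// mulrA [gamma m * 2]mulrC.
have bad_le m : (0 < m)%N -> gamma m <= 1 -> 2 * gamma m * (2 + C0 ^+ 2) < delta ->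
    forall mu, P0 mu -> ((power_measure mu m)^*%mu
      [set S : m.-tuple (borel x0 * Y) | (eps%:E <= Cr_norm A r
         (estimator (rectangle lo hi) g H (gamma m) S \- regression g H mu)%R)%E] <=
      (D / (m%:R * gamma m))%:E)%E.
  move=> m0 g1 gd mu Pmu.
  have [cf ef] := regP mu Pmu; set f := regression g H mu in cf ef *.
  have [_ ig _] := PKP mu Pmu.
  have fC : rk_norm H f <= C0 by exact: normC.
  have fcont : continuous f.
    exact: (kernel_dominated_continuous smX sK (rk_kernel_dominated cf fC)).
  have fB x : `|f x| <= B0 by apply: (rk_eval_norm cf fC (KM x)); exact: ltW.
  have [E1 [mE1 nE1 hE1]] := residual_tail lohi XQ' mg ig (gM mu Pmu) ef fcont fB m0 (gamma0 m m0).
  have mass z : exists E : set (m.-tuple (borel x0 * Y)), [/\ measurable E,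
      (power_sigma_finite mu m E <= (b m z)%:E)%E & forall S : m.-tuple (borel x0 * Y), ~ E S ->
        kappa z / 2 < m%:R^-1 * \sum_(p <- S) \1_(U z) (p.1 : X)].
    have [k0 hk] := hkappa z; rewrite power_sigma_finiteE.
    by apply: mass_tail => //; [exact: measurable_open|exact: hk].
  have [E2 [mE2 nE2 hE2]] := union_tail s mass.
  have m0' : 0 < m%:R :> R by rewrite ltr0n.
  have mg0 : 0 < m%:R * gamma m by rewrite mulr_gt0// gamma0.
  apply: (@le_trans _ _ (power_measure mu m (E1 `|` E2))).
    apply: mu_ext_le; first by rewrite -power_sigma_finiteE measure0.
      exact: measurableU.
    move=> S; rewrite /= => big; apply: contrapT => /not_orP[nE1S nE2S].
    have [nh eh] := estimator_difference lohi XQ' (gamma0 m m0) cf fC (hE1 S nE1S).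
    set h := _ \- _ in nh eh big.
    have [ch _] := estimator_spec lohi XQ' g H S (gamma0 m m0).
    have Kh : kernel_dominated K B h by apply: (rk_kernel_dominated (rk_sub ch cf)).
    have : (Cr_norm A r h <= (eps / 2)%:E)%E.
      apply: (small _ Kh) => x; rewrite leNgt; apply/negP => /ltW hx.
      have [z zs hz] := lower h Kh x hx.
      have [k0 _] := hkappa z; have [_ c0] := rc0 z.
      have hm := hE2 S nE2S z zs.
      have mono : \sum_(p <- S) \1_(U z) (p.1 : X) <=
          \sum_(p <- S) (\1_(ball z (rad z)) (p.1 : X) : R).
        apply: ler_sum => p _; rewrite !indicE.
        have [zp|_] := boolP ((p.1 : X) \in U z); last by rewrite ler0n.
        by rewrite mem_set//; apply: interior_subset; exact: set_mem.
      (* The contradiction: the form is also at most [2 * gamma m * (2 + C0 ^+ 2)], which is below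
         [delta], itself below this square. *)
      have : (c z * (kappa z / 2)) ^+ 2 <= empirical_form lo hi m S h.
        apply: le_trans (hz m S); rewrite ler_sqr ?nnegrE.
        - rewrite ler_pM2l//; apply: (le_trans (ltW hm)).
          by rewrite ler_pM2l ?invr_gt0.
        - by rewrite mulr_ge0 ?divr_ge0 ?ltW.
        - rewrite mulr_ge0 ?ltW// mulr_gt0 ?invr_gt0//.
          apply: lt_le_trans mono; rewrite -(pmulr_rgt0 _ (x := m%:R^-1)) ?invr_gt0//.
          by apply: lt_trans hm; rewrite divr_gt0.
      by have := hdelta z zs; lra.
    move=> /(le_trans big); rewrite lee_fin; lra.
  rewrite -power_sigma_finiteE; apply: le_trans (measureU2 _ mE1 mE2) _.
  have nE1' : (power_sigma_finite mu m E1 <= ((2 * B0 ^+ 2 + 2 * M) / (m%:R * gamma m))%:E)%E.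
    by rewrite power_sigma_finiteE.
  apply: le_trans (leeD nE1' nE2) _.
  rewrite -EFinD lee_fin /D [leRHS]mulrDl lerD2l mulr_suml; apply: ler_sum => z _.
  by rewrite /b invfM mulrC ler_wpM2l ?invr_ge0 ?sqr_ge0// lef_pV2 ?posrE// ler_piMr// ltW.
have cD : (fun m => (D / (m%:R * gamma m))%:E) @ \oo --> 0%E.
  apply: cvg_EFin; first by near=> m.
  have : (fun m => D * (m%:R * gamma m)^-1) @ \oo --> D * 0.
    apply: cvgMr; apply/gtr0_cvgV0 => //; near=> m.
    have m0 : (0 < m)%N by near: m; exact: nbhs_infty_gt.
    by rewrite mulr_gt0 ?ltr0n// gamma0.
  by rewrite mulr0.
apply: (squeeze_cvge _ (@cvg_cst _ 0%E _ \oo _) cD).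
near=> m; rewrite le_max lexx/= ge_max.
have m0 : (0 < m)%N by near: m; exact: nbhs_infty_gt.
apply/andP; split.
  by rewrite lee_fin divr_ge0// mulr_ge0// ltW// gamma0.
apply: ge_ereal_sup => _ [mu Pmu <-]; apply: bad_le => //; last by near: m.
near: m; have /cvgr0Pnorm_le/(_ 1 ltr01) := cg; apply: filterS => m.
exact: le_trans (ler_norm _).
Unshelve. all: by end_near. Qed.
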